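(* Let $d\ge 1$, let $\psi\in\mathcal P(\mathbb R^d)$ be real-valued and satisfy the Genericity Condition, and let $\gamma>0$. Let $\{\sigma_i\}_{i=1}^\infty$ be any sequence of positive real numbers with $\sigma_i\to\infty$. Then any real-valued $f\in\mathcal P_\gamma'(\mathbb R^d)\cap L^1(\mathbb R^d)$ is uniquely determined, up to a constant multiple, by the zero sets of the functions $f*\psi_{\sigma_i}$, $i\ge 1$. That is, if $f,g\in\mathcal P_\gamma'(\mathbb R^d)\cap L^1(\mathbb R^d)$ are real-valued and for every $i\ge1$ $$\{\mathbf x\in\mathbb R^d: f*\psi_{\sigma_i}(\mathbf x)=0\}=\{\mathbf x\in\mathbb R^d: g*\psi_{\sigma_i}(\mathbf x)=0\},$$ then $g=cf$ almost everywhere for some nonzero constant $c\in\mathbb R$.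
   Context: For a multiindex $\alpha=(\alpha_1,\dots,\alpha_d)$, $\psi^{(\alpha)}$ denotes the mixed partial derivative of $\psi$ of orders given by $\alpha$, and $|\alpha|=\alpha_1+\dots+\alpha_d$. For $\gamma>0$, $\mathcal P_\gamma=\mathcal P_\gamma(\mathbb R^d)$ is the space of smooth functions $\psi$ on $\mathbb R^d$ such that $\lim_{|\mathbf x|\to\infty}e^{-\gamma|\mathbf x|}\psi^{(\alpha)}(\mathbf x)=0$ for every multiindex $\alpha$, with topology generated by the seminorms $\|\psi\|_{\gamma,\alpha}=\sup_{\mathbf x}|e^{-\gamma|\mathbf x|}\psi^{(\alpha)}(\mathbf x)|$. $\mathcal P=\bigcap_{\gamma>0}\mathcal P_\gamma$, with topology generated by all seminorms $\|\cdot\|_{\gamma,\alpha}$ ($\gamma>0$, $\alpha$ a multiindex). $\mathcal P_\gamma'$ and $\mathcal P'$ are the topological duals; $\mathcal P_\gamma'\subset\mathcal P'$. An element of $\mathcal P_\gamma'\cap L^1(\mathbb R^d)$ is an integrable function $f$ whose associated distribution $\phi\mapsto\int f\phi$ (on compactly supported smooth $\phi$) extends to a (necessarily unique) element of $\mathcal P_\gamma'$, again denoted $f$. For $\sigma>0$, $\psi_\sigma(\mathbf x)=\sigma^{-d}\psi(\mathbf x/\sigma)$, and $f*\psi_\sigma(\mathbf x)=\langle f,\psi_\sigma(\mathbf x-\cdot)\rangle$. A regular zero of a real function $u$ on $\mathbb R^d$ is a point in every neighborhood of which $u$ takes both positive and negative values. A derivative of fixed order $n\ge0$ of $\psi$ is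 $\sum_{|\alpha|=n}C_\alpha\psi^{(\alpha)}$ with real constants $C_\alpha$ not all zero, i.e. a nonzero homogeneous constant-coefficient differential operator of order $n$ applied to $\psi$, considered modulo multiplication by a nonzero constant. Genericity Condition on $\psi$: for any $n,m\ge0$, the regular zero set of any derivative of $\psi$ of fixed order $n$ is not contained in the zero set of any other derivative of $\psi$ of fixed order $m$. Here two fixed-order derivatives are ''other'' (distinct) if their orders differ, or if their orders agree and their coefficient vectors $(C_\alpha)$ are not proportional. *)

(* Defs.v *)
From HB Require Import structures.
From mathcomp Require Import all_boot all_order all_algebra.
From mathcomp Require Import ring lra.
From mathcomp Require Import all_classical all_reals all_analysis.

Set Implicit Arguments.
Unset Strict Implicit.
Unset Printing Implicit Defensive.

Import Order.TTheory GRing.Theory Num.Theory.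
Import numFieldNormedType.Exports.

Local Open Scope classical_set_scope.
Local Open Scope ring_scope.

(* The product sigma-algebra on row vectors (the Borel sigma-algebra of R^d);
   the library has the same construction on tuples. *)
Section Rd_measure.
Variables (R : realType) (d : nat).

Let coor (i : 'I_d) (x : 'rV[R]_d) : measurableTypeR R := x ord0 i.

Let row_set0 : g_sigma_preimage coor set0.
Proof. exact: sigma_algebra0. Qed.

Let row_setC A : g_sigma_preimage coor A -> g_sigma_preimage coor (~` A).
Proof. exact: sigma_algebraC. Qed.

Let row_bigcup (F : (set 'rV[R]_d)^nat) :
  (forall i, g_sigma_preimage coor (F i)) ->
  g_sigma_preimage coor (\bigcup_i F i).
Proof. exact: sigma_algebra_bigcup. Qed.

HB.instance Definition _ := @isMeasurable.Build default_measure_display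
  'rV[R]_d (g_sigma_preimage coor) row_set0 row_setC row_bigcup.

Lemma measurable_coor (i : 'I_d) : measurable_fun [set: 'rV[R]_d] (coor i).
Proof.
move=> _ Y mY; rewrite setTI; apply: sub_sigma_algebra => /=.
rewrite -bigcup_seq/=; exists i => /=; first by rewrite mem_index_enum.
by exists Y => //; rewrite setTI.
Qed.

Lemma measurable_fun_row dT (T : measurableType dT) (f : T -> 'rV[R]_d) :
  (forall i, measurable_fun [set: T] (fun t => coor i (f t))) ->
  measurable_fun [set: T] f.
Proof.
move=> mf; suff : g_sigma_preimage (fun i => coor i \o f) `<=` measurable.
  rewrite g_sigma_preimage_comp => h _ A mA; apply: h.
  by exists A.
apply: smallest_sub; first exact: sigma_algebra_measurable.
rewrite -bigcup_seq => A [i _] [B mB <-].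
exact: mf.
Qed.

End Rd_measure.

Section lebesgue.
Variable R : realType.

Definition cons_row n (p : measurableTypeR R * 'rV[R]_n) : 'rV[R]_n.+1 :=
  \row_i oapp (p.2 ord0) p.1 (unlift ord0 i).

Let uncons_row n (x : 'rV[R]_n.+1) : measurableTypeR R * 'rV[R]_n :=
  (x ord0 ord0, \row_j x ord0 (lift ord0 j)).

Let cons_rowK n : cancel (@cons_row n) (@uncons_row n).
Proof.
move=> [a v]; rewrite /uncons_row mxE unlift_none; congr pair.
by apply/rowP => j; rewrite !mxE liftK.
Qed.

Lemma measurable_cons_row n : measurable_fun [set: _] (@cons_row n).
Proof.
apply: measurable_fun_row => i; case: (unliftP ord0 i) => [j|] -> /=.
  rewrite (_ : (fun _ => _) =
      (fun x : 'rV[R]_n => x ord0 j : measurableTypeR R) \o snd).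
    by apply: measurableT_comp; [exact: measurable_coor|exact: measurable_snd].
  by apply/funext => p; rewrite mxE liftK.
rewrite (_ : (fun _ => _) = fst); first exact: measurable_fst.
by apply/funext => p; rewrite mxE unlift_none.
Qed.

Let measurable_uncons_row n : measurable_fun [set: _] (@uncons_row n).
Proof.
apply/measurable_fun_pair => /=; first exact: measurable_coor.
apply: measurable_fun_row => j.
rewrite (_ : (fun _ => _) =
  (fun x : 'rV[R]_n.+1 => x ord0 (lift ord0 j) : measurableTypeR R)).
  exact: measurable_coor.
by apply/funext => x; rewrite mxE.
Qed.

Section step.
Variables (n : nat) (mu : {sigma_finite_measure set 'rV[R]_n -> \bar R}).

Definition lebesgue_step : set 'rV[R]_n.+1 -> \bar R :=
  pushforward (@lebesgue_measure R \x mu)%E (@cons_row n).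

Let step0 : lebesgue_step set0 = 0%E.
Proof. by rewrite /lebesgue_step /pushforward preimage_set0 measure0. Qed.

Let step_ge0 A : (0 <= lebesgue_step A)%E.
Proof. by rewrite /lebesgue_step /pushforward; exact: measure_ge0. Qed.

Let step_sigma_additive : semi_sigma_additive lebesgue_step.
Proof.
move=> F mF tF mUF; rewrite /lebesgue_step /pushforward preimage_bigcup.
apply: measure_semi_sigma_additive.
- by move=> k; rewrite -[X in measurable X]setTI; exact: measurable_cons_row.
- apply/trivIsetP => /= i j _ _ ij; rewrite -preimage_setI.
  by move/trivIsetP : tF => /(_ _ _ _ _ ij) ->//; rewrite preimage_set0.
- rewrite -preimage_bigcup -[X in measurable X]setTI.
  exact: measurable_cons_row.
Qed.

HB.instance Definition _ := isMeasure.Build _ _ _ lebesgue_step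
  step0 step_ge0 step_sigma_additive.

Let step_sigma_finite : sigma_finite setT lebesgue_step.
Proof.
have /sigma_finiteP[F [TF ndF Foo]] := sigma_finiteT (@lebesgue_measure R).
have /sigma_finiteP[G [TG ndG Goo]] := sigma_finiteT mu.
exists (fun k => @uncons_row n @^-1` (F k `*` G k)).
  rewrite -preimage_bigcup -(preimage_setT (@uncons_row n)).
  congr (_ @^-1` _); rewrite -setXTT TF TG predeqE => -[x y]; split.
    move=> [/= [k _ Fkx] [l _ Gly]]; exists (maxn k l) => //; split.
    - by move: x Fkx; exact/subsetPset/ndF/leq_maxl.
    - by move: y Gly; exact/subsetPset/ndG/leq_maxr.
  by move=> [k _ []/= ? ?]; split; exists k.
move=> k; have [mF Fk] := Foo k; have [mG Gk] := Goo k; split.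
  by rewrite -[X in measurable X]setTI; apply: measurable_uncons_row => //;
    exact: measurableX.
rewrite /lebesgue_step /pushforward -comp_preimage (_ : _ \o _ = id).
  by rewrite preimage_id product_measure1E// lte_mul_pinfty// ge0_fin_numE.
by apply/funext => p /=; rewrite cons_rowK.
Qed.

HB.instance Definition _ := Measure_isSigmaFinite.Build _ _ _ lebesgue_step
  step_sigma_finite.

End step.

(* d-dimensional Lebesgue measure as an iterated product measure. *)
Fixpoint lebesgue_row n : {sigma_finite_measure set 'rV[R]_n -> \bar R} :=
  if n is m.+1 then lebesgue_step (lebesgue_row m)
  else \d_(0 : 'rV[R]_0).

Lemma lebesgue_row_box n (A : 'I_n -> set (measurableTypeR R)) :
  (forall i, measurable (A i)) ->
  lebesgue_row n [set x | forall i, A i (x ord0 i)] =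
  (\prod_(i < n) lebesgue_measure (A i))%E.
Proof.
elim: n A => [|n IH] A mA.
  by rewrite big_ord0 /= diracE mem_set//; case.
have mB : measurable [set x : 'rV[R]_n |
    forall i, A (lift ord0 i) (x ord0 i)].
  rewrite (_ : mkset _ = \big[setI/setT]_(i < n)
      ((fun x : 'rV[R]_n => x ord0 i : measurableTypeR R) @^-1`
        A (lift ord0 i))).
    apply: bigsetI_measurable => i _.
    by rewrite -[X in measurable X]setTI; exact: measurable_coor.
  apply/seteqP; split => x; rewrite -bigcap_seq /= => Ax i.
    by move=> _; exact: Ax.
  by apply: (Ax i); rewrite /= mem_index_enum.
rewrite big_ord_recl -(IH (fun i => A (lift ord0 i)))// -product_measure1E//.
congr (product_measure1 _ _ _); apply/seteqP; split => -[a v] /=.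
  move=> Av; split; first by have := Av ord0; rewrite mxE unlift_none.
  by move=> i; have := Av (lift ord0 i); rewrite mxE liftK.
by move=> [Aa Av] i; rewrite mxE; case: unliftP => [j|] ->.
Qed.

End lebesgue.

Section euclidean_norm.
Variables (R : realType) (d : nat).
Implicit Types x y : 'rV[R]_d.

(* The library norm on row vectors is the sup norm. *)
Definition enorm x : R := Num.sqrt (\sum_i x ord0 i ^+ 2).

Lemma enorm_ge0 x : 0 <= enorm x.
Proof. exact: sqrtr_ge0. Qed.

Lemma enormN x : enorm (- x) = enorm x.
Proof. by congr Num.sqrt; apply: eq_bigr => i _; rewrite mxE sqrrN. Qed.

Lemma sqr_enorm x : enorm x ^+ 2 = \sum_i x ord0 i ^+ 2.
Proof. by rewrite sqr_sqrtr// sumr_ge0// => i _; rewrite sqr_ge0. Qed.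

Lemma enormZ c x : enorm (c *: x) = `|c| * enorm x.
Proof.
rewrite -sqrtr_sqr -sqrtrM ?sqr_ge0//; congr Num.sqrt.
by rewrite mulr_sumr; apply: eq_bigr => i _; rewrite mxE exprMn.
Qed.

Lemma coor_le_enorm x i : `|x ord0 i| <= enorm x.
Proof.
rewrite -ler_sqr ?nnegrE ?enorm_ge0// sqr_enorm real_normK ?num_real//.
by rewrite (bigD1 i)//= lerDl sumr_ge0// => j _; rewrite sqr_ge0.
Qed.

Let dot x y : R := \sum_i x ord0 i * y ord0 i.

Let dot_le x y : dot x y <= enorm x * enorm y.
Proof.
have [x0|x0] := eqVneq (enorm x) 0.
  rewrite x0 mul0r /dot big1// => i _.
  by have := coor_le_enorm x i; rewrite x0 normr_le0 => /eqP ->; rewrite mul0r.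
have [y0|y0] := eqVneq (enorm y) 0.
  rewrite y0 mulr0 /dot big1// => i _.
  by have := coor_le_enorm y i; rewrite y0 normr_le0 => /eqP ->; rewrite mulr0.
have xy0 : 0 < enorm x * enorm y.
  by rewrite mulr_gt0// lt_neqAle eq_sym ?x0 ?y0 enorm_ge0.
have : 0 <= \sum_i (enorm y * x ord0 i - enorm x * y ord0 i) ^+ 2.
  by rewrite sumr_ge0// => i _; rewrite sqr_ge0.
have -> : \sum_i (enorm y * x ord0 i - enorm x * y ord0 i) ^+ 2 =
    2 * (enorm x * enorm y) * (enorm x * enorm y - dot x y).
  transitivity (enorm y ^+ 2 * \sum_i x ord0 i ^+ 2
     + enorm x ^+ 2 * \sum_i y ord0 i ^+ 2
     - 2 * (enorm x * enorm y) * dot x y); last by rewrite -!sqr_enorm; ring.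
  rewrite /dot !mulr_sumr -sumrN -!big_split /=.
  by apply: eq_bigr => i _; ring.
by rewrite pmulr_rge0 ?subr_ge0// mulr_gt0.
Qed.

Lemma enormD x y : enorm (x + y) <= enorm x + enorm y.
Proof.
rewrite -ler_sqr ?nnegrE ?addr_ge0 ?enorm_ge0// sqr_enorm.
have -> : \sum_i (x + y) ord0 i ^+ 2 =
    enorm x ^+ 2 + enorm y ^+ 2 + 2 * dot x y.
  rewrite !sqr_enorm /dot mulr_sumr -!big_split /=.
  by apply: eq_bigr => i _; rewrite mxE; ring.
by have := dot_le x y; nra.
Qed.

Definition at_infinity : set_system 'rV[R]_d :=
  filter_from setT (fun M => [set x | M < enorm x]).

Global Instance at_infinity_filter : Filter at_infinity.
Proof.
apply: filter_from_filter; first by exists 0.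
move=> M N _ _; exists (Num.max M N) => // x /=.
by rewrite gt_max => /andP[].
Qed.

End euclidean_norm.
Arguments at_infinity {R d}.

Section derivatives.
Variables (R : realType) (d : nat).
Implicit Types (f g : 'rV[R]_d -> R) (s : seq 'I_d).

Definition multiindex : Type := {ffun 'I_d -> nat}.

HB.instance Definition _ := Choice.on multiindex.
HB.instance Definition _ := isPointed.Build multiindex [ffun=> 0%N].

Definition morder (a : multiindex) : nat := (\sum_i a i)%N.

Definition pderivs s f : 'rV[R]_d -> R :=
  foldr (fun i (g : 'rV[R]_d -> R) => 'D_(delta_mx ord0 i) g) f s.

Definition mderiv (a : multiindex) f : 'rV[R]_d -> R :=
  pderivs (flatten [seq nseq (a i) i | i <- enum 'I_d]) f.

Definition smooth f : Prop := forall s x, differentiable (pderivs s f) x.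

Lemma pderivs_linear s f g (c : R) : smooth f -> smooth g ->
  pderivs s (c *: f + g) = c *: pderivs s f + pderivs s g.
Proof.
move=> sf sg; elim: s => [//|i s IH] /=; rewrite IH; apply/funext => x.
have df := diff_derivable (sf s x) (v := delta_mx ord0 i).
have dg := diff_derivable (sg s x) (v := delta_mx ord0 i).
by rewrite deriveD ?deriveZ//; exact: derivableZ.
Qed.

Lemma smooth_linear f g (c : R) : smooth f -> smooth g -> smooth (c *: f + g).
Proof.
move=> sf sg s x; rewrite pderivs_linear//.
by apply: differentiableD; [apply: differentiableZ; exact: sf|exact: sg].
Qed.

Lemma pderivs0 s : pderivs s 0 = 0.
Proof.
elim: s => [//|i s IH] /=; rewrite IH; apply/funext => x.
exact: derive_cst.
Qed.

Lemma smooth0 : smooth 0.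
Proof. by move=> s x; rewrite pderivs0; exact: differentiable_cst. Qed.


Let affine (k : R) (v : 'rV[R]_d) (x : 'rV[R]_d) := k *: x + v.

Let is_diff_affine k v x : is_diff x (affine k v) ( *:%R k).
Proof.
rewrite /affine; apply: is_diff_eq; exact: addr0.
Qed.

Lemma differentiable_affine f (c k : R) (v : 'rV[R]_d) x :
  differentiable f (k *: x + v) ->
  differentiable (fun x => c * f (k *: x + v)) x.
Proof.
move=> df; apply: (@differentiableZ _ _ _ (f \o affine k v)).
exact: differentiable_comp.

Qed.

Lemma derive_affine f (c k : R) (v u : 'rV[R]_d) x :
  differentiable f (k *: x + v) ->
  'D_u (fun x => c * f (k *: x + v)) x = c * k * 'D_u f (k *: x + v).
Proof.
move=> df; have da := is_diff_affine k v x.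
have dfa : differentiable (f \o affine k v) x.
  exact: differentiable_comp.
rewrite (@deriveZ _ _ _ (f \o affine k v)); last exact: diff_derivable.
rewrite -[RHS]mulrA; congr (c * _).
rewrite deriveE// diff_comp//.
by rewrite /= diff_val linearZ/= deriveE.
Qed.

Lemma pderivs_affine s f (c k : R) (v : 'rV[R]_d) : smooth f ->
  pderivs s (fun x => c * f (k *: x + v)) =
  (fun x => c * k ^+ size s * pderivs s f (k *: x + v)).
Proof.
move=> sf; elim: s => [|i s IH] /=; first by rewrite expr0 mulr1.
rewrite IH; apply/funext => x; rewrite derive_affine; last exact: sf.
by rewrite -[c * _ * k]mulrA -exprSr.
Qed.

Lemma smooth_affine f (c k : R) (v : 'rV[R]_d) : smooth f ->
  smooth (fun x => c * f (k *: x + v)).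
Proof.
move=> sf s x; rewrite pderivs_affine//; apply: differentiable_affine.
exact: sf.
Qed.

End derivatives.

Section Pgamma.
Variables (R : realType) (d : nat).
Implicit Types (psi phi : 'rV[R]_d -> R) (gamma sigma : R).

Definition Pgamma_set gamma : set ('rV[R]_d -> R) :=
  [set psi | smooth psi /\ forall a : multiindex d,
    expR (- gamma * enorm x) * mderiv a psi x @[x --> at_infinity] --> 0].

Definition Pgamma_pred gamma : {pred 'rV[R]_d -> R} :=
  fun psi => `[< Pgamma_set gamma psi >].

Lemma Pgamma_submod_closed gamma : submod_closed (Pgamma_pred gamma).
Proof.
split=> [|c f g /asboolP[sf cf] /asboolP[sg cg]]; apply/asboolP; split.
- exact: smooth0.
- move=> a; rewrite /mderiv pderivs0.
  by under eq_cvg do rewrite mulr0; exact: cvg_cst.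
- exact: smooth_linear.
- move=> a; rewrite /mderiv pderivs_linear//.
  rewrite [X in _ --> X](_ : 0 = c * 0 + 0 :> R); last by rewrite mulr0 addr0.
  under eq_cvg do rewrite [(_ *: _ + _) _]/(_ * _ + _) mulrDr mulrCA.
  by apply: cvgD; [apply: cvgM; [exact: cvg_cst|exact: cf]|exact: cg].
Qed.

HB.instance Definition _ gamma := GRing.isSubmodClosed.Build R
  ('rV[R]_d -> R) (Pgamma_pred gamma) (Pgamma_submod_closed gamma).

Record Pgamma gamma := MkPgamma {
  Pgamma_fun :> 'rV[R]_d -> R;
  _ : Pgamma_fun \in Pgamma_pred gamma }.

HB.instance Definition _ gamma := [isSub for @Pgamma_fun gamma].
HB.instance Definition _ gamma := [Choice of Pgamma gamma by <:].
HB.instance Definition _ gamma :=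
  [SubChoice_isSubLmodule of Pgamma gamma by <:].
HB.instance Definition _ gamma := isPointed.Build (Pgamma gamma) 0.

Definition seminorm gamma (a : multiindex d) (psi : 'rV[R]_d -> R) : R :=
  sup (range (fun x => `|expR (- gamma * enorm x) * mderiv a psi x|)).

Definition seminorm_ball gamma (i : Pgamma gamma * multiindex d * R) :
  set (Pgamma gamma) :=
  [set phi | seminorm gamma i.1.2 (phi - i.1.1) < i.2].

(* The topology generated by the seminorms. *)
HB.instance Definition _ gamma := isSubBaseTopological.Build (Pgamma gamma)
  [set i : Pgamma gamma * multiindex d * R | 0 < i.2] (@seminorm_ball gamma).

Definition P_set : set ('rV[R]_d -> R) :=
  \bigcap_(gamma in [set gamma | 0 < gamma]) Pgamma_set gamma.

Definition dilate sigma psi : 'rV[R]_d -> R :=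
  fun x => (sigma ^+ d)^-1 * psi (sigma^-1 *: x).

Lemma Pgamma_dilate psi gamma sigma (x : 'rV[R]_d) : P_set psi -> 0 < gamma ->
  0 < sigma ->
  (fun y => dilate sigma psi (x - y)) \in Pgamma_pred gamma.
Proof.
move=> Ppsi g0 s0; apply/asboolP.
have [spsi _] := Ppsi _ g0.
have E : (fun y => dilate sigma psi (x - y)) =
  (fun y => (sigma ^+ d)^-1 * psi (- sigma^-1 *: y + sigma^-1 *: x)).
  by apply/funext => y; rewrite /dilate scalerBr scaleNr addrC.
rewrite E; split=> [|a]; first exact: smooth_affine.
rewrite /mderiv pderivs_affine//.
set s := flatten _; set C0 := (_ * _ ^+ size s).
have [C CE] : exists C, C = C0 by exists C0.
rewrite -CE {C0 CE}.
have [_ /(_ a)] := Ppsi _ (mulr_gt0 g0 s0).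
rewrite /mderiv -/s => cpsi.
pose K := expR (gamma * enorm x) * `|C|.
have K0 : 0 <= K by rewrite mulr_ge0// expR_ge0.
have K1 : 0 < K + 1 by rewrite ltr_wpDl.
apply/cvgr0Pnorm_lt => e e0.
have /cvgr0Pnorm_lt/(_ (e / (K + 1)) (divr_gt0 e0 K1)) [M _ HM] := cpsi.
exists (sigma * M + enorm x) => // y /= yM.
set z := - sigma^-1 *: y + sigma^-1 *: x.
have zE : sigma *: z = x - y.
  rewrite /z scalerDr !scalerA mulrN divff ?gt_eqF//.
  by rewrite scaleN1r scale1r addrC.
have nz : sigma * enorm z = enorm (x - y).
  by rewrite -zE enormZ gtr0_norm.
have /HM /= zM : M < enorm z.
  rewrite -(ltr_pM2l s0) nz.
  have := enormD (y - x) x; rewrite subrK -(enormN (y - x)) opprB; lra.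
rewrite normrM (ger0_norm (expR_ge0 _)) in zM.
rewrite !normrM (ger0_norm (expR_ge0 _)).
have ey : expR (- gamma * enorm y) <=
    expR (gamma * enorm x) * expR (- (gamma * sigma) * enorm z).
  rewrite -expRD ler_expR.
  have -> : - (gamma * sigma) * enorm z = - gamma * enorm (x - y).
    by rewrite -nz; ring.
  by have := enormD x (- y); rewrite enormN; nra.
apply: (@le_lt_trans _ _ (K * (expR (- (gamma * sigma) * enorm z) *
    `|pderivs s psi z|))).
  rewrite (_ : K * _ = (expR (gamma * enorm x) *
    expR (- (gamma * sigma) * enorm z)) * (`|C| * `|pderivs s psi z|)).
    by apply: ler_wpM2r => //; exact: mulr_ge0.
  by rewrite /K; ring.
have [->|K00] := eqVneq K 0; first by rewrite mul0r.
have Kp : 0 < K by rewrite lt_neqAle eq_sym K00.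
apply: (@lt_le_trans _ _ (K * (e / (K + 1)))); first by rewrite ltr_pM2l.
by rewrite mulrCA ger_pMr// ler_pdivrMr// mul1r lerDl.
Qed.

(* f * psi_sigma (x) = <f, psi_sigma (x - .)>, with F the extension of f. *)
Definition convolution gamma (F : Pgamma gamma -> R) psi sigma (hpsi : P_set psi)
    (hgamma : 0 < gamma) (hsigma : 0 < sigma) (x : 'rV[R]_d) : R :=
  F (MkPgamma (Pgamma_dilate x hpsi hgamma hsigma)).

Lemma enorm_le_norm (x : 'rV[R]_d) : enorm x <= d%:R * `|x|.
Proof.
rewrite -ler_sqr ?nnegrE ?enorm_ge0 ?mulr_ge0// sqr_enorm.
have xi i : x ord0 i ^+ 2 <= `|x| ^+ 2.
  rewrite -[leLHS]real_normK ?num_real// ler_sqr ?nnegrE//.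
  rewrite [leRHS]/Num.norm/= mx_normrE.
  exact: (le_bigmax _ (fun ij => `|x ij.1 ij.2|) (ord0, i)).
apply: (@le_trans _ _ (\sum_(i < d) `|x| ^+ 2)); first exact: ler_sum.
rewrite sumr_const card_ord exprMn -[leLHS]mulr_natl; apply: ler_wpM2r;
  first exact: sqr_ge0.
by rewrite -natrX ler_nat expnS expn1; case: (d) => // n; rewrite leq_pmulr.
Qed.

Definition test_function phi : Prop :=
  smooth phi /\ compact (closure [set x | phi x != 0]).

Lemma pderivs_support s phi (x : 'rV[R]_d) :
  ~ closure [set x | phi x != 0] x -> pderivs s phi x = 0.
Proof.
elim: s x => [|i s IH] x /= xS.
  by apply: contrapT => /eqP px; apply: xS; exact: subset_closure.
have oS : open (~` closure [set x | phi x != 0]).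
  by apply: closed_openC; exact: closed_closure.
rewrite -[RHS](derive_cst (0 : R^o) x (delta_mx ord0 i)).
apply: near_eq_derive.
apply: filterS (open_nbhs_nbhs (conj oS xS)) => y yS /=.
exact: IH.
Qed.

Lemma test_Pgamma gamma phi : test_function phi -> phi \in Pgamma_pred gamma.
Proof.
move=> [sphi cphi]; apply/asboolP; split=> // a.
have /(@compact_bounded R 'rV[R]_d)[M [_ HM]] := cphi.
apply/cvgr0Pnorm_lt => e e0.
exists (d%:R * (M + 1)) => // x /= Mx.
rewrite /mderiv pderivs_support ?mulr0 ?normr0// => xS.
have /(_ _ xS)/= xM := HM (M + 1) ltac:(by rewrite ltrDl).
have := enorm_le_norm x.
have : d%:R * `|x| <= d%:R * (M + 1) by exact: ler_wpM2l.
lra.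
Qed.

(* F is the element of the dual of P_gamma that the integrable function f
   determines. *)
Definition Pgamma_dual_L1 gamma (f : 'rV[R]_d -> R)
    (F : {linear Pgamma gamma -> R^o}) : Prop :=
  [/\ (lebesgue_row R d).-integrable setT (EFin \o f),
      continuous F &
      forall phi (tphi : test_function phi),
        F (MkPgamma (test_Pgamma gamma tphi)) =
        \int[lebesgue_row R d]_x (f x * phi x)].

End Pgamma.

Section genericity.
Variables (R : realType) (d : nat).
Implicit Types (u psi : 'rV[R]_d -> R) (C : multiindex d -> R).

Definition regular_zero u : set 'rV[R]_d :=
  [set x | forall U, nbhs x U ->
    (exists2 y, U y & 0 < u y) /\ (exists2 y, U y & u y < 0)].

(* Only the values of C at multiindices of order n matter. *)
Definition order_deriv n C psi : 'rV[R]_d -> R :=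
  fun x => \sum_(a \in [set a | morder a = n]) C a * mderiv a psi x.

Definition nonzero_coefs n C : Prop :=
  exists2 a : multiindex d, morder a = n & C a != 0.

Definition proportional n C C' : Prop :=
  exists c : R, forall a, morder a = n -> C' a = c * C a.

Definition genericity psi : Prop :=
  forall n m C C', nonzero_coefs n C -> nonzero_coefs m C' ->
    (n <> m \/ ~ proportional n C C') ->
    ~ (regular_zero (order_deriv n C psi) `<=`
       [set x | order_deriv m C' psi x = 0]).

End genericity.

(* Main.v *)
From HB Require Import structures.
Require Import Defs.
From mathcomp Require Import all_boot all_order all_algebra.
From mathcomp Require Import ring lra.
From mathcomp Require Import all_classical all_reals all_analysis.
From mathcomp Require Import measurable_realfun.

Import Order.TTheory GRing.Theory Num.Theory.
Import numFieldNormedType.Exports.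

Local Open Scope classical_set_scope.
Local Open Scope ring_scope.

Set Implicit Arguments.
Unset Strict Implicit.
Unset Printing Implicit Defensive.

(* The blurred function f * psi_sigma, rescaled to x |-> <f, psi (x - s .)> with
   s = 1 / sigma, has the asymptotic expansion
     sum_k (-s)^k / k! * sum_{|w| = k} <f, y^w> (d^w psi)(x)
   as s -> 0, locally uniformly in x.  Let n be the least order of a nonzero moment
   of f, and m that of g.  Near a regular zero of the leading coefficient for f, which is
   a derivative of psi of order n, the blurred f changes sign for small s; so it
   vanishes nearby, hence the blurred g does as well, and the leading coefficient for
   g vanishes there.  By genericity n = m and the two leading coefficients are
   proportional, with ratio c.  The same argument for the pair (f, g - c f), whose moments of
   order n vanish, shows that all moments of g - c f vanish.

   A function all of whose moments vanish is zero: a cosine of small frequency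
   is the limit in P_gamma of its Taylor polynomials, so one gets <f, p T> = 0 for
   every polynomial p and every finite product T of such cosines, by adding one factor
   at a time.  The sets where finitely many of these cosines are positive form a
   pi-system generating the Borel sets, and f integrates to zero over each of them. *)

(** * Partial derivatives *)

(** The functional is only continuous on P_gamma, and f times a polynomial need not be integrable,
    so a moment <f, y^w> is a value of the extension and not an integral. Every limit is therefore
    taken in weighted C^N norms ([jet_le]), where continuity reads [|L phi| <= C * M]. Integrals of
    f enter only through bounded functions, which is why the moments are turned into statements
    about cosines. The growth allowance gamma is shared between the factors of a product. The Taylor
    polynomials of cos (h t) converge with an error of order 2^-m e^(2 h |t|), so a frequency h <=
    gamma / 4 spends half of gamma. The other half is left to the remaining factors, whose product
    has arbitrarily small exponential rate however many they are. Frequencies stay bounded but the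
    number of factors does not, so all polynomials in a cosine become available, and these
    approximate the indicator of the set where the cosine is positive. *)

Section partial_derivatives.
Variables (R : realType) (d : nat).
Implicit Types (phi psi : 'rV[R]_d -> R) (D E : 'I_d -> 'rV[R]_d -> R).

(** Carrying candidate partials [D] along with differentiability lets derivatives be computed by
    composing rules and adjusted pointwise with [has_partials_eq]. *)
Definition has_partials phi D : Prop := forall x,
  differentiable phi x /\ forall i, 'D_(delta_mx ord0 i) phi x = D i x.

Lemma has_partials_diff phi : (forall x, differentiable phi x) ->
  has_partials phi (fun i => 'D_(delta_mx ord0 i) phi).
Proof. by move=> dphi x; split. Qed.

Lemma has_partialsE phi D : has_partials phi D ->
  forall i, 'D_(delta_mx ord0 i) phi = D i.
Proof. by move=> h i; apply/funext => x; have [_ ->] := h x. Qed.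

Lemma has_partials_eq phi psi D E : phi =1 psi -> D =2 E ->
  has_partials phi D -> has_partials psi E.
Proof.
move=> /funext -> DE; suff -> : D = E by [].
by apply/funext => i; apply/funext => x; rewrite DE.
Qed.

Lemma has_partials_cst (c : R) : has_partials (fun=> c) (fun=> fun=> 0).
Proof.
move=> x; split; first exact: differentiable_cst.
by move=> i; exact: derive_cst.
Qed.

Lemma has_partialsD phi psi D E : has_partials phi D -> has_partials psi E ->
  has_partials (fun x => phi x + psi x) (fun i x => D i x + E i x).
Proof.
move=> hD hE x; have [d1 e1] := hD x; have [d2 e2] := hE x; split.
  exact: differentiableD.
move=> i; rewrite -e1 -e2.
by rewrite (@deriveD _ _ _ phi psi) //; exact: diff_derivable.
Qed.

Lemma has_partialsM phi psi D E : has_partials phi D -> has_partials psi E ->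
  has_partials (fun x => phi x * psi x)
    (fun i x => D i x * psi x + phi x * E i x).
Proof.
move=> hD hE x; have [d1 e1] := hD x; have [d2 e2] := hE x; split.
  exact: differentiableM.
move=> i; rewrite -e1 -e2.
rewrite (@deriveM _ _ phi psi); try exact: diff_derivable.
by rewrite addrC [X in X + _ = _]mulrC.
Qed.

Lemma has_partialsZ c phi D : has_partials phi D ->
  has_partials (fun x => c * phi x) (fun i x => c * D i x).
Proof.
move=> hD; apply: has_partials_eq (has_partialsM (has_partials_cst c) hD) => //.
by move=> i x; rewrite mul0r add0r.
Qed.

Lemma has_partialsB phi psi D E : has_partials phi D -> has_partials psi E ->
  has_partials (fun x => phi x - psi x) (fun i x => D i x - E i x).
Proof.
move=> hD hE; apply: has_partials_eq (has_partialsD hD (has_partialsZ (-1) hE)).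
  by move=> x; rewrite mulN1r.
by move=> i x; rewrite mulN1r.
Qed.

Lemma has_partials_sum (I : Type) (r : seq I) (phi : I -> 'rV[R]_d -> R)
  (D : I -> 'I_d -> 'rV[R]_d -> R) : (forall k, has_partials (phi k) (D k)) ->
  has_partials (fun x => \sum_(k <- r) phi k x)
    (fun i x => \sum_(k <- r) D k i x).
Proof.
move=> h; elim: r => [|k r IH].
  by apply: has_partials_eq (has_partials_cst 0) => [x|i x]; rewrite big_nil.
by apply: has_partials_eq (has_partialsD (h k) IH) => [x|i x]; rewrite big_cons.
Qed.

Lemma has_partials_coor j : has_partials (fun x : 'rV[R]_d => x ord0 j)
  (fun i _ => (i == j)%:R).
Proof.
move=> x; split; first exact: differentiable_coord.
move=> i; rewrite deriveE; last exact: differentiable_coord.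
have lin_coor : linear (fun N : 'rV[R]_d => N ord0 j : R^o).
  by move=> a u w; rewrite !mxE.
pose coorL := GRing.isLinear.Build _ _ _ _ _ lin_coor.
pose f : {linear 'rV[R]_d -> R^o} :=
  HB.pack (fun N : 'rV[R]_d => N ord0 j : R^o) coorL.
rewrite (_ : (fun x => _) = f :> ('rV[R]_d -> R)) // diff_lin; last exact: coord_continuous.
by rewrite /= mxE eqxx /= eq_sym.
Qed.

Lemma has_partials_affine phi D (k : R) v : has_partials phi D ->
  has_partials (fun x => phi (k *: x + v)) (fun i x => k * D i (k *: x + v)).
Proof.
move=> hD x; have [d1 e1] := hD (k *: x + v).
have := @differentiable_affine _ _ phi 1 k v x d1.
under eq_fun do rewrite mul1r.
move=> da; split=> // i; rewrite -e1.
have := @derive_affine _ _ phi 1 k v (delta_mx ord0 i) x d1.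
by under eq_fun do rewrite mul1r; rewrite mul1r.
Qed.

Lemma has_partials_comp phi D (u u' : R -> R) :
  (forall t : R, is_derive t 1 u (u' t)) -> has_partials phi D ->
  has_partials (fun x => u (phi x)) (fun i x => u' (phi x) * D i x).
Proof.
move=> hu hD x; have [d1 e1] := hD x.
have du : differentiable u (phi x).
  by apply/derivable1_diffP; have [] := hu (phi x).
split; first exact: differentiable_comp.
move=> i; rewrite -e1 deriveE; last exact: differentiable_comp.
rewrite (@diff_comp _ _ _ _ phi u)// deriveE//= deriv1E; last first.
  by apply/derivable1_diffP.
by rewrite derive1E (@derive_val _ _ _ _ _ _ _ (hu (phi x))) mulrC.
Qed.

Lemma row_sum_basis (v : 'rV[R]_d) :
  v = \sum_j v ord0 j *: delta_mx ord0 j.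
Proof.
apply/rowP => i; rewrite summxE (bigD1 i)//= !mxE !eqxx mulr1 big1 ?addr0// => j.
by move=> ji; rewrite !mxE (eq_sym i) (negbTE ji) andbF mulr0.
Qed.

Lemma is_derive_line phi D x v (t : R) : has_partials phi D ->
  is_derive t 1 (fun t => phi (t *: v + x)) (\sum_j v ord0 j * D j (t *: v + x)).
Proof.
move=> hD; have [d1 e1] := hD (t *: v + x).
have hl : is_diff t (fun t : R => t *: v + x) (fun s => s *: v).
  by apply: is_diff_eq; rewrite addr0.
have dl : differentiable (fun t : R => t *: v + x) t by [].
have dc : differentiable (phi \o (fun t : R => t *: v + x)) t.
  exact: differentiable_comp.
apply: DeriveDef; first by apply: diff_derivable.
rewrite deriveE// diff_comp//= diff_val scale1r.
rewrite [X in 'd phi _ X](row_sum_basis v) linear_sum.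
by apply: eq_bigr => j _; rewrite linearZ /= -deriveE// e1.
Qed.

Lemma mean_value phi D x v : has_partials phi D ->
  exists2 t : R, 0 <= t <= 1 &
    phi (x + v) - phi x = \sum_j v ord0 j * D j (x + t *: v).
Proof.
move=> hD.
have [] := @MVT_segment R (fun t => phi (t *: v + x))
  (fun t => \sum_j v ord0 j * D j (t *: v + x)) 0 1 ler01.
- by move=> t _; exact: is_derive_line.
- apply: derivable_within_continuous => t _.
  by have [] := is_derive_line x v t hD.
move=> t; rewrite in_itv/= => t01; rewrite subr0 mulr1 scale1r scale0r add0r.
by rewrite (addrC v) (addrC _ x) => ->; exists t.
Qed.

End partial_derivatives.

(** * Symmetry of second partial derivatives *)

Section schwarz.
Variables (R : realType) (d : nat).
Implicit Types (phi : 'rV[R]_d -> R) (D : 'I_d -> 'rV[R]_d -> R).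

Lemma has_partials_shift phi D v : has_partials phi D ->
  has_partials (fun x => phi (x + v)) (fun i x => D i (x + v)).
Proof.
move=> hD; apply: has_partials_eq (has_partials_affine 1 v hD) => [x|i x].
  by rewrite scale1r.
by rewrite scale1r mul1r.
Qed.

Lemma sum_basis (h : R) (i : 'I_d) (F : 'I_d -> R) :
  \sum_j (h *: delta_mx ord0 i : 'rV[R]_d) ord0 j * F j = h * F i.
Proof.
rewrite (bigD1 i)//= !mxE !eqxx mulr1 big1 ?addr0// => j ji.
by rewrite !mxE (negbTE ji) andbF mulr0 mul0r.
Qed.

(** The mean value theorem is used twice: along e_i for the increment [phi (x + v) - phi x], then
    along e_j for [D i]. *)
Lemma second_difference phi D E i j x (h : R) :
  has_partials phi D -> has_partials (D i) E ->
  exists s t : R, [/\ 0 <= s <= 1, 0 <= t <= 1 &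
   phi (x + h *: delta_mx ord0 i + h *: delta_mx ord0 j)
     - phi (x + h *: delta_mx ord0 i)
     - (phi (x + h *: delta_mx ord0 j) - phi x) =
   h ^+ 2 * E j (x + s *: (h *: delta_mx ord0 i) + t *: (h *: delta_mx ord0 j))].
Proof.
move=> hD hE; set u := h *: delta_mx ord0 i; set v := h *: delta_mx ord0 j.
have [s s01 Hs] := mean_value x u (has_partialsB (has_partials_shift v hD) hD).
have [t t01 Ht] := mean_value (x + s *: u) v hE.
exists s, t; split=> //; rewrite Hs sum_basis Ht sum_basis.
by rewrite mulrA -expr2.
Qed.

(** The second difference is symmetric in [i] and [j], so [E i j] and [E j i] take a common value at
    two points arbitrarily close to [x]; continuity concludes. *)
Lemma schwarz phi D (E : 'I_d -> 'I_d -> 'rV[R]_d -> R) i j :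
  has_partials phi D -> has_partials (D i) (E i) -> has_partials (D j) (E j) ->
  continuous (E i j) -> continuous (E j i) -> E i j = E j i.
Proof.
move=> hD hi hj ci cj; apply/funext => x; apply/eqP; apply: contrapT => /negP ne.
have e0 : 0 < `|E i j x - E j i x| / 2 by rewrite divr_gt0// normr_gt0 subr_eq0.
have /cvgrPdist_lt/(_ _ e0)/nbhs_ballP[r1 /= r10 H1] := ci x.
have /cvgrPdist_lt/(_ _ e0)/nbhs_ballP[r2 /= r20 H2] := cj x.
pose ei : 'rV[R]_d := delta_mx ord0 i; pose ej : 'rV[R]_d := delta_mx ord0 j.
pose K := `|ei| + `|ej| + 1.
have K0 : 0 < K by rewrite ltr_wpDl// addr_ge0.
pose r := Num.min r1 r2; have r0 : 0 < r by rewrite lt_min r10.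
(* With this step both evaluation points lie within [r / 2] of [x], whatever the intermediate
   parameters in [0, 1]. *)
have [h h0 hK] : exists2 h : R, 0 < h & h * K = r / 2.
  exists (r / (K * 2)); first by rewrite divr_gt0// mulr_gt0.
  by field; rewrite gt_eqF.
have near_x (s t : R) (a b : 'rV[R]_d) : `|a| + `|b| <= K ->
    0 <= s <= 1 -> 0 <= t <= 1 -> `|x - (x + s *: (h *: a) + t *: (h *: b))| < r.
  move=> abK /andP[s0 s1] /andP[t0 t1].
  rewrite -addrA opprD addNKr -normrN opprK.
  apply: (le_lt_trans (ler_normD _ _)); rewrite !normrZ !ger0_norm ?(ltW h0)//.
  apply: (@le_lt_trans _ _ (h * K)); last first.
    by rewrite hK; move: r0; lra.
  apply: (@le_trans _ _ (h * (`|a| + `|b|))); last by rewrite ler_pM2l.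
  by rewrite [leRHS]mulrDr; apply: lerD; rewrite ler_piMl// mulr_ge0// ltW.
have [s [t [s01 t01 H]]] := second_difference j x h hD hi.
have [s' [t' [s01' t01' H']]] := second_difference i x h hD hj.
have EE : E i j (x + s *: (h *: ei) + t *: (h *: ej)) =
    E j i (x + s' *: (h *: ej) + t' *: (h *: ei)).
  have h2 : h ^+ 2 != 0 by rewrite expf_neq0// gt_eqF.
  apply: (mulfI h2); rewrite -H -H' [x + h *: delta_mx _ j + _]addrAC.
  by set a := phi _; set b := phi _; set c := phi _; set e := phi _; lra.
have := H1 (x + s *: (h *: ei) + t *: (h *: ej)); rewrite -ball_normE /=.
have nK : `|ei| + `|ej| <= K by rewrite /K lerDl.
have nK' : `|ej| + `|ei| <= K by rewrite addrC.
have := near_x _ _ _ _ nK s01 t01; rewrite lt_min => /andP[-> _] /(_ isT).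
have := H2 (x + s' *: (h *: ej) + t' *: (h *: ei)); rewrite -ball_normE /=.
have := near_x _ _ _ _ nK' s01' t01'; rewrite lt_min => /andP[_ ->] /(_ isT).
rewrite EE => A B.
have := ler_normD (E i j x - E j i (x + s' *: (h *: ej) + t' *: (h *: ei)))
  (E j i (x + s' *: (h *: ej) + t' *: (h *: ei)) - E j i x).
rewrite subrKA; move: A; rewrite distrC; lra.
Qed.

End schwarz.

Section mixed_partials.
Variables (R : realType) (d : nat).
Implicit Types (phi : 'rV[R]_d -> R) (s : seq 'I_d).

Lemma pderivs_cat s1 s2 phi : pderivs (s1 ++ s2) phi = pderivs s1 (pderivs s2 phi).
Proof. by rewrite /pderivs foldr_cat. Qed.

Lemma smooth_pderivs s phi : smooth phi -> smooth (pderivs s phi).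
Proof. by move=> sphi t x; rewrite -pderivs_cat; exact: sphi. Qed.

Lemma smooth_has_partials phi : smooth phi ->
  has_partials phi (fun i => pderivs [:: i] phi).
Proof. by move=> sphi; apply: has_partials_diff => x; exact: (sphi [::]). Qed.

Lemma pderivs_swap i j phi : smooth phi ->
  pderivs [:: i; j] phi = pderivs [:: j; i] phi.
Proof.
move=> sphi.
have h k := smooth_has_partials (smooth_pderivs [:: k] sphi).
apply: (schwarz (E := fun j i => pderivs [:: i; j] phi) (smooth_has_partials sphi)
  (h j) (h i)) => x.
- exact: differentiable_continuous (sphi [:: i; j] x).
- exact: differentiable_continuous (sphi [:: j; i] x).
Qed.

Lemma pderivs_catC s1 s2 phi : smooth phi ->
  pderivs (s1 ++ s2) phi = pderivs (s2 ++ s1) phi.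
Proof.
have one i s (f : 'rV[R]_d -> R) : smooth f -> pderivs (i :: s) f = pderivs (rcons s i) f.
  move=> sf; elim: s => [//|j s IH].
  rewrite rcons_cons (_ : pderivs [:: i, j & s] f = pderivs [:: j; i] (pderivs s f)).
    exact: (congr1 (fun g => pderivs [:: j] g) IH).
  rewrite -(pderivs_swap i j (smooth_pderivs s sf)).
  exact: pderivs_cat [:: i; j] s f.
move=> sphi; elim: s1 s2 => [|i s1 IH] s2; first by rewrite cats0.
by rewrite cat_cons (one _ _ _ sphi) -[rcons _ _]cats1 -catA IH -catA.
Qed.

Lemma perm_pderivs s1 s2 phi : smooth phi -> perm_eq s1 s2 ->
  pderivs s1 phi = pderivs s2 phi.
Proof.
move=> sphi ps; apply: (catCA_perm_subst (F := fun s => pderivs s phi) _ ps).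
move=> t1 t2 t3; rewrite !catA !(pderivs_cat _ t3) pderivs_catC//.
exact: smooth_pderivs.
Qed.

(** Derivatives and monomials are handled through words, which allow induction on one letter at a
    time; this map returns to the multiindices of the seminorms and of genericity. *)
Definition word_type s : multiindex d := [ffun i => count_mem i s].

Lemma count_mem_flatten_nseq (a : multiindex d) (i : 'I_d) :
  count_mem i (flatten [seq nseq (a j) j | j <- enum 'I_d]) = a i.
Proof.
rewrite count_flatten -map_comp sumnE big_map big_enum (bigD1 i)//=.
rewrite count_nseq /= eqxx mul1n big1 ?addn0// => j ji.
by rewrite count_nseq /= (negbTE ji) mul0n.
Qed.

Lemma mderiv_word_type s phi : smooth phi ->
  mderiv (word_type s) phi = pderivs s phi.
Proof.
move=> sphi; apply: perm_pderivs => //; apply/allP => i _ /=.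
by rewrite count_mem_flatten_nseq ffunE.
Qed.

End mixed_partials.

(** * Jets of exponential growth *)

Section jets.
Variables (R : realType) (d : nat).
Implicit Types (phi psi : 'rV[R]_d -> R) (D : 'I_d -> 'rV[R]_d -> R).
Implicit Types (N : nat) (r M c : R) (s : seq 'I_d).

(** A weighted C^N bound with one constant for all derivatives up to order [N]. The recursion
    mirrors the Leibniz and chain rules, so each closure property is a short induction on [N]. *)
Fixpoint jet_le N r M phi : Prop :=
  (forall x, `|phi x| <= M * expR (r * enorm x)) /\
  if N is N'.+1 then
    exists2 D, has_partials phi D & forall i, jet_le N' r M (D i)
  else True.

Lemma jet_le_bound N r M phi x : jet_le N r M phi ->
  `|phi x| <= M * expR (r * enorm x).
Proof. by case: N => [|N] []. Qed.

Lemma jet_leSP N r M phi : jet_le N.+1 r M phi ->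
  (forall x, `|phi x| <= M * expR (r * enorm x)) /\
  exists2 D, has_partials phi D & forall i, jet_le N r M (D i).
Proof. by []. Qed.

Lemma jet_leS N r M phi D : has_partials phi D ->
  (forall x, `|phi x| <= M * expR (r * enorm x)) -> (forall i, jet_le N r M (D i)) -> jet_le N.+1 r M phi.
Proof. by move=> hD b jD; split=> //; exists D. Qed.

Lemma jet_le_ge0 N r M phi : jet_le N r M phi -> 0 <= M.
Proof.
move=> /(jet_le_bound 0) h; have := le_trans (normr_ge0 _) h.
by rewrite pmulr_lge0 ?expR_gt0.
Qed.

Lemma jet_le_mono N r r' M M' phi : r <= r' -> M <= M' -> jet_le N r M phi ->
  jet_le N r' M' phi.
Proof.
move=> rr MM; have b (f : 'rV[R]_d -> R) : (forall x, `|f x| <= M * expR (r * enorm x)) ->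
    forall x, `|f x| <= M' * expR (r' * enorm x).
  move=> h x; apply: (le_trans (h x)); apply: ler_pM; rewrite ?expR_ge0//.
  - have := le_trans (normr_ge0 _) (h x).
    by rewrite pmulr_lge0 ?expR_gt0.
  - by rewrite ler_expR ler_wpM2r ?enorm_ge0.
elim: N phi => [|N IH] phi; first by move=> [h _]; split=> //; exact: b.
by move=> /jet_leSP[h [D hD jD]]; split; [exact: b|exists D => // i; exact: IH (jD i)].
Qed.

Lemma jet_leW N N' r M phi : (N' <= N)%N -> jet_le N r M phi ->
  jet_le N' r M phi.
Proof.
elim: N N' phi => [|N IH] [|N'] phi //; first by move=> _ [].
by move=> NN /jet_leSP[h [D hD jD]]; split=> //; exists D => // i; exact: IH NN (jD i).
Qed.

Lemma jet_leD N r M M' phi psi : jet_le N r M phi -> jet_le N r M' psi ->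
  jet_le N r (M + M') (fun x => phi x + psi x).
Proof.
elim: N phi psi => [|N IH] phi psi; first by move=> [h _] [k _]; split=> // x; rewrite mulrDl;
  apply: (le_trans (ler_normD _ _)); exact: lerD.
move=> /jet_leSP[h [D hD jD]] /jet_leSP[k [E hE jE]].
apply: (jet_leS (has_partialsD hD hE)).
  by move=> x; rewrite mulrDl; apply: (le_trans (ler_normD _ _)); exact: lerD.
by move=> i; exact: IH (jD i) (jE i).
Qed.

Lemma jet_leZ N r M c phi : jet_le N r M phi ->
  jet_le N r (`|c| * M) (fun x => c * phi x).
Proof.
elim: N phi => [|N IH] phi.
  by move=> [h _]; split=> // x; rewrite normrM -mulrA ler_wpM2l.
move=> /jet_leSP[h [D hD jD]]; apply: (jet_leS (has_partialsZ c hD)).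
  by move=> x; rewrite normrM -mulrA ler_wpM2l.
by move=> i; exact: IH (jD i).
Qed.

(** Each differentiation doubles the number of Leibniz terms, whence [2 ^+ N]; the exponential rates
    add up. *)
Lemma jet_leM N r r' M M' phi psi : jet_le N r M phi -> jet_le N r' M' psi ->
  jet_le N (r + r') (2 ^+ N * M * M') (fun x => phi x * psi x).
Proof.
have b (f g : 'rV[R]_d -> R) : (forall x, `|f x| <= M * expR (r * enorm x)) ->
    (forall x, `|g x| <= M' * expR (r' * enorm x)) ->
    forall x, `|f x * g x| <= M * M' * expR ((r + r') * enorm x).
  move=> hf hg x; rewrite normrM mulrDl expRD mulrACA.
  by apply: ler_pM.
elim: N phi psi => [|N IH] phi psi.
  by move=> [h _] [k _]; split=> //; rewrite expr0 mul1r; exact: b.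
move=> jp jq; move: (jet_leW (leqnSn N) jp) (jet_leW (leqnSn N) jq) => jp' jq'.
have MM : 0 <= M * M' by rewrite mulr_ge0//; [exact: jet_le_ge0 jp|exact: jet_le_ge0 jq].
move: jp jq => /jet_leSP[h [D hD jD]] /jet_leSP[k [E hE jE]].
apply: (jet_leS (has_partialsM hD hE)) => [x|i].
  apply: (le_trans (b _ _ h k x)); rewrite ler_wpM2r ?expR_ge0// -mulrA.
  by rewrite ler_peMl// exprn_ege1// ler1n.
rewrite (_ : 2 ^+ N.+1 * M * M' = 2 ^+ N * M * M' + 2 ^+ N * M * M').
  by apply: jet_leD; [exact: IH (jD i) jq'|exact: IH jp' (jE i)].
by rewrite exprS; ring.
Qed.

Lemma jet_le_cst N r c : 0 <= r -> jet_le N r `|c| (fun=> c).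
Proof.
move=> r0; have b c' x : `|c'| <= `|c'| * expR (r * @enorm R d x).
  rewrite ler_peMr//; apply: le_trans (expR_ge1Dx _).
  by rewrite lerDl mulr_ge0 ?enorm_ge0.
elim: N c => [|N IH] c; first by split.
apply: (jet_leS (has_partials_cst c)) => // i.
by apply: jet_le_mono (IH 0) => //; rewrite normr0.
Qed.

Lemma jet_le_affine N r M k v phi : 0 <= r -> `|k| <= 1 -> jet_le N r M phi ->
  jet_le N r (M * expR (r * enorm v)) (fun x => phi (k *: x + v)).
Proof.
move=> r0 k1; have b (f : 'rV[R]_d -> R) : (forall x, `|f x| <= M * expR (r * enorm x)) ->
    forall x, `|f (k *: x + v)| <= M * expR (r * enorm v) * expR (r * enorm x).
  move=> h x; apply: (le_trans (h _)).
  have M0 : 0 <= M.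
    by have := le_trans (normr_ge0 _) (h 0); rewrite pmulr_lge0 ?expR_gt0.
  rewrite -mulrA ler_wpM2l// -expRD ler_expR -mulrDr ler_wpM2l//.
  apply: (le_trans (enormD _ _)); rewrite addrC lerD2l enormZ.
  by rewrite ler_piMl ?enorm_ge0.
elim: N phi => [|N IH] phi; first by move=> [h _]; split=> //; exact: b.
move=> /jet_leSP[h [D hD jD]]; apply: (jet_leS (has_partials_affine k v hD)).
  exact: b.
move=> i; apply: jet_le_mono (jet_leZ k (IH _ (jD i))) => //.
by rewrite ler_piMl//; apply: jet_le_ge0 (IH _ (jD i)).
Qed.

Lemma enorm_le_expR r (x : 'rV[R]_d) : 0 < r -> enorm x <= r^-1 * expR (r * enorm x).
Proof.
move=> r0; rewrite -ler_pdivrMl ?invr_gt0// invrK.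
by apply: le_trans (expR_ge1Dx _); rewrite lerDr.
Qed.

Lemma jet_le_coor N r j : 0 < r ->
  jet_le N r (r^-1 + 1) (fun x : 'rV[R]_d => x ord0 j).
Proof.
move=> r0; have b (x : 'rV[R]_d) :
    `|x ord0 j| <= (r^-1 + 1) * expR (r * enorm x).
  apply: (le_trans (coor_le_enorm _ _)); apply: (le_trans (enorm_le_expR _ r0)).
  by rewrite ler_wpM2r ?expR_ge0// lerDl.
case: N => [|N]; first by split.
apply: (jet_leS (has_partials_coor j)) => // i.
apply: (jet_le_mono (r := 0) _ _ (jet_le_cst _ _ (lexx _))); first exact: ltW.
have r1 : 0 <= r^-1 by rewrite invr_ge0 ltW.
by case: (i == j); rewrite ?normr0 ?normr1 ?lerDr// addr_ge0.
Qed.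

Lemma has_partials_pderivs s i phi D : has_partials phi D ->
  pderivs (rcons s i) phi = pderivs s (D i).
Proof.
by move=> hD; rewrite /pderivs foldr_rcons (has_partialsE hD).
Qed.

Lemma jet_le_pderivs N r M phi s : (size s <= N)%N -> jet_le N r M phi ->
  jet_le (N - size s) r M (pderivs s phi).
Proof.
elim/last_ind: s N phi => [|s i IH] N phi; first by rewrite subn0.
case: N => [|N]; rewrite size_rcons// ltnS => sN /jet_leSP[_ [D hD jD]].
by rewrite (has_partials_pderivs s i hD) subSS; exact: IH (jD i).
Qed.

(** This is membership in P, by [tame_Pgamma] and [P_set_tame]. Having every rate at disposal makes
    it stable under products: each factor is taken at rate [r / 2]. *)
Definition tame phi : Prop :=
  forall r, 0 < r -> forall N, exists M, jet_le N r M phi.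

Lemma tame_smooth phi : tame phi -> smooth phi.
Proof.
move=> t s x; have [M jM] := t 1 ltr01 (size s).+1.
have := jet_le_pderivs (leqnSn _) jM; rewrite subSnn => /jet_leSP[_ [D hD _]].
by have [] := hD x.
Qed.

Lemma tame_cst c : tame (fun=> c).
Proof. by move=> r r0 N; exists `|c|; exact: jet_le_cst _ _ (ltW r0). Qed.

Lemma tameD phi psi : tame phi -> tame psi -> tame (fun x => phi x + psi x).
Proof.
move=> t1 t2 r r0 N; have [M j1] := t1 r r0 N; have [M' j2] := t2 r r0 N.
by exists (M + M'); exact: jet_leD.
Qed.

Lemma tameZ c phi : tame phi -> tame (fun x => c * phi x).
Proof.
by move=> t r r0 N; have [M j] := t r r0 N; exists (`|c| * M); exact: jet_leZ.
Qed.

Lemma tame_sum (I : Type) (l : seq I) (phi : I -> 'rV[R]_d -> R) :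
  (forall k, tame (phi k)) -> tame (fun x => \sum_(k <- l) phi k x).
Proof.
move=> t; elim: l => [|k l IH].
  rewrite (_ : (fun x => _) = fun=> 0); first exact: tame_cst.
  by apply/funext => x; rewrite big_nil.
rewrite (_ : (fun x => _) = fun x => phi k x + \sum_(k <- l) phi k x).
  exact: tameD.
by apply/funext => x; rewrite big_cons.
Qed.

Lemma tameM phi psi : tame phi -> tame psi -> tame (fun x => phi x * psi x).
Proof.
move=> t1 t2 r r0 N; have r2 : 0 < r / 2 by rewrite divr_gt0.
have [M j1] := t1 _ r2 N; have [M' j2] := t2 _ r2 N.
exists (2 ^+ N * M * M'); rewrite (splitr r); exact: jet_leM.
Qed.

Lemma tameB phi psi : tame phi -> tame psi -> tame (fun x => phi x - psi x).
Proof.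
move=> t1 t2; rewrite (_ : (fun x => _) = fun x => phi x + (-1) * psi x).
  by apply: tameD => //; exact: tameZ.
by apply/funext => x; rewrite mulN1r.
Qed.

Lemma tame_affine k v phi : `|k| <= 1 -> tame phi ->
  tame (fun x => phi (k *: x + v)).
Proof.
move=> k1 t r r0 N; have [M j] := t r r0 N.
by exists (M * expR (r * enorm v)); exact: (jet_le_affine v (ltW r0)).
Qed.

Lemma tame_coor j : tame (fun x : 'rV[R]_d => x ord0 j).
Proof. by move=> r r0 N; exists (r^-1 + 1); exact: jet_le_coor. Qed.

Lemma tame_prod_coor s : tame (fun x : 'rV[R]_d => \prod_(j <- s) x ord0 j).
Proof.
elim: s => [|j s IH].
  rewrite (_ : (fun x => _) = fun=> 1); first exact: tame_cst.
  by apply/funext => x; rewrite big_nil.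
rewrite (_ : (fun x => _) = fun x : 'rV[R]_d => x ord0 j * \prod_(j <- s) x ord0 j).
  by apply: tameM => //; exact: tame_coor.
by apply/funext => x; rewrite big_cons.
Qed.

Lemma tame_pderivs s phi : tame phi -> tame (pderivs s phi).
Proof.
move=> t r r0 N; have [M j] := t r r0 (N + size s)%N.
by exists M; rewrite -[N](addnK (size s)); apply: jet_le_pderivs => //; exact: leq_addl.
Qed.

Lemma tame_Pgamma (g : R) phi : 0 < g -> tame phi -> Pgamma_set g phi.
Proof.
move=> g0 t; split=> [|a]; first exact: tame_smooth.
rewrite /mderiv; set s := flatten _.
have g2 : 0 < g / 2 by rewrite divr_gt0.
have [M j] := t _ g2 (size s).
have := jet_le_pderivs (leqnn _) j; rewrite subnn => -[h _].
have M0 := jet_le_ge0 j.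
(* The jet is taken at rate [g / 2], leaving a factor e^(- g |x| / 2); beyond this radius e^t >= 1 +
   t makes it smaller than [e / M]. *)
apply/cvgr0Pnorm_lt => e e0; exists (M / e / (g / 2)) => // x /= xM.
rewrite normrM ger0_norm ?expR_ge0//.
apply: (@le_lt_trans _ _ (M * expR (- (g / 2 * enorm x)))).
  rewrite (_ : - (g / 2 * enorm x) = - g * enorm x + g / 2 * enorm x).
    by rewrite expRD mulrCA ler_wpM2l ?expR_ge0.
  by field.
rewrite expRN ltr_pdivrMr ?expR_gt0// -ltr_pdivrMl// mulrC.
apply: lt_le_trans (expR_ge1Dx _).
have : M / e < g / 2 * enorm x by rewrite [ltRHS]mulrC -ltr_pdivrMr.
lra.
Qed.

End jets.

(** * Tame functions and the space P *)

Section Pgamma_tame.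
Variables (R : realType) (d : nat).
Implicit Types (phi psi : 'rV[R]_d -> R).

Lemma compact_norm_ball (r : R) : compact [set x : 'rV[R]_d | `|x| <= r].
Proof.
apply: bounded_closed_compact.
  exists r; split; first exact: num_real.
  by move=> y ry x /= /le_trans -> //; exact: ltW.
rewrite (_ : [set x | _] = closed_ball_ Num.norm (0 : 'rV[R]_d) r); first exact: closed_closed_ball_.
by apply/seteqP; split=> x; rewrite /closed_ball_ /= sub0r normrN.
Qed.

Lemma norm_le_enorm (x : 'rV[R]_d) : `|x| <= enorm x.
Proof.
rewrite /Num.norm/= mx_normrE; apply/bigmax_leP; split; first exact: enorm_ge0.
by move=> [i j] _ /=; rewrite (ord1 i) coor_le_enorm.
Qed.

Lemma continuous_bounded_ball phi (r : R) : continuous phi ->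
  exists M, forall x, enorm x <= r -> `|phi x| <= M.
Proof.
move=> cphi; pose A := [set x : 'rV[R]_d | `|x| <= Num.max r 0].
have cA : compact A by exact: compact_norm_ball.
have A0 : A !=set0 by exists 0; rewrite /A /= normr0 le_max lexx orbT.
have cn : {within A, continuous (fun x => `|phi x|)}.
  apply: continuous_subspaceT => x; apply: continuous_comp; first exact: cphi.
  exact: norm_continuous.
have [c _ Hc] := EVT_max_rV A0 cA cn.
exists `|phi c| => x xr; apply: Hc; rewrite inE /A /=.
by rewrite le_max (le_trans (norm_le_enorm x) xr).
Qed.

(** Decay controls the outside of a ball and compactness the inside. This makes the [sup] in
    [seminorm] a genuine upper bound. *)
Lemma Pgamma_bounded g phi (a : multiindex d) : 0 <= g -> Pgamma_set g phi ->
  exists M, forall x, `|expR (- g * enorm x) * mderiv a phi x| <= M.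
Proof.
move=> g0 [sphi /(_ a)/cvgr0Pnorm_lt/(_ 1 ltr01)[A _ HA]].
have cm : continuous (mderiv a phi).
  by move=> x; exact: differentiable_continuous (sphi _ x).
have [M HM] := continuous_bounded_ball A cm.
exists (Num.max 1 M) => x; rewrite le_max; have [xA|xA] := leP (enorm x) A.
  apply/orP; right; rewrite normrM ger0_norm ?expR_ge0//.
  apply: le_trans (HM _ xA); rewrite ler_piMl//.
  by rewrite -[leRHS]expR0 ler_expR mulNr oppr_le0 mulr_ge0// enorm_ge0.
by apply/orP; left; apply/ltW/HA.
Qed.

Lemma jet_le_exists N r phi : smooth phi ->
  (forall s, exists M, forall x, `|pderivs s phi x| <= M * expR (r * enorm x)) ->
  exists M, jet_le N r M phi.
Proof.
elim: N phi => [|N IH] phi sphi h.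
  by have [M HM] := h [::]; exists M; split.
have [M HM] := h [::].
have /choice[Mi HMi] : forall i : 'I_d, exists M, jet_le N r M (pderivs [:: i] phi).
  move=> i; apply: IH; first exact: smooth_pderivs.
  by move=> s; have [M' H'] := h (s ++ [:: i]); exists M' => x; rewrite -pderivs_cat.
have Mi0 i : 0 <= Mi i by exact: jet_le_ge0 (HMi i).
exists (`|M| + \sum_i Mi i); apply: (jet_leS (smooth_has_partials sphi)).
  move=> x; apply: (le_trans (HM x)); rewrite ler_wpM2r ?expR_ge0//.
  by apply: (le_trans (ler_norm _)); rewrite lerDl sumr_ge0.
move=> i; apply: jet_le_mono (HMi i) => //.
rewrite (bigD1 i)//= addrCA lerDl addr_ge0// sumr_ge0//.
Qed.

Lemma P_set_tame psi : P_set psi -> tame psi.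
Proof.
move=> Ppsi r r0 N; have [spsi _] := Ppsi _ r0.
apply: jet_le_exists => // s.
have [M HM] := Pgamma_bounded (word_type s) (ltW r0) (Ppsi _ r0).
exists M => x; have := HM x; rewrite mderiv_word_type// normrM ger0_norm ?expR_ge0//.
by rewrite mulNr expRN -ler_pdivlMl ?invr_gt0 ?expR_gt0// invrK mulrC.
Qed.

End Pgamma_tame.

(** * The dual of P_gamma *)

Section dual_representation.
Variables (R : realType) (d : nat).
Implicit Types (phi psi f g : 'rV[R]_d -> R).

(* Outside P_gamma, insubd gives the junk value F 0 = 0. *)
Definition dual_ext gamma (F : Pgamma d gamma -> R^o) phi : R :=
  F (insubd (0 : Pgamma d gamma) phi).

(** The topology of P_gamma is replaced by one quantitative bound in jets. Stating everything for
    plain functions avoids membership proofs and makes the notion visibly stable under g - c f. *)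
Record dual_rep (gamma : R) f (L : ('rV[R]_d -> R) -> R) : Prop := DualRep {
  dual_rep_integrable : (lebesgue_row R d).-integrable setT (EFin \o f);
  dual_rep_linear : forall c phi psi, tame phi -> tame psi ->
    L (fun x => c * phi x + psi x) = c * L phi + L psi;
  dual_rep_bound : exists C N, 0 <= C /\ forall phi M,
    tame phi -> jet_le N gamma M phi -> `|L phi| <= C * M;
  dual_rep_test : forall phi, tame phi -> test_function phi ->
    L phi = \int[lebesgue_row R d]_x (f x * phi x) }.

(** Subbasic balls are centred anywhere, so a ball around psi that contains 0 has room [e - s0] left
    there by the triangle inequality. Only half of it is used, since a supremum of strict bounds is
    bounded only weakly. *)
Lemma seminorm_ball_jets (gamma : R) (i : Pgamma d gamma * multiindex d * R) :
  0 <= gamma -> seminorm_ball i 0 -> exists N (t : R), 0 < t /\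
  forall (phi : Pgamma d gamma) (M : R),
  M <= t -> jet_le N gamma M phi -> seminorm_ball i phi.
Proof.
move=> g0; case: i => [[psi a] e]; rewrite /seminorm_ball /= => lt0.
set s := flatten [seq nseq (a j) j | j <- enum 'I_d].
pose s0 := seminorm gamma a (0 - psi : 'rV[R]_d -> R).
have s0e : s0 < e by exact: lt0.
exists (size s), ((e - s0) / 2); split; first by rewrite divr_gt0// subr_gt0.
have Ppsi (chi : Pgamma d gamma) : Pgamma_set gamma chi.
  by have /asboolP := valP chi.
move=> phi M Mt jphi; apply: (@le_lt_trans _ _ ((e - s0) / 2 + s0)); last lra.
have bnd0 x : `|expR (- gamma * enorm x) * mderiv a (0 - psi : 'rV[R]_d -> R) x| <= s0.
  apply: ub_le_sup; last by exists x.
  have [K HK] := Pgamma_bounded a g0 (Ppsi (0 - psi)).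
  by exists K => _ [y _ <-]; exact: HK.
apply: ge_sup; first by eexists; exists 0.
move=> _ [x _ <-].
have -> : mderiv a (phi - psi : 'rV[R]_d -> R) x =
    mderiv a phi x + mderiv a (0 - psi : 'rV[R]_d -> R) x.
  have [[sp _] [sq _]] := (Ppsi phi, Ppsi psi).
  rewrite (_ : phi - psi = (-1) *: (psi : 'rV[R]_d -> R) + phi :> ('rV[R]_d -> R)); last first.
    by apply/funext => y; rewrite scaleN1r addrC.
  rewrite (_ : 0 - psi = (-1) *: (psi : 'rV[R]_d -> R) + 0 :> ('rV[R]_d -> R)); last first.
    by apply/funext => y; rewrite scaleN1r addrC.
  rewrite /mderiv !pderivs_linear//; last exact: smooth0.
  by rewrite pderivs0 addr0 addrC.
rewrite mulrDr; apply: (le_trans (ler_normD _ _)); apply: lerD => //.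
apply: le_trans Mt; rewrite normrM ger0_norm ?expR_ge0//.
have := jet_le_pderivs (leqnn _) jphi; rewrite subnn => -[/(_ x) h _].
by rewrite mulNr expRN ler_pdivrMl ?expR_gt0// mulrC.
Qed.

Lemma finite_seminorm_balls_jets (gamma : R)
  (l : seq (Pgamma d gamma * multiindex d * R)) : 0 <= gamma ->
  (forall i, i \in l -> seminorm_ball i 0) ->
  exists N (t : R), 0 < t /\ forall (phi : Pgamma d gamma) (M : R), M <= t ->
    jet_le N gamma M phi ->
    forall i, i \in l -> seminorm_ball i phi.
Proof.
move=> g0; elim: l => [|i l IH] H; first by exists 0%N, 1.
have [|N [t [t0 Ht]]] := IH; first by move=> j jl; apply: H; rewrite inE jl orbT.
have [|N' [t' [t0' Ht']]] := @seminorm_ball_jets gamma i g0.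
  by apply: H; rewrite inE eqxx.
exists (maxn N N'), (Num.min t t'); split; first by rewrite lt_min t0.
move=> phi M; rewrite le_min => /andP[Mt Mt'] j k; rewrite inE => /orP[/eqP ->|kl].
  by apply: Ht' Mt' _; exact: jet_leW (leq_maxr _ _) j.
by apply: Ht Mt _ _ kl; exact: jet_leW (leq_maxl _ _) j.
Qed.

(** Continuity at 0 gives a finite intersection of subbasic balls on which [|F| < 1]; homogeneity
    turns this into a bound linear in the jet constant. *)
Lemma Pgamma_dual_L1_rep (gamma : R) f (F : {linear Pgamma d gamma -> R^o}) :
  0 < gamma -> Pgamma_dual_L1 f F -> dual_rep gamma f (dual_ext F).
Proof.
move=> g0 [intf cF testF].
have mem phi : tame phi -> phi \in Pgamma_pred gamma.
  by move=> t; apply/asboolP; exact: tame_Pgamma.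
have lin c phi psi : tame phi -> tame psi -> dual_ext F (fun x => c * phi x + psi x) =
    c * dual_ext F phi + dual_ext F psi.
  move=> t1 t2; rewrite /dual_ext.
  have t3 : tame (fun x => c * phi x + psi x) by apply: tameD => //; exact: tameZ.
  rewrite (_ : insubd _ (fun x => _) = c *: insubd 0 phi + insubd 0 psi).
    by rewrite linearP.
  apply: val_inj => /=; rewrite insubdK; last exact: mem.
  rewrite -[RHS]/(c *: val (insubd (0 : Pgamma d gamma) phi)
    + val (insubd (0 : Pgamma d gamma) psi)).
  by rewrite !insubdK //; exact: mem.
split=> //.
- have : nbhs (0 : Pgamma d gamma) (F @^-1` [set y | `|y| < 1]).
    apply: cF; rewrite linear0; apply/nbhs_ballP; exists 1 => //= y.
    by rewrite -ball_normE /= sub0r normrN.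
  rewrite nbhsE => -[B [oB B0] BF].
  case: oB => D' sD EB; move: B0; rewrite -EB => -[A DA A0].
  have [l lD EA] := sD _ DA.
  have [|N [t [t0 Ht]]] := @finite_seminorm_balls_jets gamma
    (finmap.enum_fset l : seq (Pgamma d gamma * multiindex d * R)) (ltW g0).
    by move=> i il; move: A0; rewrite -EA; apply.
  exists t^-1, N; split; first by rewrite invr_ge0 ltW.
  move=> phi M tphi jphi; apply/ler_addgt0Pr => e e0.
  have M0 := jet_le_ge0 jphi.
  (* [M] may be 0, so it is enlarged before dividing; rescaling by [t / M'] then yields the bound
     [M / t + e], with [e] arbitrary. *)
  pose M' := M + e * t; have M'0 : 0 < M' by rewrite ltr_wpDl// mulr_gt0.
  pose c := t / M'; have c0 : 0 < c by rewrite divr_gt0.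
  have Fc : `|F (c *: insubd 0 phi)| < 1.
    apply: BF; rewrite -EB; exists A => //.
    apply: (eq_ind _ (fun S : set (Pgamma d gamma) => S (c *: insubd 0 phi)) _ _ EA).
    move=> i il.
    apply: (Ht _ (c * M)) => //.
      rewrite /c -mulrA ler_piMr ?(ltW t0)// ler_pdivrMl// mulr1.
      by rewrite /M' lerDl mulr_ge0// ltW.
    rewrite (_ : Pgamma_fun _ = fun x => c * phi x).
      by have := jet_leZ c jphi; rewrite (gtr0_norm c0).
    rewrite -[LHS]/(c *: val (insubd (0 : Pgamma d gamma) phi)).
    by rewrite insubdK//; exact: mem.
  move: Fc; rewrite linearZ /= normrM gtr0_norm// -ltr_pdivlMl// mulr1.
  rewrite /c invf_div => /ltW; rewrite -/(dual_ext F phi) => /le_trans; apply.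
  by rewrite /M' mulrDl mulfK ?gt_eqF// mulrC.
- move=> phi _ tphi; rewrite -(testF _ tphi) /dual_ext; congr (F _).
  by apply: val_inj; rewrite /= insubdK//; exact: test_Pgamma.
Qed.

Lemma convolution_dual_ext gamma (F : Pgamma d gamma -> R^o) psi sigma
  (Ppsi : P_set psi) (g0 : 0 < gamma) (s0 : 0 < sigma) x :
  convolution F Ppsi g0 s0 x = dual_ext F (fun y => dilate sigma psi (x - y)).
Proof.
rewrite /convolution /dual_ext; congr (F _); apply: val_inj => /=.
by rewrite insubdK//; exact: Pgamma_dilate.
Qed.

End dual_representation.

(** * Pairing with bounded measurable functions *)

Section bounded_measurable.
Context {disp : measure_display} {T : measurableType disp} {R : realType}.
Variable mu : {measure set T -> \bar R}.
Implicit Types (f h k : T -> R).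

Definition bmeas h : Prop :=
  measurable_fun setT h /\ exists K, forall x, `|h x| <= K.

Lemma bmeas_cst (c : R) : bmeas (fun=> c).
Proof. by split; [exact: measurable_cst|exists `|c|]. Qed.

Lemma bmeasD h k : bmeas h -> bmeas k -> bmeas (fun x => h x + k x).
Proof.
move=> [mh [K hK]] [mk [K' kK]]; split; first exact: measurable_funD.
by exists (K + K') => x; apply: (le_trans (ler_normD _ _)); exact: lerD.
Qed.

Lemma bmeasM h k : bmeas h -> bmeas k -> bmeas (fun x => h x * k x).
Proof.
move=> [mh [K hK]] [mk [K' kK]]; split; first exact: measurable_funM.
by exists (K * K') => x; rewrite normrM; exact: ler_pM.
Qed.

Lemma bmeasX h n : bmeas h -> bmeas (fun x => h x ^+ n).
Proof.
move=> bh; elim: n => [|n IH].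
  by under eq_fun do rewrite expr0; exact: bmeas_cst.
by under eq_fun do rewrite exprS; exact: bmeasM.
Qed.

Lemma bmeas_sum (I : Type) (r : seq I) (h : I -> T -> R) :
  (forall i, bmeas (h i)) -> bmeas (fun x => \sum_(i <- r) h i x).
Proof.
move=> bh; elim: r => [|i r IH].
  by under eq_fun do rewrite big_nil; exact: bmeas_cst.
by under eq_fun do rewrite big_cons; exact: bmeasD.
Qed.

Lemma bmeas_prod (I : Type) (r : seq I) (h : I -> T -> R) :
  (forall i, bmeas (h i)) -> bmeas (fun x => \prod_(i <- r) h i x).
Proof.
move=> bh; elim: r => [|i r IH].
  by under eq_fun do rewrite big_nil; exact: bmeas_cst.
by under eq_fun do rewrite big_cons; exact: bmeasM.
Qed.

Lemma bmeas_indic (A : set T) : measurable A -> bmeas (\1_A : T -> R).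
Proof.
move=> mA; split; first exact: measurable_indic.
by exists 1 => x; rewrite indicE ger0_norm// lern1 leq_b1.
Qed.

Variable f : T -> R.
Hypothesis intf : mu.-integrable setT (EFin \o f).

Definition pairing h : R := \int[mu]_x (f x * h x).

Lemma bmeas_integrable h : bmeas h ->
  mu.-integrable setT (EFin \o (fun x => f x * h x)).
Proof.
move=> [mh [K hK]]; apply: (@integrableMl _ _ _ mu setT measurableT _ h intf mh).
exists K; split; first exact: num_real.
by move=> M KM x _ /=; apply: (le_trans (hK x)); exact: ltW.
Qed.

Lemma eq_pairing h k : h =1 k -> pairing h = pairing k.
Proof. by move=> /funext ->. Qed.

Lemma pairing_linear c h k : bmeas h -> bmeas k ->
  pairing (fun x => c * h x + k x) = c * pairing h + pairing k.
Proof.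
move=> bh bk; rewrite /pairing.
rewrite -RintegralZl//; last exact: bmeas_integrable.
rewrite -RintegralD//; [|rewrite (_ : _ \o _ = EFin \o (fun x => f x * (c * h x)))|].
- by apply: eq_Rintegral => x _; ring.
- by apply: bmeas_integrable; apply: bmeasM => //; exact: bmeas_cst.
- by apply/funext => x /=; rewrite mulrCA.
- exact: bmeas_integrable.
Qed.

Lemma pairing0 : pairing (fun=> 0) = 0.
Proof.
have := @pairing_linear (-1) _ _ (bmeas_cst 0) (bmeas_cst 0).
under [in LHS]eq_fun do rewrite mulr0 addr0.
lra.
Qed.

Lemma bmeas_cvg (h : nat -> T -> R) k (K : R) : (forall n, measurable_fun setT (h n)) ->
  (forall n x, `|h n x| <= K) -> (forall x, h n x @[n --> \oo] --> k x) -> bmeas k.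
Proof.
move=> mh hK hk; split; first exact: (measurable_fun_cvg mh (fun x _ => hk x)).
exists K => x; apply: (cvgr_to_le (cvg_norm (hk x))).
by apply: nearW => n; exact: hK.
Qed.

Lemma pairing_cvg (h : nat -> T -> R) k (K : R) : (forall n, measurable_fun setT (h n)) ->
  (forall n x, `|h n x| <= K) -> (forall x, h n x @[n --> \oo] --> k x) ->
  pairing (h n) @[n --> \oo] --> pairing k.
Proof.
move=> mh hK hk.
have bh n : bmeas (h n) by split=> //; exists K.
have bk := bmeas_cvg mh hK hk.
have := @dominated_convergence _ _ _ mu setT measurableT
  (fun n x => (f x * h n x)%:E) (fun x => (f x * k x)%:E)
  (fun x => (`|f x| * K)%:E).
case.
- by move=> n; have /integrableP[] := bmeas_integrable (bh n).
- by have /integrableP[] := bmeas_integrable bk.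
- apply: aeW => x _; apply: cvg_EFin; first by apply: nearW => n.
  by apply: cvgM; [exact: cvg_cst|exact: hk].
- have := integrable_abse (bmeas_integrable (bmeas_cst K)).
  apply: le_integrable => //.
    apply/measurable_EFinP; apply: measurable_funM; last exact: measurable_cst.
    apply: measurableT_comp => //; apply/measurable_EFinP.
    by have /integrableP[] := intf.
  by move=> x _ /=; rewrite lee_fin !normrM normr_id normr_id.
- apply: aeW => x n _ /=; rewrite lee_fin normrM ler_wpM2l//.
move=> _ _ H.
have fin : (\int[mu]_x (f x * k x)%:E)%E \is a fin_num.
  by apply: (@integrable_fin_num _ _ _ mu setT measurableT); exact: bmeas_integrable bk.
by move: H; rewrite -(fineK fin) => /fine_cvg.
Qed.

Lemma pairing_sum (I : Type) (r : seq I) (h : I -> T -> R) (c : I -> R) :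
  (forall i, bmeas (h i)) ->
  pairing (fun x => \sum_(i <- r) c i * h i x) = \sum_(i <- r) c i * pairing (h i).
Proof.
move=> bh; elim: r => [|i r IH].
  by rewrite big_nil -[RHS]pairing0; apply: eq_pairing => x; rewrite big_nil.
rewrite big_cons -IH -pairing_linear//.
  by apply: eq_pairing => x; rewrite big_cons.
apply: bmeas_sum => j; apply: bmeasM => //; exact: bmeas_cst.
Qed.

(** The difference of the indicators of the sets where f is positive and negative is the sign of f,
    and pairing with it gives the integral of |f|. *)
Lemma pairing_indic_ae0 : (forall A, measurable A -> pairing (\1_A : T -> R) = 0) ->
  {ae mu, forall x, f x = 0}.
Proof.
move=> H.
have mf : measurable_fun setT f.
  by apply/measurable_EFinP; have /integrableP[] := intf.
pose A := f @^-1` `]0, +oo[; pose B := f @^-1` `]-oo, 0[.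
have mA : measurable A by rewrite -[A]setTI; exact: mf.
have mB : measurable B by rewrite -[B]setTI; exact: mf.
have : pairing (fun x => (-1) * (\1_B x : R) + \1_A x) = 0.
  by rewrite pairing_linear; [rewrite !H// mulr0 addr0|exact: bmeas_indic..].
rewrite /pairing (_ : (fun x => _) = (fun x => `|f x|)); last first.
  apply/funext => x; rewrite !indicE.
  have [xA|xA] := boolP (x \in A); have [xB|xB] := boolP (x \in B).
  - move: xA xB; rewrite !inE /A /B /= !in_itv/= andbT => a b.
    by have := lt_trans a b; rewrite ltxx.
  - move: xA; rewrite !inE /A /= !in_itv/= andbT => a.
    by rewrite gtr0_norm// mulr0 add0r mulr1.
  - move: xB; rewrite !inE /B /= !in_itv/= => a.
    by rewrite ltr0_norm// mulr1 addr0 mulrN1.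
  - have : f x = 0.
      apply/eqP; move: xA xB; rewrite !notin_setE /A /B /= !in_itv/= andbT.
      by move=> /negP + /negP; rewrite -!leNgt => a b; rewrite eq_le a b.
    by move=> ->; rewrite mul0r normr0.
have fin : (\int[mu]_x (`|f x|)%:E)%E \is a fin_num.
  by apply: integrable_fin_num => //; have := integrable_abse intf.
rewrite /Rintegral => I0.
have : (\int[mu]_x `|(f x)%:E| = 0)%E.
  have -> : (\int[mu]_x `|(f x)%:E| = \int[mu]_x (`|f x|)%:E)%E by [].
  by rewrite -(fineK fin) I0.
move=> /(ae_eq_integral_abs _ measurableT) => h.
have : ae_eq mu setT (EFin \o f) (cst 0%E).
  by apply: h; exact/measurable_EFinP.
by apply: filterS => x /(_ I) [].
Qed.

End bounded_measurable.

(** Dynkin's lemma: sets of zero pairing are closed under complement, because the whole space is one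
    of them, and under countable disjoint unions, by dominated convergence. *)
Lemma pairing_generated {disp : measure_display} {T : measurableType disp}
  {R : realType} (mu : {measure set T -> \bar R}) (f : T -> R)
  (G : set (set T)) : mu.-integrable setT (EFin \o f) ->
  @measurable _ T = <<s G >> -> setI_closed G -> G setT ->
  (forall A, G A -> pairing mu f (\1_A : T -> R) = 0) ->
  {ae mu, forall x, f x = 0}.
Proof.
move=> intf mG GI GT H; apply: (pairing_indic_ae0 intf).
rewrite mG; apply: (dynkin_induction (P := fun A => pairing mu f (\1_A : T -> R) = 0)) => //.
- exact: H.
- move=> A mA PA.
  rewrite (@eq_pairing _ _ _ mu f _ (fun x => (-1) * (\1_A x : R) + \1_[set: T] x)).
    rewrite pairing_linear//; [|exact: bmeas_indic|exact: bmeas_indic].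
    by rewrite PA H// mulr0 addr0.
  move=> x; rewrite !indicE in_setC in_setT.
  by case: (x \in A) => /=; rewrite ?mulr1 ?mulr0 ?addr0 ?add0r ?addNr.
move=> F mF tF PF.
have h n x : \1_(\big[setU/set0]_(i < n) F i) x = \sum_(i < n) 1 * (\1_(F i) x : R).
  have [xF|xF] := pselect (exists i, F i x); last first.
    rewrite indicE (_ : _ \in _ = false); last first.
      apply/negbTE/negP; rewrite inE -bigcup_mkord => -[i /= _ Fi].
      by apply: xF; exists i.
    rewrite [RHS]big1// => i _; rewrite mul1r indicE memNset//.
    by move=> Fi; apply: xF; exists (nat_of_ord i).
  have [i Fi] := xF.
  have Fj j : j <> i -> \1_(F j) x = 0 :> R.
    move=> ji; rewrite indicE memNset// => Fjx.
    by apply: ji; apply: (tF j i I I); exists x.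
  have [ni|ni] := ltnP i n.
    rewrite [RHS](bigD1 (Ordinal ni))//= [X in _ + X]big1 ?addr0 => [|j ji].
      by rewrite mul1r !indicE !mem_set// -bigcup_mkord; exists i.
    rewrite mul1r Fj// => E; move: ji => /negP; apply; apply/eqP; exact: val_inj.
  rewrite [RHS]big1 => [|j _].
    rewrite indicE memNset// -bigcup_mkord => -[j /= jn Fjx].
    have ji : j <> i by move=> E; move: jn; rewrite E ltnNge ni.
    by have := Fj j ji; rewrite indicE mem_set// => /eqP; rewrite oner_eq0.
  rewrite mul1r Fj// => E; move: (ltn_ord j); by rewrite E ltnNge ni.
have cv : pairing mu f (\1_(\big[setU/set0]_(i < n) F i) : T -> R) @[n --> \oo] -->
    pairing mu f (\1_(\bigcup_k F k) : T -> R).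
  apply: (pairing_cvg intf (K := 1)).
  - by move=> n; apply: measurable_indic; exact: bigsetU_measurable.
  - by move=> n x; rewrite indicE ger0_norm// lern1 leq_b1.
  move=> x; have [xF|xF] := pselect ((\bigcup_k F k) x).
    rewrite indicE mem_set//; apply: cvg_near_cst.
    have [i _ Fi] := xF; exists i.+1 => // n /= ni.
    by rewrite indicE mem_set// -bigcup_mkord; exists i.
  rewrite indicE memNset//; apply: cvg_near_cst; apply: nearW => n.
  rewrite indicE memNset// -bigcup_mkord => -[i _ Fi]; apply: xF.
  by exists i.
have : (0 : R) @[n --> \oo] --> pairing mu f (\1_(\bigcup_k F k) : T -> R).
  apply: cvg_trans cv; apply: near_eq_cvg; apply: nearW => n.
  rewrite (eq_pairing _ _ (h n)) pairing_sum//; last by move=> i; exact: bmeas_indic.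
  by rewrite big1// => i _; rewrite PF mulr0.
by move/(cvg_unique _ (cvg_cst 0)) => <-.
Qed.

(** * Cutoff functions *)

Section bump.
Variable R : realType.

(* The factor u^-k closes the family under differentiation. *)
Definition expinv (k : nat) (u : R) : R :=
  if 0 < u then u^-1 ^+ k * expR (- u^-1) else 0.

(** From e^v >= v^(k+2) / (k+2)! at v = 1 / u. Being quadratic in [u], the bound makes the
    derivative at 0 exist and vanish. *)
Lemma expinv_le k u : `|expinv k u| <= (k.+2)`!%:R * u ^+ 2.
Proof.
rewrite /expinv; case: ifPn => u0; last by rewrite normr0 mulr_ge0// sqr_ge0.
have v0 : 0 < u^-1 by rewrite invr_gt0.
rewrite ger0_norm ?mulr_ge0 ?exprn_ge0 ?expR_ge0 ?(ltW v0)//.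
have := @expR_ge1Dxn R u^-1 k.+1 (ltW v0).
set c := _`!%:R; have c0 : 0 < c by rewrite ltr0n fact_gt0.
move=> h; rewrite expRN ler_pdivrMr ?expR_gt0//.
have h2 : u^-1 ^+ k.+2 / c <= expR u^-1 by apply: le_trans h; rewrite lerDr.
have : c * u ^+ 2 * (u^-1 ^+ k.+2 / c) <= c * u ^+ 2 * expR u^-1.
  by rewrite ler_wpM2l// mulr_ge0 ?(ltW c0)// sqr_ge0.
apply: le_trans; rewrite -(addn2 k) exprD le_eqVlt; apply/orP; left; apply/eqP.
have uv : u ^+ 2 * u^-1 ^+ 2 = 1 by rewrite -exprMn divff ?expr1n ?gt_eqF.
transitivity (u^-1 ^+ k * (u ^+ 2 * u^-1 ^+ 2) * (c / c)); last first.
  by move: (u^-1) (c^-1) => v w; ring.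
by rewrite uv divff ?gt_eqF// !mulr1.
Qed.

Lemma is_derive_expinv k (u : R) :
  is_derive u 1 (expinv k) (- k%:R * expinv k.+1 u + expinv k.+2 u).
Proof.
have [u0|u0|u0] := ltgtP 0 u.
- have nu : u != 0 by rewrite gt_eqF.
  have h : is_derive u 1 (fun t : R => t^-1 ^+ k * expR (- t^-1))
      (- k%:R * expinv k.+1 u + expinv k.+2 u).
    have i1 : is_derive u 1 (fun t : R => t^-1) (- u ^- 2).
      apply: DeriveDef; first exact: (derivableV nu).
      by rewrite (@deriveV _ _ id)//= derive_id scaler1.
    have i2 : is_derive u 1 (fun t : R => t^-1 ^+ k)
        (k%:R * u^-1 ^+ k.-1 * (- u ^- 2)).
      have := is_deriveX k i1; rewrite (_ : _ ^+ k = (fun t : R => t^-1 ^+ k))//.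
      by apply/funext => t; rewrite exprfctE.
    have i3 := is_deriveN i1.
    have i4 := @is_derive1_comp R expR (fun t : R => - t^-1) u _ _ (is_derive_expR _) i3.
    have i5 := is_deriveM i2 i4.
    apply: (is_derive_eq i5).
    rewrite /expinv u0 -exprVn /GRing.scale /=.
    move: (u^-1) => w; move: (expR (- w)) => e.
    have -> : w ^+ k.+2 = w ^+ k * w ^+ 2 by rewrite -exprD addn2.
    case: (k) => [|n]; first by rewrite mulr0n oppr0 !mul0r mulr0 !add0r addr0; ring.
    by rewrite !exprS /=; move: n.+1%:R => c; ring.
  apply: near_eq_is_derive h.
  near=> t; rewrite /expinv ifT//; near: t.
  exact: lt_nbhsr.
- have h : is_derive u 1 (cst (0 : R)) 0 by exact: is_derive_cst.
  rewrite /expinv !ifF ?mulr0 ?addr0; [|exact: lt_gtF..].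
  apply: near_eq_is_derive h.
  near=> t; rewrite /expinv ifF//; apply/negbTE; rewrite -leNgt; apply/ltW; near: t.
  exact: lt_nbhsl.
rewrite -u0 /expinv !ltxx mulr0 addr0.
have H : h^-1 *: (expinv k (h *: 1 + 0) - expinv k 0) @[h --> (0 : R)^'] --> (0 : R).
  have c0 : 0 < (k.+2)`!%:R :> R by rewrite ltr0n fact_gt0.
  apply/cvgr0Pnorm_lt => e e0; near=> h.
  have hn : h != 0 by near: h; exact: nbhs_dnbhs_neq.
  have he : `|h| < e / (k.+2)`!%:R.
    near: h; apply: dnbhs0_lt; exact: divr_gt0.
  rewrite addr0 [h *: 1]mulr1 {2}/expinv ltxx subr0 [_ *: _]/(_ * _) normrM normfV.
  rewrite ltr_pdivrMl ?normr_gt0//; apply: (le_lt_trans (expinv_le _ _)).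
  rewrite -real_normK ?num_real// expr2 mulrCA ltr_pM2l ?normr_gt0//.
  by rewrite -ltr_pdivlMl// mulrC.
apply: DeriveDef; first exact: cvgP H.
exact: cvg_lim H.
Unshelve. all: by end_near. Qed.

Variable d : nat.

Definition ball_gauge (x : 'rV[R]_d) : R := 1 - \sum_j x ord0 j * x ord0 j.

Lemma ball_gauge_le1 x : ball_gauge x <= 1.
Proof. by rewrite /ball_gauge gerBl sumr_ge0// => j _; rewrite -expr2 sqr_ge0. Qed.

Lemma has_partials_ball_gauge :
  has_partials ball_gauge (fun i x => - 2 * x ord0 i).
Proof.
have h := has_partialsB (has_partials_cst 1) (has_partials_sum (index_enum 'I_d)
  (fun j => has_partialsM (@has_partials_coor R d j) (has_partials_coor j))).
apply: has_partials_eq h => // i x.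
rewrite sub0r (bigD1 i)//= big1 => [|j ji]; last first.
  by rewrite eq_sym (negbTE ji) mul0r mulr0 addr0.
by rewrite eqxx mulr1 mul1r addr0; ring.
Qed.

(** A derivative raises [k] by one and two, so the induction on the order is uniform in [k]. The
    values are bounded: where [expinv] is nonzero, the gauge lies in (0, 1]. *)
Lemma tame_expinv_gauge k : tame (fun x => expinv k (ball_gauge x)).
Proof.
have b j x r : 0 < r -> `|expinv j (ball_gauge x)| <= j.+2`!%:R * expR (r * enorm x).
  move=> r0; have [q0|q0] := ltP 0 (ball_gauge x); last first.
    by rewrite /expinv ltNge q0 /= normr0 mulr_ge0// expR_ge0.
  apply: (le_trans (expinv_le _ _)); rewrite ler_wpM2l//.
  apply: (@le_trans _ _ 1); first by rewrite exprn_ile1 ?(ltW q0) ?ball_gauge_le1.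
  by rewrite -[leLHS]expR0 ler_expR mulr_ge0 ?enorm_ge0 ?(ltW r0).
move=> r r0 N; elim: N r r0 k => [|N IH] r r0 k.
  by exists k.+2`!%:R; split=> // x; exact: b.
have r2 : 0 < r / 2 by rewrite divr_gt0.
have [M1 j1] := IH _ r2 k.+1.
have [M2 j2] := IH _ r2 k.+2.
have hp := has_partials_comp (is_derive_expinv k) has_partials_ball_gauge.
have j3 i := jet_leM (jet_leD (jet_leZ (- k%:R) j1) j2) (jet_leZ (- 2) (jet_le_coor N i r2)).
move: j3; set M3 := _ * (_ + M2) * _ => j3.
have k0 : 0 <= k.+2`!%:R :> R by [].
exists (k.+2`!%:R + `|M3|); apply: (jet_leS hp) => [x|i].
  by apply: (le_trans (b k x r r0)); rewrite ler_wpM2r ?expR_ge0// lerDl.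
apply: jet_le_mono (j3 i); first by rewrite -splitr.
by apply: (le_trans (ler_norm _)); rewrite lerDr.
Qed.

(** The factor [expR 1] normalises the value at 0 to 1, so that dilated copies converge to 1. *)
Definition bump (x : 'rV[R]_d) : R := expR 1 * expinv 0 (ball_gauge x).

Lemma tame_bump : tame bump.
Proof. exact/tameZ/tame_expinv_gauge. Qed.

Lemma bump0 : bump 0 = 1.
Proof.
rewrite /bump /ball_gauge big1 => [|j _]; last by rewrite mxE mul0r.
rewrite subr0 /expinv ltr01 expr0 mul1r invr1 -expRD subrr; exact: expR0.
Qed.

Lemma bump_ge0_le1 x : 0 <= bump x <= 1.
Proof.
rewrite /bump /expinv; case: ifPn => q0; last by rewrite mulr0 lexx ler01.
rewrite expr0 mul1r -expRD expR_ge0/= -[leRHS]expR0 ler_expR.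
by rewrite subr_le0 -[leLHS]invr1 lef_pV2 ?posrE ?ball_gauge_le1.
Qed.

Lemma bump_support x : bump x != 0 -> enorm x <= 1.
Proof.
move=> b0; have q0 : 0 < ball_gauge x.
  by apply: contrapT => /negP q0; move: b0; rewrite /bump /expinv (negbTE q0) mulr0 eqxx.
rewrite -ler_sqr ?nnegrE ?enorm_ge0// expr1n sqr_enorm.
by move: q0; rewrite /ball_gauge subr_gt0 => /ltW.
Qed.

Lemma test_functionI phi (r : R) : smooth phi ->
  (forall x : 'rV[R]_d, phi x != 0 -> enorm x <= r) -> test_function phi.
Proof.
move=> sphi h; split=> //.
have c := @compact_norm_ball R d r.
apply: subclosed_compact c _; first exact: closed_closure.
have cl : closed [set x : 'rV[R]_d | `|x| <= r] by exact: (compact_closed _ (@compact_norm_ball R d r)).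
rewrite [X in _ `<=` X](closure_id _).1//; apply: closureS => x /= /h.
exact: le_trans (norm_le_enorm x).
Qed.

(** Derivatives carry an explicit factor [k], and the value itself is at most of order k |x| by the
    mean value theorem, with |x| absorbed by half of the rate. Dilated cutoffs thus converge to 1 in
    weighted norms. *)
Lemma jet_le_rescale chi (r : R) N : tame chi -> 0 < r -> exists C, forall k : R,
  0 <= k <= 1 -> jet_le N r (C * k) (fun x : 'rV[R]_d => chi 0 - chi (k *: x)).
Proof.
move=> tchi r0; have r2 : 0 < r / 2 by rewrite divr_gt0.
have schi := tame_smooth tchi.
have hD := smooth_has_partials schi.
have [M jM] := tchi _ r2 N.+1.
have {}jM i : jet_le N (r / 2) M (pderivs [:: i] chi).
  by have := @jet_le_pderivs R d N.+1 (r / 2) M chi [:: i] isT jM; rewrite subSS subn0.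
(* The bounds on the partial derivatives force [0 <= M] as soon as an index exists; a negative [M]
   leaves only dimension 0, where every row is 0. *)
have [M0|Mn] := leP 0 M; last first.
  have d0 (i : 'I_d) : False by have := jet_le_ge0 (jM i); rewrite leNgt Mn.
  exists 0 => k _; rewrite mul0r.
  have E (x : 'rV[R]_d) : x = 0 by apply/rowP => i; case: (d0 i).
  rewrite (_ : (fun x => _) = fun=> 0).
    by have := @jet_le_cst R d N r 0 (ltW r0); rewrite normr0.
  by apply/funext => x; rewrite (E (k *: x)) subrr.
pose K := M * (d%:R * (r / 2)^-1 + 1).
exists K => k /andP[k0 k1].
have kn : `|k| <= 1 by rewrite ger0_norm.
have b (x : 'rV[R]_d) : `|chi 0 - chi (k *: x)| <= K * k * expR (r * enorm x).
  have [t /andP[t0 t1]] := mean_value 0 (k *: x) hD; rewrite !add0r => E.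
  rewrite distrC E; apply: (le_trans (ler_norm_sum _ _ _)).
  apply: (@le_trans _ _ (\sum_(j < d) (k * enorm x * (M * expR (r / 2 * enorm x))))).
    apply: ler_sum => j _; rewrite normrM mxE normrM ger0_norm//.
    apply: ler_pM => //; first by rewrite mulr_ge0.
      by rewrite ler_wpM2l// coor_le_enorm.
    apply: (le_trans (jet_le_bound _ (jM j))); rewrite ler_wpM2l// ler_expR.
    rewrite ler_wpM2l ?(ltW r2)// scalerA enormZ ger0_norm ?mulr_ge0//.
    by rewrite ler_piMl ?enorm_ge0// mulr_ile1.
  rewrite sumr_const card_ord -[leLHS]mulr_natl.
  have := enorm_le_expR x r2; set e := expR (r / 2 * enorm x) => he.
  have e0 : 0 <= e by exact: expR_ge0.
  have -> : expR (r * enorm x) = e * e.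
    by rewrite /e -expRD; congr expR; field.
  apply: (@le_trans _ _ (d%:R * (k * ((r / 2)^-1 * e) * (M * e)))).
    by rewrite ler_wpM2l// ler_wpM2r ?mulr_ge0// ler_wpM2l.
  rewrite [leRHS](_ : _ = d%:R * (k * ((r / 2)^-1 * e) * (M * e)) + M * k * (e * e)); last first.
    by rewrite /K; move: ((r / 2)^-1) => w; ring.
  by rewrite lerDl !mulr_ge0.
case: N jM => [|N] jM; first by split.
have hp := has_partialsB (has_partials_cst (chi 0)) (has_partials_affine k 0 hD).
rewrite (_ : (fun x => _) = (fun x => chi 0 - chi (k *: x + 0))); last first.
  by apply/funext => x; rewrite addr0.
apply: (jet_leS hp) => [x|i]; first by rewrite addr0; exact: b.
rewrite (_ : (fun x => _) = fun x => (- k) * pderivs [:: i] chi (k *: x + 0)); last first.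
  by apply/funext => x; rewrite sub0r mulNr.
apply: jet_le_mono (jet_leZ (- k) (jet_le_affine 0 (ltW r2) kn (jet_leW (leqnSn N) (jM i)))).
  by rewrite ler_piMr ?(ltW r0)// invf_le1// ler1n.
rewrite normrN ger0_norm// [leRHS]mulrC ler_wpM2l//.
rewrite -[X in enorm X](scale0r 0) enormZ normr0 mul0r mulr0 expR0 mulr1.
by rewrite /K mulrDr mulr1 lerDr !mulr_ge0// invr_ge0 ltW.
Qed.

End bump.

(** * Borel sets for the product sigma-algebra *)

Section borel_row.
Variables (R : realType) (d : nat).

(** Boxes with rational centre and width 2 / (n + 1) are countably many, and those inside [U] cover
    it. *)
Lemma open_measurable_row (U : set 'rV[R]_d) : open U -> measurable U.
Proof.
move=> oU.
pose box (q : {ffun 'I_d -> rat} * nat) := [set x : 'rV[R]_d |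
  forall i, ratr (q.1 i) - q.2.+1%:R^-1 < x ord0 i < ratr (q.1 i) + q.2.+1%:R^-1].
have mbox q : measurable (box q).
  rewrite (_ : box q = \big[setI/setT]_(i < d)
      ((fun x : 'rV[R]_d => x ord0 i : measurableTypeR R) @^-1`
        `]ratr (q.1 i) - q.2.+1%:R^-1, ratr (q.1 i) + q.2.+1%:R^-1[)).
    apply: bigsetI_measurable => i _.
    by rewrite -[X in measurable X]setTI; apply: measurable_coor => //; exact: measurable_itv.
  apply/seteqP; split => x; rewrite -bigcap_seq /= => h i.
    by move=> _; rewrite /= in_itv /=; exact: h.
  by have := h i (mem_index_enum _); rewrite /= in_itv.
pose F k := if unpickle k is Some q then
  if `[< box q `<=` U >] then box q else set0 else set0.
have -> : U = \bigcup_k F k.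
  apply/seteqP; split => [x Ux|x [k _]]; last first.
    rewrite /F; case: (unpickle k) => [q|//].
    by case: asboolP => // sub; exact: sub.
  have /nbhs_ballP[e /= e0 eU] : nbhs x U by exact: open_nbhs_nbhs.
  (* The half-width is below [e / 2], because two points of one box are compared. *)
  have [n _ /(_ n (leqnn _)) hn] := near_infty_natSinv_lt (PosNum (divr_gt0 e0 (ltr0Sn R 1))).
  have n0 : 0 < n.+1%:R^-1 :> R by rewrite invr_gt0.
  have /choice[q hq] : forall i, exists q : rat, ratr q \in `]x ord0 i - n.+1%:R^-1, x ord0 i + n.+1%:R^-1[.
    by move=> i; apply: rat_in_itvoo; rewrite ltrBlDr -addrA ltrDl addr_gt0.
  have bx : box ([ffun i => q i], n) x.
    move=> i /=; rewrite ffunE; have := hq i; rewrite in_itv /= => /andP[a b].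
    by rewrite ltrBlDr b -ltrBlDr.
  exists (pickle ([ffun i => q i], n)) => //; rewrite /F pickleK.
  case: asboolP => // -[] y yb; apply: eU; rewrite -ball_normE /=.
  rewrite [X in X < _]/Num.norm/= mx_normrE; apply/bigmax_ltP; split=> // -[i j] _ /=.
  rewrite (_ : i = ord0); last exact: ord1.
  rewrite !mxE; have := yb j; have := bx j; rewrite /= ffunE.
  move: hn => /=; rewrite ltr_pdivlMr// => hn /andP[a b] /andP[a' b'].
  rewrite ltr_norml; move: (ratr (q j)) (n.+1%:R^-1) (x ord0 j) (y ord0 j) hn a b a' b'.
  by move=> q' n' x' y' hn a b a' b'; apply/andP; split; lra.
apply: bigcupT_measurable => k; rewrite /F; case: (unpickle k) => [q|//].
by case: ifP.
Qed.

Lemma continuous_measurable_row (phi : 'rV[R]_d -> R) :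
  continuous phi -> measurable_fun setT phi.
Proof.
move=> cphi; apply: (measurability _ (RGenOpens.measurableE R)).
move=> _ [_ [a [b ->] <-]]; rewrite setTI.
by apply: open_measurable_row; apply: open_comp; [move=> x _; exact: cphi|exact: interval_open].
Qed.

End borel_row.

(** * From the functional to integrals of f *)

Section dual_rep_theory.
Variables (R : realType) (d : nat) (gamma : R) (f : 'rV[R]_d -> R).
Variable L : ('rV[R]_d -> R) -> R.
Hypothesis (gamma_gt0 : 0 < gamma) (repL : dual_rep gamma f L).
Implicit Types (phi psi : 'rV[R]_d -> R).
Local Notation mu := (lebesgue_row R d).

Lemma dual_rep_eq phi psi : phi =1 psi -> L phi = L psi.
Proof. by move=> /funext ->. Qed.

Lemma dual_rep0 : L (fun=> 0) = 0.
Proof.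
have := dual_rep_linear repL (-1) (@tame_cst R d 0) (@tame_cst R d 0).
rewrite (dual_rep_eq (psi := fun=> 0)); first lra.
by move=> x; rewrite mulr0 addr0.
Qed.

Lemma dual_repZ c phi : tame phi -> L (fun x => c * phi x) = c * L phi.
Proof.
move=> t; have := dual_rep_linear repL c t (@tame_cst R d 0).
rewrite dual_rep0 addr0 => <-; apply: dual_rep_eq => x; exact/esym/addr0.
Qed.

Lemma dual_repB phi psi : tame phi -> tame psi ->
  L (fun x => phi x - psi x) = L phi - L psi.
Proof.
move=> t1 t2; have := dual_rep_linear repL (-1) t2 t1.
by rewrite mulN1r addrC => <-; apply: dual_rep_eq => x; rewrite mulN1r addrC.
Qed.

Lemma dual_rep_sum (I : Type) (r : seq I) (c : I -> R)
  (phi : I -> 'rV[R]_d -> R) : (forall i, tame (phi i)) ->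
  L (fun x => \sum_(i <- r) c i * phi i x) = \sum_(i <- r) c i * L (phi i).
Proof.
move=> t; elim: r => [|i r IH].
  by rewrite big_nil -[RHS]dual_rep0; apply: dual_rep_eq => x; rewrite big_nil.
rewrite big_cons -IH -(dual_rep_linear repL)//.
  by apply: dual_rep_eq => x; rewrite big_cons.
by apply: tame_sum => j; exact: tameZ.
Qed.

Definition cutoff n (x : 'rV[R]_d) : R := bump (n.+1%:R^-1 *: x).

Lemma tame_cutoff n : tame (cutoff n).
Proof.
have := @tame_affine R d n.+1%:R^-1 0 _ _ (@tame_bump R d).
under eq_fun do rewrite addr0; apply.
by rewrite ger0_norm ?invr_ge0// invf_le1// ler1n.
Qed.

Lemma test_function_cutoff n phi : tame phi ->
  test_function (fun x => phi x * cutoff n x).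
Proof.
move=> t; apply: (@test_functionI R d _ n.+1%:R).
  by apply: tame_smooth; apply: tameM => //; exact: tame_cutoff.
move=> x; rewrite mulf_eq0 negb_or => /andP[_ /bump_support].
by rewrite enormZ ger0_norm ?invr_ge0// ler_pdivrMl// mulr1.
Qed.

(** The functional is tied to f on test functions only, and this limit is the bridge to tame ones:
    [phi] and one minus the cutoff each take rate [gamma / 2], the latter with a constant of order 1
    / n. *)
Lemma dual_rep_cutoff phi : tame phi ->
  L (fun x => phi x * cutoff n x) @[n --> \oo] --> L phi.
Proof.
move=> t; have [C [N [C0 bL]]] := dual_rep_bound repL.
have g2 : 0 < gamma / 2 by rewrite divr_gt0.
have [M jM] := t _ g2 N.
have [K HK] := jet_le_rescale N (@tame_bump R d) g2.
apply/cvgrPdist_le => e e0.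
have ev : \forall n \near \oo, C * (2 ^+ N * M * (K * n.+1%:R^-1)) <= e.
  have : C * (2 ^+ N * M * (K * n.+1%:R^-1)) @[n --> \oo] --> C * (2 ^+ N * M * (K * 0)).
    by do 3 (apply: cvgM; first exact: cvg_cst); exact: cvg_harmonic.
  rewrite !mulr0 => /cvgrPdist_le/(_ _ e0); apply: filterS => n.
  by rewrite sub0r normrN => /(le_trans (ler_norm _)).
apply: filterS ev => n; apply: le_trans.
have tc := tameM t (tame_cutoff n).
rewrite -dual_repB//; apply: bL; first exact: tameB.
have -> : (fun x => phi x - phi x * cutoff n x) =
    (fun x => phi x * (bump (0 : 'rV[R]_d) - bump (n.+1%:R^-1 *: x))).
  by apply/funext => x; rewrite bump0 mulrBr mulr1.
have kn : 0 <= (n.+1%:R^-1 : R) <= 1.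
  by rewrite invr_ge0 ler0n/= invf_le1// ler1n.
by have := jet_leM jM (HK _ kn); rewrite -splitr.
Qed.

Lemma measurable_cutoff n : measurable_fun setT (cutoff n).
Proof.
apply: continuous_measurable_row => x.
exact: differentiable_continuous (tame_smooth (tame_cutoff n) [::] x).
Qed.

Lemma cutoff_cvg1 x : cutoff n x @[n --> \oo] --> (1 : R).
Proof.
have cb : continuous (@bump R d).
  by move=> y; exact: differentiable_continuous (tame_smooth (@tame_bump R d) [::] y).
rewrite -(@bump0 R d); apply: continuous_cvg; first exact: cb.
rewrite -[X in _ --> X](scale0r x); apply: cvgZl; exact: cvg_harmonic.
Qed.

(** Both sides agree on the cutoffs of [phi]. The functional passes to the limit by
    [dual_rep_cutoff], the integral by dominated convergence, where boundedness compensates for f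
    being merely integrable. *)
Lemma dual_rep_pairing phi : tame phi -> bmeas phi -> L phi = pairing mu f phi.
Proof.
move=> t [mphi [K HK]].
have c1 : L (fun x => phi x * cutoff n x) @[n --> \oo] --> L phi by exact: dual_rep_cutoff.
have K0 : 0 <= K by apply: le_trans (HK 0).
have c2 : pairing mu f (fun x => phi x * cutoff n x) @[n --> \oo] --> pairing mu f phi.
  apply: (pairing_cvg (dual_rep_integrable repL) (K := K)) => [n|n x|x].
  - by apply: measurable_funM => //; exact: measurable_cutoff.
  - rewrite normrM; apply: le_trans (HK x); rewrite ler_piMr//.
    by have /andP[b0 b1] := bump_ge0_le1 (n.+1%:R^-1 *: x); rewrite ger0_norm.
  - rewrite -[X in _ --> X]mulr1; apply: cvgM; first exact: cvg_cst.
    exact: cutoff_cvg1.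
move: c1; rewrite (_ : (fun n => L _) = fun n => pairing mu f (fun x => phi x * cutoff n x)).
  by move/(cvg_unique (@Rhausdorff R) c2) => ->.
apply/funext => n; rewrite (dual_rep_test repL)//; first by apply: tameM => //; exact: tame_cutoff.
exact: test_function_cutoff.
Qed.

Lemma dual_rep_ae0 phi : {ae mu, forall x, f x = 0} -> tame phi -> L phi = 0.
Proof.
move=> f0 t.
have c1 : L (fun x => phi x * cutoff n x) @[n --> \oo] --> L phi by exact: dual_rep_cutoff.
move: c1; rewrite (_ : (fun n => L _) = fun=> 0).
  by move/(cvg_unique (@Rhausdorff R) (cvg_cst 0)) => ->.
apply/funext => n; rewrite (dual_rep_test repL).
- rewrite /Rintegral (_ : (\int[mu]_x _ = \int[mu]_x cst 0 x)%E); first by rewrite integral_cst// mul0e.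
  apply: ae_eq_integral => //.
  + apply/measurable_EFinP; apply: measurable_funM.
      by apply/measurable_EFinP; have /integrableP[] := dual_rep_integrable repL.
    apply: measurable_funM; last exact: measurable_cutoff.
    apply: continuous_measurable_row => x.
    exact: differentiable_continuous (tame_smooth t [::] x).
  + by apply: filterS f0 => x /= -> _; rewrite mul0r.
- by apply: tameM => //; exact: tame_cutoff.
- exact: test_function_cutoff.
Qed.

End dual_rep_theory.

(** * Vanishing moments *)

Section cosine_remainder.
Variables (R : realType) (d : nat).

(* The Taylor remainder at 0 of the function cos (t + a). *)
Fixpoint cosrem (m : nat) (a t : R) : R :=
  if m is m'.+1 then
    cosrem m' a t - cos (a + m'%:R * (pi / 2)) * (t ^+ m' / m'`!%:R)
  else cos (t + a).

(** Differentiating a cosine advances its phase by pi / 2, and the phase parameter keeps the family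
    closed. At [m = 0] the predecessor is again 0, which is right for the cosine itself. *)
Lemma is_derive_cosrem m (a t : R) :
  is_derive t 1 (cosrem m a) (cosrem m.-1 (a + pi / 2) t).
Proof.
elim: m => [|m IH] /=.
  have h1 : is_derive t 1 (fun s : R => s + a) 1.
    by apply: is_derive_eq; rewrite addr0.
  have h2 := @is_derive1_comp R cos (fun s : R => s + a) t _ _ (is_derive_cos _) h1.
  by apply: (is_derive_eq h2); rewrite mulr1 addrA cosDpihalf.
set c := cos (a + m%:R * (pi / 2)).
have hp : is_derive t 1 (fun s : R => s ^+ m / m`!%:R)
    (if m is p.+1 then t ^+ p / p`!%:R else 0).
  have h1 : is_derive t 1 (fun s : R => s ^+ m) (m%:R * t ^+ m.-1).
    have := @is_deriveX R R id m t 1 1 (is_derive_id _ _).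
    rewrite (_ : id ^+ m = fun s : R => s ^+ m); last by apply/funext => s; rewrite exprfctE.
    by move=> h; apply: (is_derive_eq h); rewrite /= /GRing.scale /= mulr1.
  have h2 := is_deriveZ (m`!%:R^-1) h1.
  have h3 : is_derive t 1 (fun s : R => s ^+ m / m`!%:R) (m`!%:R^-1 *: (m%:R * t ^+ m.-1)).
    have -> : (fun s : R => s ^+ m / m`!%:R) = (fun s => m`!%:R^-1 * s ^+ m).
      by apply/funext => s; rewrite mulrC.
    exact: h2.
  apply: (is_derive_eq h3); case: (m) => [|p]; rewrite /GRing.scale /=.
    by rewrite mul0r mulr0.
  have f0 : p`!%:R != 0 :> R by rewrite pnatr_eq0 -lt0n fact_gt0.
  have p0 : p.+1%:R != 0 :> R by rewrite pnatr_eq0.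
  by rewrite factS natrM; field; rewrite ?p0 ?f0 ?nat1r ?p0 ?andbT.
have h := is_deriveB IH (is_deriveZ c hp).
apply: (is_derive_eq h) => {h hp IH}; rewrite {}/c /GRing.scale /=; case: m => [|m].
  by rewrite mulr0 subr0.
rewrite /=; congr (_ - cos _ * _).
by rewrite -addrA; congr (_ + _); rewrite -natr1; ring.
Qed.

Lemma cosremS0 m a : cosrem m.+1 a 0 = 0.
Proof.
elim: m => [|m IH]; first by rewrite /= add0r mul0r addr0 expr0 divr1 mulr1 subrr.
rewrite -[LHS]/(cosrem m.+1 a 0 - _) IH expr0n mul0r mulr0 subr0//.
Qed.

(** The bound is chosen to reproduce itself: the derivative of 2^-(m+1) e^(2t) is 2^-m e^(2t), so
    integrating the bound for [m] gives the one for [m + 1]. It trades factorial decay for a clean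
    geometric rate. The sign [e] covers both half-lines. *)
Lemma cosrem_le m (a e t : R) : e ^+ 2 = 1 -> 0 <= t ->
  `|cosrem m a (e * t)| <= 2^-1 ^+ m * expR (2 * t).
Proof.
move=> e1; elim: m a t => [|m IH] a t t0.
  rewrite expr0 mul1r /=; apply: (@le_trans _ _ 1).
    by rewrite ler_norml cos_geN1 cos_le1.
  by rewrite -[leLHS]expR0 ler_expR mulr_ge0.
have key s : s ^+ 2 = 1 -> s * cosrem m.+1 a (e * t) <= 2^-1 ^+ m.+1 * expR (2 * t).
  move=> s1.
  (* [G] is positive at 0 and has nonnegative derivative; [s] = 1 and -1 give the two halves of the
     absolute value. *)
  pose G (x : R) := 2^-1 ^+ m.+1 * expR (2 * x) - s * cosrem m.+1 a (e * x).
  have dG (x : R) : is_derive x 1 G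
      (2^-1 ^+ m * expR (2 * x) - s * (cosrem m (a + pi / 2) (e * x) * e)).
    have hl (k : R) : is_derive x 1 (fun y : R => k * y) k.
      have := @is_deriveZ _ _ _ id k x 1 1 (is_derive_id _ _).
      by rewrite scaler1.
    have h1 := is_deriveZ (2^-1 ^+ m.+1)
      (@is_derive1_comp R expR (fun y => 2 * y) x _ _ (is_derive_expR _) (hl 2)).
    have h2 := is_deriveZ s
      (@is_derive1_comp R (cosrem m.+1 a) (fun y => e * y) x _ _
        (is_derive_cosrem m.+1 a (e * x)) (hl e)).
    apply: (is_derive_eq (is_deriveB h1 h2)); rewrite /GRing.scale /=.
    by congr (_ - _); rewrite exprS; field.
  have [] := @MVT_segment R G _ 0 t t0 (fun x _ => dG x).
    apply: derivable_within_continuous => x _.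
    by have [] := dG x.
  move=> c cI; have /andP[c0 ct] : 0 <= c <= t by move: cI; rewrite in_itv.
  rewrite /G !mulr0 cosremS0 mulr0 !subr0 expR0 mulr1 => E.
  have h := IH (a + pi / 2) c c0.
  have P : 0 <= 2^-1 ^+ m * expR (2 * c) - s * (cosrem m (a + pi / 2) (e * c) * e).
    rewrite subr_ge0; apply: le_trans h; apply: (le_trans (ler_norm _)).
    have n1 (u : R) : u ^+ 2 = 1 -> `|u| = 1.
      move=> u1; have : `|u| ^+ 2 = 1 by rewrite real_normK ?num_real.
      by move/eqP; rewrite sqrp_eq1// => /eqP.
    by rewrite !normrM (n1 s s1) (n1 e e1) mul1r mulr1.
  have : 0 <= 2^-1 ^+ m.+1 :> R by rewrite exprn_ge0.
  have := mulr_ge0 P t0; rewrite -E; move: (cosrem m.+1 a (e * t)) => X.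
  by lra.
have k1 := key 1 (expr1n _ _).
have k2 : -1 * cosrem m.+1 a (e * t) <= 2^-1 ^+ m.+1 * expR (2 * t).
  by apply: key; rewrite sqrrN expr1n.
rewrite ler_norml; move: k1 k2; move: (cosrem m.+1 a (e * t)) => X k1 k2.
by apply/andP; split; lra.
Qed.

Definition trig (e : 'I_d * R * R) (x : 'rV[R]_d) : R :=
  cos (e.1.2 * x ord0 e.1.1 + e.2).

Definition trigs (l : seq ('I_d * R * R)) (x : 'rV[R]_d) : R :=
  \prod_(e <- l) trig e x.

Definition monomial (w : seq 'I_d) (x : 'rV[R]_d) : R := \prod_(j <- w) x ord0 j.

Lemma has_partials_cosrem m a (i : 'I_d) (h : R) :
  has_partials (fun x : 'rV[R]_d => cosrem m a (h * x ord0 i))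
  (fun j x => h * (j == i)%:R * cosrem m.-1 (a + pi / 2) (h * x ord0 i)).
Proof.
have h1 := has_partials_comp (is_derive_cosrem m a)
  (has_partialsZ h (@has_partials_coor R d i)).
by apply: has_partials_eq h1 => // j x; rewrite mulrC.
Qed.

(** Each derivative lowers [m] by one and so costs a factor 2 in 2^-m; over [N] derivatives this is
    [2 ^+ N]. *)
Lemma jet_le_cosrem N m a (i : 'I_d) (h : R) : 0 <= h <= 1 ->
  jet_le N (2 * h) (2 ^+ N * 2^-1 ^+ m)
    (fun x : 'rV[R]_d => cosrem m a (h * x ord0 i)).
Proof.
move=> /andP[h0 h1].
have b N' m' a' (x : 'rV[R]_d) : `|cosrem m' a' (h * x ord0 i)| <=
    2 ^+ N' * 2^-1 ^+ m' * expR (2 * h * enorm x).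
  apply: (@le_trans _ _ (2^-1 ^+ m' * expR (2 * (h * `|x ord0 i|)))).
    have [x0|x0] := leP 0 (x ord0 i).
      rewrite -[h * x ord0 i]mul1r (ger0_norm x0); apply: cosrem_le; first by rewrite expr1n.
      exact: mulr_ge0.
    rewrite (ltr0_norm x0) (_ : h * x ord0 i = -1 * (h * - x ord0 i)); last by ring.
    apply: cosrem_le; first by rewrite sqrrN expr1n.
    by rewrite mulr_ge0// oppr_ge0 ltW.
  apply: ler_pM; rewrite ?exprn_ge0 ?expR_ge0//.
    by rewrite ler_peMl ?exprn_ge0// exprn_ege1// ler1n.
  by rewrite ler_expR -mulrA ler_wpM2l// ler_wpM2l// coor_le_enorm.
elim: N m a => [|N IH] m a; first by split=> // x; exact: b.
apply: (jet_leS (has_partials_cosrem m a i h)) => [x|j]; first exact: b.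
apply: jet_le_mono (jet_leZ (h * (j == i)%:R) (IH m.-1 (a + pi / 2))) => //.
apply: (@le_trans _ _ (1 * (2 ^+ N * 2^-1 ^+ m.-1))).
  rewrite ler_wpM2r ?mulr_ge0 ?exprn_ge0//.
  rewrite normrM ger0_norm// mulr_ile1//.
  by case: (j == i); rewrite ?normr1 ?normr0.
rewrite mul1r exprS; case: m => [|m] /=.
  by rewrite expr0 !mulr1 ler_peMl ?exprn_ge0// ler1n.
by rewrite exprS; have := exprn_ge0 N (ler0n R 2); nra.
Qed.

Lemma tame_trig (e : 'I_d * R * R) : 0 <= e.1.2 <= 1 -> tame (trig e).
Proof.
case: e => -[i h] a /= h01 r r0 N; exists 1.
rewrite /trig /=; rewrite -[fun x => _]/(fun x : 'rV[R]_d => cosrem 0 a (h * x ord0 i)).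
have b (x : 'rV[R]_d) a' : `|cosrem 0 a' (h * x ord0 i)| <= 1 * expR (r * enorm x).
  rewrite mul1r /=; apply: (@le_trans _ _ 1); first by rewrite ler_norml cos_geN1 cos_le1.
  by rewrite -[leLHS]expR0 ler_expR mulr_ge0 ?enorm_ge0// ltW.
elim: N a => [|N IH] a; first by split.
apply: (jet_leS (has_partials_cosrem 0 a i h)) => [x|j]; first exact: b.
apply: jet_le_mono (jet_leZ (h * (j == i)%:R) (IH (a + pi / 2))) => //.
rewrite mulr1 normrM; case/andP: h01 => h0 h1; rewrite ger0_norm// mulr_ile1//.
by case: (j == i); rewrite ?normr1 ?normr0.
Qed.

Lemma monomial_nseq m i x : monomial (nseq m i) x = x ord0 i ^+ m.
Proof.
elim: m => [|m IH]; first by rewrite /monomial big_nil.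
by rewrite /monomial /= big_cons exprS -IH.
Qed.

Lemma monomial_cat w w' x : monomial (w ++ w') x = monomial w x * monomial w' x.
Proof. exact: big_cat. Qed.

Lemma tame_cosrem m a (i : 'I_d) (h : R) : 0 <= h <= 1 ->
  tame (fun x : 'rV[R]_d => cosrem m a (h * x ord0 i)).
Proof.
move=> h01; elim: m => [|m IH]; first exact: (@tame_trig (i, h, a)).
have -> : (fun x : 'rV[R]_d => cosrem m.+1 a (h * x ord0 i)) =
    (fun x => cosrem m a (h * x ord0 i) -
      cos (a + m%:R * (pi / 2)) * (h ^+ m / m`!%:R) * monomial (nseq m i) x).
  apply/funext => x; rewrite monomial_nseq /= exprMn; congr (_ - _).
  by rewrite -!mulrA; congr (_ * (_ * _)); rewrite mulrC.
apply: tameB => //; apply: tameZ; exact: tame_prod_coor.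
Qed.

Lemma tame_trigs l : (forall e, e \in l -> 0 <= e.1.2 <= 1) -> tame (trigs l).
Proof.
rewrite /trigs; elim: l => [|e l IH] h.
  by under eq_fun do rewrite big_nil; exact: tame_cst.
under eq_fun do rewrite big_cons.
apply: tameM; first by apply: tame_trig; apply: h; rewrite mem_head.
by apply: IH => e' el; apply: h; rewrite inE el orbT.
Qed.

Lemma bmeas_trig e : bmeas (trig e).
Proof.
split; last by exists 1 => x; rewrite ler_norml cos_geN1 cos_le1.
apply: continuous_measurable_row => x.
have [dt _] := has_partials_cosrem 0 e.2 e.1.1 e.1.2 x.
exact: differentiable_continuous dt.
Qed.

Lemma bmeas_trigs l : bmeas (trigs l).
Proof. by apply: bmeas_prod => e; exact: bmeas_trig. Qed.

End cosine_remainder.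

Section vanishing_moments.
Variables (R : realType) (d : nat) (gamma : R) (f : 'rV[R]_d -> R).
Variable L : ('rV[R]_d -> R) -> R.
Hypothesis (gamma_gt0 : 0 < gamma) (repL : dual_rep gamma f L).
Hypothesis moments0 : forall w, L (monomial w) = 0.
Local Notation mu := (lebesgue_row R d).

(** Replacing the first cosine by its remainders of increasing order changes nothing: consecutive
    ones differ by a monomial times the shorter product, killed by the induction hypothesis for a
    longer word. The remainders tend to 0, with rate 2h <= gamma / 2 and gamma / 2 left for the
    other factors. *)
Lemma dual_rep_monomial_trigs (l : seq ('I_d * R * R)) w :
  (forall e, e \in l -> 0 <= e.1.2 <= 1 /\ e.1.2 <= gamma / 4) ->
  L (fun x => monomial w x * trigs l x) = 0.
Proof.
elim: l w => [|[[i h] a] l IH] w hl.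
  rewrite -[RHS](moments0 w); apply: dual_rep_eq => x.
  by rewrite /trigs big_nil mulr1.
have [h01 hg] := hl _ (mem_head _ _); rewrite /= in h01 hg.
have hl' e : e \in l -> 0 <= e.1.2 <= 1 /\ e.1.2 <= gamma / 4.
  by move=> el; apply: hl; rewrite inE el orbT.
have tl : tame (trigs l) by apply: tame_trigs => e /hl'[].
pose psi w (x : 'rV[R]_d) := monomial w x * trigs l x.
have tpsi w' : tame (psi w') by apply: tameM => //; exact: tame_prod_coor.
pose rho m (x : 'rV[R]_d) := cosrem m a (h * x ord0 i) * psi w x.
have trho m : tame (rho m) by apply: tameM => //; exact: tame_cosrem.
have -> : L (fun x => monomial w x * trigs ((i, h, a) :: l) x) = L (rho 0).
  by apply: dual_rep_eq => x; rewrite /rho /psi /trigs big_cons /= mulrCA.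
have E m : L (rho m) = L (rho 0).
  elim: m => [//|m <-].
  pose c := cos (a + m%:R * (pi / 2)) * (h ^+ m / m`!%:R).
  have := dual_repB repL (trho m) (tameZ c (tpsi (nseq m i ++ w))).
  rewrite (dual_repZ repL)// IH// mulr0 subr0 => <-; apply: dual_rep_eq => x.
  rewrite /rho /psi monomial_cat monomial_nseq /= exprMn /c.
  by move: (m`!%:R^-1) => v; ring.
have [C [N [C0 bL]]] := dual_rep_bound repL.
have g2 : 0 < gamma / 2 by rewrite divr_gt0.
have [M jM] := tpsi w _ g2 N.
have M0 := jet_le_ge0 jM.
have b m : `|L (rho 0)| <= C * (2 ^+ N * (2 ^+ N * 2^-1 ^+ m) * M).
  rewrite -(E m); apply: bL => //.
  apply: jet_le_mono (jet_leM (jet_le_cosrem N m a i h01) jM) => //.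
  by move: hg; lra.
have cv : C * (2 ^+ N * (2 ^+ N * 2^-1 ^+ m) * M) @[m --> \oo] -->
    C * (2 ^+ N * (2 ^+ N * 0) * M).
  apply: cvgM; first exact: cvg_cst.
  apply: cvgM; last exact: cvg_cst.
  do 2 (apply: cvgM; first exact: cvg_cst).
  by apply: cvg_expr; rewrite ger0_norm; lra.
have : `|L (rho 0)| <= C * (2 ^+ N * (2 ^+ N * 0) * M).
  by apply: (cvgr_to_ge cv); exact: nearW.
by rewrite !(mulr0, mul0r) normr_le0 => /eqP.
Qed.

Lemma pairing_trigs0 l :
  (forall e, e \in l -> 0 <= e.1.2 <= 1 /\ e.1.2 <= gamma / 4) ->
  pairing mu f (trigs l) = 0.
Proof.
move=> hl; rewrite -(dual_rep_pairing gamma_gt0 repL); last exact: bmeas_trigs.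
  rewrite -(dual_rep_monomial_trigs [::] hl); apply: dual_rep_eq => x.
  by rewrite /monomial big_nil mul1r.
by apply: tame_trigs => e /hl[].
Qed.

End vanishing_moments.

(** * Polynomials converging to a step function *)

Section threshold.
Variable R : realType.

Lemma bernoulli (x : R) n : 0 <= x -> 1 + n%:R * x <= (1 + x) ^+ n.
Proof.
move=> x0; elim: n => [|n IH]; first by rewrite mul0r addr0 expr0.
rewrite exprS -natr1.
have : (1 + x) * (1 + n%:R * x) <= (1 + x) * (1 + x) ^+ n by rewrite ler_wpM2l// addr_ge0.
apply: le_trans.
have : 0 <= n%:R * x * x by rewrite !mulr_ge0.
lra.
Qed.

Lemma bernoulliB (x : R) n : 0 <= x <= 1 -> 1 - n%:R * x <= (1 - x) ^+ n.
Proof.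
move=> /andP[x0 x1]; elim: n => [|n IH]; first by rewrite mul0r subr0 expr0.
rewrite exprS -natr1.
have : (1 - x) * (1 - n%:R * x) <= (1 - x) * (1 - x) ^+ n by rewrite ler_wpM2l// subr_ge0.
apply: le_trans.
have : 0 <= n%:R * x * x by rewrite !mulr_ge0.
lra.
Qed.

Lemma cvg_nat_geometric (r : R) : 0 <= r < 1 -> n%:R * r ^+ n @[n --> \oo] --> (0 : R).
Proof.
(* By the arithmetic-geometric mean inequality [r] <= s^2, so one power s^n absorbs [n] (Bernoulli)
   and the other still decays. *)
move=> /andP[r0 r1]; pose s := (1 + r) / 2.
have s0 : 0 < s by rewrite divr_gt0// ltr_wpDr.
have s1 : s < 1 by rewrite /s; lra.
pose h := s^-1 - 1; have h0 : 0 < h by rewrite subr_gt0 invf_gt1.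
have b n : n%:R * r ^+ n <= h^-1 * s ^+ n.
  have rs : r ^+ n <= s ^+ n * s ^+ n.
    rewrite -exprMn; apply: lerXn2r; rewrite ?nnegrE//.
      exact: mulr_ge0 (ltW s0) (ltW s0).
    by rewrite /s; have := sqr_ge0 (1 - r); rewrite expr2; lra.
  have hn : n%:R * s ^+ n <= h^-1.
    rewrite -[leRHS]mul1r ler_pdivlMr// mulrAC.
    have := bernoulli n (ltW h0).
    have -> : 1 + h = s^-1 by rewrite /h addrC subrK.
    rewrite exprVn => hb.
    rewrite -ler_pdivlMr ?exprn_gt0// mul1r; apply: le_trans hb.
    by rewrite lerDr.
  apply: (@le_trans _ _ (n%:R * (s ^+ n * s ^+ n))); first by rewrite ler_wpM2l.
  by rewrite mulrA ler_wpM2r ?exprn_ge0 ?(ltW s0).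
apply: (@squeeze_cvgr _ _ _ _ (fun=> 0) (fun n => h^-1 * s ^+ n)).
- by apply: nearW => n; rewrite mulr_ge0 ?exprn_ge0//=.
- exact: cvg_cst.
- rewrite -(mulr0 h^-1); apply: cvgM; first exact: cvg_cst.
  by apply: cvg_expr; rewrite gtr0_norm.
Qed.

(* With q = (1 - c) / 2 in [0, 1], the power (1 - q ^ n) ^ (n 2 ^ n) is at least
   1 - n (2 q) ^ n and at most 1 / (1 + n (2 q) ^ n), and 2 q < 1 iff c > 0. *)
Definition threshold_poly n : {poly R} :=
  (1 - (2^-1 *: (1 - 'X)) ^+ n) ^+ (n * 2 ^ n).

Lemma horner_threshold_poly n (c : R) :
  (threshold_poly n).[c] = (1 - ((1 - c) / 2) ^+ n) ^+ (n * 2 ^ n).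
Proof.
by rewrite /threshold_poly !hornerE [_ * 2^-1]mulrC.
Qed.

Lemma threshold_poly_bound n (c : R) : -1 <= c <= 1 ->
  0 <= (threshold_poly n).[c] <= 1.
Proof.
move=> /andP[c0 c1]; rewrite horner_threshold_poly.
have q0 : 0 <= (1 - c) / 2 by lra.
have q1 : (1 - c) / 2 <= 1 by lra.
have a0 := exprn_ge0 n q0; have a1 := exprn_ile1 n q0 q1.
by rewrite exprn_ge0 ?subr_ge0//= exprn_ile1// ?subr_ge0// gerBl.
Qed.

(** The delicate value is [c = 0], where 2 q = 1: the exponent 2^n alone would give the limit 1 / e,
    and the extra factor [n] in it forces the limit 0. *)
Lemma cvg_threshold_poly (c : R) : -1 <= c <= 1 ->
  (threshold_poly n).[c] @[n --> \oo] --> ((0 < c)%R%:R : R).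
Proof.
move=> cb; have /andP[c0 c1] := cb.
set q := (1 - c) / 2.
have q0 : 0 <= q by rewrite /q; lra.
have q1 : q <= 1 by rewrite /q; lra.
have E n : (threshold_poly n).[c] = (1 - q ^+ n) ^+ (n * 2 ^ n).
  exact: horner_threshold_poly.
have mE n : (n * 2 ^ n)%:R * q ^+ n = n%:R * (2 * q) ^+ n :> R.
  by rewrite natrM natrX [in RHS]exprMn -mulrA.
have [cp|cn] := ltP 0 c.
  apply: (@squeeze_cvgr _ _ _ _ (fun n => 1 - n%:R * (2 * q) ^+ n) (fun=> 1)).
  - apply: nearW => n; have /andP[_ ->] := threshold_poly_bound n cb.
    rewrite andbT E -mE; apply: bernoulliB.
    by rewrite exprn_ge0// exprn_ile1.
  - rewrite -[X in _ --> X]subr0; apply: cvgB; first exact: cvg_cst.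
    by apply: cvg_nat_geometric; rewrite mulr_ge0//= /q; lra.
  - exact: cvg_cst.
apply: (@squeeze_cvgr _ _ _ _ (fun=> 0) (fun n => n.+1%:R^-1)).
- apply: nearW => n; have /andP[-> _] /= := threshold_poly_bound n cb.
  rewrite E; set m := (n * 2 ^ n)%N.
  have a0 := exprn_ge0 n q0; have a1 := exprn_ile1 n q0 q1.
  have : (1 - q ^+ n) ^+ m * (1 + q ^+ n) ^+ m <= 1.
    rewrite -exprMn exprn_ile1//; first by rewrite mulr_ge0// ?subr_ge0// addr_ge0.
    by have := sqr_ge0 (q ^+ n); rewrite expr2; lra.
  have p0 : 0 <= (1 - q ^+ n) ^+ m by rewrite exprn_ge0// subr_ge0.
  have bb : n.+1%:R <= (1 + q ^+ n) ^+ m.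
    apply: le_trans (bernoulli m a0); rewrite mE -natr1 addrC lerD2l.
    rewrite ler_peMr// exprn_ege1// /q; lra.
  move=> h; rewrite -[leRHS]mul1r ler_pdivlMr//; apply: le_trans h.
  by rewrite ler_wpM2l.
- exact: cvg_cst.
- exact: cvg_harmonic.
Qed.

End threshold.

(** * Sets where finitely many cosines are positive *)

Section trigonometric_sets.
Variables (R : realType) (d : nat) (rho : R).
Hypothesis rho_gt0 : 0 < rho.
Local Notation mu := (lebesgue_row R d).

Definition wave_ok (e : 'I_d * R * R) : bool := 0 <= e.1.2 <= rho.

Definition trig_pos (l : seq ('I_d * R * R)) : set 'rV[R]_d :=
  [set x | forall e, e \in l -> 0 < trig e x].

Definition trig_sets : set (set 'rV[R]_d) :=
  [set A | exists2 l, all wave_ok l & A = trig_pos l].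

Lemma measurable_trig_pos l : measurable (trig_pos l).
Proof.
rewrite (_ : trig_pos l = \big[setI/setT]_(e <- l) ((fun x => trig e x) @^-1` `]0, +oo[)).
  apply: bigsetI_measurable => e _; rewrite -[X in measurable X]setTI.
  by have [m _] := bmeas_trig e; exact: m.
apply/seteqP; split => x; rewrite -bigcap_seq => h e /=.
  by move=> el; rewrite in_itv /= andbT; exact: h.
by move=> el; have := h e el; rewrite /= in_itv /= andbT.
Qed.

(* x_i < a iff sin (rho (a - x_i) / (n + 1)) > 0 for all large n. *)
Lemma trig_sets_coor (i : 'I_d) (a : R) :
  <<s trig_sets >> [set x : 'rV[R]_d | x ord0 i < a].
Proof.
pose e n : 'I_d * R * R := (i, rho / n.+1%:R, pi / 2 - rho / n.+1%:R * a).
have eok n : wave_ok (e n).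
  by rewrite /wave_ok /= divr_ge0 ?(ltW rho_gt0)//= ler_pdivrMr// ler_peMr ?(ltW rho_gt0)// ler1n.
have trigE n (x : 'rV[R]_d) : trig (e n) x = sin (rho / n.+1%:R * (a - x ord0 i)).
  rewrite /trig /= (_ : _ + _ = rho / n.+1%:R * (x ord0 i - a) + pi / 2).
    by rewrite cosDpihalf -sinN -mulrN opprB.
  by move: (rho / _) => b; ring.
have -> : [set x : 'rV[R]_d | x ord0 i < a] =
    \bigcup_N \bigcap_(n in [set n | (N <= n)%N]) trig_pos [:: e n].
  have small (u : R) : 0 <= u -> \forall n \near \oo, rho / n.+1%:R * u < pi.
    move=> u0.
    have : rho * u * n.+1%:R^-1 @[n --> \oo] --> rho * u * 0.
      by apply: cvgM; [exact: cvg_cst|exact: cvg_harmonic].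
    rewrite mulr0 => /cvgr_lt/(_ _ (pi_gt0 R)); apply: filterS => n.
    by rewrite mulrAC.
  have rn n : 0 < rho / n.+1%:R by rewrite divr_gt0.
  apply/seteqP; split => x /=.
    move=> xa; have [|N _ HN] := small (a - x ord0 i); first by rewrite subr_ge0 ltW.
    exists N => // n /= Nn e' /[!inE] /eqP ->.
    by rewrite trigE sin_gt0_pi// HN// mulr_gt0// subr_gt0.
  move=> [N _ HN]; rewrite ltNge; apply/negP => ax.
  have [|N' _ HN'] := small (x ord0 i - a); first by rewrite subr_ge0.
  have := HN (maxn N N') (leq_maxl _ _) (e (maxn N N')) (mem_head _ _).
  rewrite trigE -opprB mulrN sinN oppr_gt0 ltNge sin_ge0_pi//.
  by rewrite mulr_ge0 ?subr_ge0 ?(ltW (rn _))//= ltW// HN'//= leq_maxr.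
apply: sigma_algebra_bigcup => N.
apply: (@bigcap_measurable _ (g_sigma_algebraType trig_sets)); first by exists N => /=.
move=> n _; apply: sub_sigma_algebra; exists [:: e n] => //.
by rewrite /= eok.
Qed.

Lemma measurable_row_trig_sets :
  @measurable _ 'rV[R]_d = <<s trig_sets >>.
Proof.
apply/seteqP; split; last first.
  apply: smallest_sub; first exact: sigma_algebra_measurable.
  by move=> _ [l _ ->]; exact: measurable_trig_pos.
apply: smallest_sub; first exact: smallest_sigma_algebra.
rewrite -bigcup_seq => A [i _] [B mB <-].
have : measurable_fun [set: g_sigma_algebraType trig_sets]
    (fun x : 'rV[R]_d => x ord0 i : measurableTypeR R).
  apply: (measurability _ (RGenInftyO.measurableE R)).
  move=> _ [_ [a ->] <-]; rewrite setTI.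
  have := trig_sets_coor i a.
  rewrite (_ : [set x : 'rV[R]_d | x ord0 i < a] =
    (fun x : 'rV[R]_d => x ord0 i) @^-1` `]-oo, a[%classic)//.
by move=> h; exact: (h measurableT B mB).
Qed.

Lemma trig_sets_setI : setI_closed trig_sets.
Proof.
move=> _ _ [l hl ->] [l' hl' ->]; exists (l ++ l'); first by rewrite all_cat hl.
apply/seteqP; split=> x.
  by move=> [h h'] e; rewrite mem_cat => /orP[]; [exact: h|exact: h'].
by move=> h; split=> e el; apply: h; rewrite mem_cat el ?orbT.
Qed.

Variable f : 'rV[R]_d -> R.
Hypothesis intf : mu.-integrable setT (EFin \o f).
Hypothesis trig0 : forall l, all wave_ok l -> pairing mu f (trigs l) = 0.

(** Cosines become indicators one at a time. Keeping [l] arbitrary lets powers of the next cosine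
    join it as repeated factors, so every polynomial in that cosine pairs to zero; the threshold
    polynomials then converge boundedly to the indicator. *)
Lemma pairing_trig_pos0 S l : all wave_ok S -> all wave_ok l ->
  pairing mu f (fun x => \1_(trig_pos S) x * trigs l x) = 0.
Proof.
elim: S l => [|e S IH] l.
  move=> _ hl; rewrite -(trig0 hl); apply: eq_pairing => x.
  by rewrite indicE mem_set ?mul1r.
move=> /= /andP[he hS] hl.
have bS : bmeas (\1_(trig_pos S) : 'rV[R]_d -> R) := bmeas_indic (measurable_trig_pos S).
have bh k : bmeas (fun x => \1_(trig_pos S) x * (trigs l x * trig e x ^+ k)).
  apply: bmeasM => //; apply: bmeasM; first exact: bmeas_trigs.
  by apply: bmeasX; exact: bmeas_trig.
have H k : pairing mu f (fun x => \1_(trig_pos S) x * (trigs l x * trig e x ^+ k)) = 0.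
  rewrite -(IH (nseq k e ++ l) hS); last by rewrite all_cat hl all_nseq he orbT.
  apply: eq_pairing => x; congr (_ * _); rewrite /trigs big_cat /= mulrC; congr (_ * _).
  by elim: k => [|k IHk]; rewrite ?big_nil ?big_cons ?exprS -?IHk.
pose h n x := \1_(trig_pos S) x * (trigs l x * (threshold_poly R n).[trig e x]).
have hE n x : h n x = \sum_(k < size (threshold_poly R n))
    (threshold_poly R n)`_k * (\1_(trig_pos S) x * (trigs l x * trig e x ^+ k)).
  rewrite /h horner_coef !mulr_sumr; apply: eq_bigr => k _.
  by ring.
have h0 n : pairing mu f (h n) = 0.
  rewrite (eq_pairing _ _ (hE n)) (pairing_sum intf)//.
  by rewrite big1// => k _; rewrite H mulr0.
have cb x : -1 <= trig e x <= 1 by rewrite cos_geN1 cos_le1.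
have : pairing mu f (h n) @[n --> \oo] -->
    pairing mu f (fun x => \1_(trig_pos (e :: S)) x * trigs l x).
  have [ml [K HK]] := bmeas_trigs l.
  apply: (pairing_cvg intf (K := K)) => [n|n x|x].
  - rewrite (_ : h n = fun x => \sum_(k < size (threshold_poly R n))
      (threshold_poly R n)`_k * (\1_(trig_pos S) x * (trigs l x * trig e x ^+ k))).
      have [//] := bmeas_sum (index_enum 'I_(size (threshold_poly R n)))
        (fun k : 'I_(size (threshold_poly R n)) => bmeasM (bmeas_cst (threshold_poly R n)`_k) (bh k)).
    by apply/funext => x; exact: hE.
  - rewrite /h !normrM; apply: le_trans (HK x).
    have /andP[t0 t1] := threshold_poly_bound n (cb x).
    rewrite (ger0_norm t0) indicE ger0_norm//.
    case: (x \in _); rewrite ?mul1r ?mul0r//.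
    by rewrite ler_piMr.
  - have -> : \1_(trig_pos (e :: S)) x * trigs l x =
        \1_(trig_pos S) x * (trigs l x * (0 < trig e x)%R%:R).
      rewrite [in RHS](mulrC (trigs l x)) mulrA; congr (_ * _).
      rewrite !indicE; have [xe|xe] := boolP (0 < trig e x).
        rewrite mulr1; congr (_%:R); congr nat_of_bool.
        apply/idP/idP; rewrite !inE => pe e' el.
          by apply: pe; rewrite inE el orbT.
        by move: el; rewrite inE => /orP[/eqP ->//|]; exact: pe.
      rewrite mulr0 memNset// => pe; move/negP: xe; apply; apply: pe; exact: mem_head.
    apply: cvgM; first exact: cvg_cst; apply: cvgM; first exact: cvg_cst.
    exact: cvg_threshold_poly.
rewrite (_ : (fun n => _) = fun=> 0); last by apply/funext => n; exact: h0.
by move/(cvg_unique (@Rhausdorff R) (cvg_cst 0)) => <-.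
Qed.

Lemma trig_pairings_ae0 : {ae mu, forall x, f x = 0}.
Proof.
apply: (pairing_generated intf measurable_row_trig_sets trig_sets_setI).
  by exists [::] => //; apply/seteqP; split.
move=> _ [S hS ->]; rewrite -(@pairing_trig_pos0 S [::] hS isT).
by apply: eq_pairing => x; rewrite /trigs big_nil mulr1.
Qed.

End trigonometric_sets.

Lemma moments0_ae0 (R : realType) (d : nat) (gamma : R) (f : 'rV[R]_d -> R)
  (L : ('rV[R]_d -> R) -> R) : 0 < gamma -> dual_rep gamma f L ->
  (forall w, L (@monomial R d w) = 0) ->
  {ae lebesgue_row R d, forall x, f x = 0}.
Proof.
move=> g0 repL m0; pose rho := Num.min 1 (gamma / 4).
have rho0 : 0 < rho by rewrite lt_min ltr01 divr_gt0.
apply: (@trig_pairings_ae0 R d rho rho0 f (dual_rep_integrable repL)) => l hl.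
apply: (pairing_trigs0 g0 repL m0) => e /(allP hl).
by rewrite /wave_ok /rho le_min => /and3P[-> -> ->].
Qed.

(** * Asymptotics of the blurred function *)

Section taylor.
Variables (R : realType) (d : nat).
Implicit Types (psi : 'rV[R]_d -> R) (x h y : 'rV[R]_d).
Local Notation D j psi := (pderivs [:: j] psi).
Local Arguments pderivs : simpl never.

(** The k-th directional derivative (h . grad)^k psi at [x], that is, k! times the Taylor term of
    degree [k]. *)
Fixpoint taylorQ (k : nat) psi x h : R :=
  if k is k'.+1 then \sum_j h ord0 j * taylorQ k' (D j psi) x h else psi x.

Fixpoint tayrem (k : nat) psi x h : R :=
  if k is k'.+1 then tayrem k' psi x h - taylorQ k' psi x h / k'`!%:R
  else psi (x + h).

Lemma taylorQ_homogeneous k psi x (c : R) h :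
  taylorQ k psi x (c *: h) = c ^+ k * taylorQ k psi x h.
Proof.
elim: k psi => [|k IH] psi; first by rewrite expr0 mul1r.
rewrite /= mulr_sumr; apply: eq_bigr => j _.
by rewrite IH mxE exprS; ring.
Qed.

Lemma has_partials_taylorQ k psi x : smooth psi ->
  has_partials (taylorQ k psi x) (fun i h => k%:R * taylorQ k.-1 (D i psi) x h).
Proof.
elim: k psi => [|k IH] psi spsi.
  by apply: has_partials_eq (has_partials_cst (psi x)) => // i h; rewrite mul0r.
have hs := has_partials_sum (index_enum 'I_d) (fun j =>
  has_partialsM (@has_partials_coor R d j) (IH _ (smooth_pderivs [:: j] spsi))).
move: hs; apply: has_partials_eq => // i h; rewrite big_split /= (bigD1 i)//= big1 => [|j ji]; last first.
  by rewrite eq_sym (negbTE ji) mul0r.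
rewrite eqxx mul1r addr0 -natr1 mulrDl mul1r addrC; congr (_ + _).
case: k IH => [|k] _; first by rewrite mul0r big1// => j _; rewrite mul0r mulr0.
rewrite [in RHS]/= mulr_sumr; apply: eq_bigr => j _; rewrite mulrCA.
have E : D i (D j psi) = D j (D i psi) := pderivs_swap i j spsi.
by rewrite E.
Qed.

(** A derivative in [h] of a remainder is the remainder of one order less for a partial derivative
    of [psi]; at order 0 the predecessor 0 is correct, since that remainder is [psi (x + h)]. *)
Lemma has_partials_tayrem k psi x : smooth psi ->
  has_partials (tayrem k psi x) (fun i h => tayrem k.-1 (D i psi) x h).
Proof.
move=> spsi; elim: k => [|k IH].
  apply: has_partials_eq (has_partials_shift x (smooth_has_partials spsi)) => [h|i h].
    by rewrite addrC.
  by rewrite /= addrC.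
have hs := has_partialsB IH (has_partialsZ (k`!%:R^-1) (has_partials_taylorQ k x spsi)).
apply: has_partials_eq hs => [h|i h]; first by rewrite /= mulrC.
case: k IH => [|k] IH; first by rewrite mul0r mulr0 subr0.
rewrite [RHS]/=; congr (_ - _).
have f0 : k`!%:R != 0 :> R by rewrite pnatr_eq0 -lt0n fact_gt0.
have p0 : k.+1%:R != 0 :> R by rewrite pnatr_eq0.
by rewrite factS natrM invfM /=; move: (taylorQ k _ _ _) => q; field; rewrite ?p0 ?f0 ?nat1r ?p0.
Qed.

Lemma tayremS0 k psi x : tayrem k.+1 psi x 0 = 0.
Proof.
elim: k => [|k IH]; first by rewrite /= addr0 divr1 subrr.
rewrite -[LHS]/(tayrem k.+1 psi x 0 - _) IH sub0r /= big1 ?mul0r ?oppr0// => j _.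
by rewrite mxE mul0r.
Qed.

(** Remainders of positive order vanish at [h = 0], so the mean value theorem gains one factor |h|
    per order. *)
Lemma tayrem_bound k psi (r rho : R) : 0 < r -> tame psi ->
  exists2 C, 0 <= C & forall x h, enorm x <= rho ->
    `|tayrem k psi x h| <= C * enorm h ^+ k * expR (r * enorm h).
Proof.
move=> r0; elim: k psi => [|k IH] psi tpsi.
  have [M jM] := tpsi r r0 0.
  have M0 := jet_le_ge0 jM.
  exists (M * expR (r * rho)); first by rewrite mulr_ge0// expR_ge0.
  move=> x h xr; rewrite expr0 mulr1; apply: (le_trans (jet_le_bound _ jM)).
  rewrite -mulrA ler_wpM2l// -expRD ler_expR -mulrDr ler_wpM2l ?(ltW r0)//.
  by apply: (le_trans (enormD _ _)); rewrite lerD2r.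
have spsi := tame_smooth tpsi.
have /choice[C HC] : forall j : 'I_d, exists C, 0 <= C /\ forall x h, enorm x <= rho ->
    `|tayrem k (D j psi) x h| <= C * enorm h ^+ k * expR (r * enorm h).
  move=> j; have [C C0 HC] := IH _ (tame_pderivs [:: j] tpsi).
  by exists C.
exists (\sum_j C j); first by rewrite sumr_ge0// => j _; have [] := HC j.
move=> x h xr.
have [t /andP[t0 t1]] := mean_value 0 h (has_partials_tayrem k.+1 x spsi).
rewrite !add0r tayremS0 subr0 => ->; apply: (le_trans (ler_norm_sum _ _ _)).
rewrite !mulr_suml; apply: ler_sum => j _; have [C0 {}HC] := HC j.
rewrite normrM exprSr; apply: (@le_trans _ _ (enorm h * (C j * enorm h ^+ k * expR (r * enorm h)))).
  apply: ler_pM => //; first exact: coor_le_enorm.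
  apply: (le_trans (HC x _ xr)).
  have th : enorm (t *: h) <= enorm h.
    by rewrite enormZ ger0_norm// ler_piMl ?enorm_ge0.
  apply: ler_pM; rewrite ?mulr_ge0 ?exprn_ge0 ?enorm_ge0 ?expR_ge0//.
    by rewrite ler_wpM2l// lerXn2r ?nnegrE ?enorm_ge0.
  by rewrite ler_expR ler_wpM2l// ltW.
by rewrite le_eqVlt; apply/orP; left; apply/eqP; ring.
Qed.

Lemma enorm_exp_le k (r : R) : 0 < r ->
  exists2 c : R, 0 <= c & forall y, enorm y ^+ k <= c * expR (r * enorm y).
Proof.
move=> r0; elim: k r r0 => [|k IH] r r0.
  exists 1 => // y; rewrite expr0 mul1r -[leLHS]expR0 ler_expR.
  by rewrite mulr_ge0 ?enorm_ge0 ?ltW.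
have r2 : 0 < r / 2 by rewrite divr_gt0.
have [c c0 Hc] := IH _ r2.
exists ((r / 2)^-1 * c); first by rewrite mulr_ge0// invr_ge0 ltW.
move=> y; rewrite exprS.
have -> : expR (r * enorm y) = expR (r / 2 * enorm y) * expR (r / 2 * enorm y).
  by rewrite -expRD; congr expR; field.
rewrite mulrACA; apply: ler_pM; rewrite ?exprn_ge0 ?enorm_ge0//.
exact: enorm_le_expR.
Qed.

Lemma tayrem_scaled_bound k psi (r rho : R) : 0 < r -> tame psi ->
  exists2 C, 0 <= C & forall (s : R) x y, 0 <= s <= 1 -> enorm x <= rho ->
    `|tayrem k psi x (- s *: y)| <= C * s ^+ k * expR (r * enorm y).
Proof.
move=> r0 tpsi; have r2 : 0 < r / 2 by rewrite divr_gt0.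
have [C0 C00 HC0] := tayrem_bound k rho r2 tpsi.
have [c c0 Hc] := enorm_exp_le k r2.
exists (C0 * c); first exact: mulr_ge0.
move=> s x y /andP[s0 s1] xr; apply: (le_trans (HC0 x _ xr)).
rewrite enormZ normrN ger0_norm// exprMn.
have -> : expR (r * enorm y) = expR (r / 2 * enorm y) * expR (r / 2 * enorm y).
  by rewrite -expRD; congr expR; field.
have -> : C0 * c * s ^+ k * (expR (r / 2 * enorm y) * expR (r / 2 * enorm y)) =
  C0 * (s ^+ k * (c * expR (r / 2 * enorm y))) * expR (r / 2 * enorm y) by ring.
apply: ler_pM; rewrite ?mulr_ge0 ?exprn_ge0 ?enorm_ge0 ?expR_ge0//.
  by rewrite ler_wpM2l// ler_wpM2l// exprn_ge0.
by rewrite ler_expR ler_wpM2l ?(ltW r2)// ler_piMl ?enorm_ge0.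
Qed.

(** A derivative in [y] lowers the order of the remainder by one but brings out a factor [s], so the
    whole jet keeps the size s^k. *)
Lemma jet_le_tayrem N k psi (r rho : R) : 0 < r -> tame psi ->
  exists2 C, 0 <= C & forall (s : R) x, 0 <= s <= 1 -> enorm x <= rho ->
    jet_le N r (C * s ^+ k) (fun y => tayrem k psi x (- s *: y)).
Proof.
move=> r0; elim: N k psi => [|N IH] k psi tpsi;
  have [C0 C00 b] := tayrem_scaled_bound k rho r0 tpsi.
  by exists C0 => // s x s01 xr; split=> // y; exact: b.
have /choice[C HC] : forall j : 'I_d, exists C, 0 <= C /\
    forall (s : R) x, 0 <= s <= 1 -> enorm x <= rho ->
    jet_le N r (C * s ^+ k.-1) (fun y => tayrem k.-1 (D j psi) x (- s *: y)).
  by move=> j; have [C ? HC] := IH k.-1 _ (tame_pderivs [:: j] tpsi); exists C.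
have C0s : 0 <= \sum_j C j by rewrite sumr_ge0// => j _; have [] := HC j.
exists (C0 + \sum_j C j); first exact: addr_ge0.
move=> s x s01 xr; have /andP[s0 s1] := s01.
have hp := has_partials_affine (- s) 0 (has_partials_tayrem k x (tame_smooth tpsi)).
have -> : (fun y => tayrem k psi x (- s *: y)) = (fun y => tayrem k psi x (- s *: y + 0)).
  by apply/funext => y; rewrite addr0.
apply: (jet_leS hp) => [y|i].
  rewrite addr0; apply: (le_trans (b s x y s01 xr)).
  by rewrite ler_wpM2r ?expR_ge0// ler_wpM2r ?exprn_ge0// lerDl.
have -> : (fun y => - s * tayrem k.-1 (D i psi) x (- s *: y + 0)) =
    (fun y => - s * tayrem k.-1 (D i psi) x (- s *: y)).
  by apply/funext => y; rewrite addr0.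
have [Ci0 HCi] := HC i.
apply: jet_le_mono (jet_leZ (- s) (HCi s x s01 xr)) => //.
rewrite normrN ger0_norm//.
apply: (@le_trans _ _ (C i * s ^+ k)).
  rewrite mulrCA ler_wpM2l//; case: (k) => [|k'] /=; last by rewrite exprS.
  by rewrite mulr1.
rewrite ler_wpM2r ?exprn_ge0// (bigD1 i)//= addrCA lerDl addr_ge0 ?mulr_ge0//.
by rewrite sumr_ge0// => j _; have [] := HC j.
Qed.

End taylor.

(** * The leading term of the blurred function *)

Section leading_term.
Variables (R : realType) (d : nat).
Implicit Types (psi : 'rV[R]_d -> R) (x y : 'rV[R]_d) (w : seq 'I_d).
Local Arguments pderivs : simpl never.

Fixpoint words (m : nat) : seq (seq 'I_d) :=
  if m is m'.+1 then [seq j :: w | j <- enum 'I_d, w <- words m'] else [:: [::]].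

Lemma mem_words m w : (w \in words m) = (size w == m).
Proof.
elim: m w => [|m IH] w; first by rewrite inE; case: w.
apply/allpairsP/idP => [[[j v] /= [_ vm ->]]|].
  by rewrite /= eqSS -IH.
by case: w => [//|j w]; rewrite /= eqSS -IH => wm; exists (j, w); rewrite mem_enum.
Qed.

Lemma taylorQ_words m psi x y : smooth psi ->
  taylorQ m psi x y =
  \sum_(w <- words m) mderiv (word_type w) psi x * monomial w y.
Proof.
elim: m psi => [|m IH] psi spsi.
  by rewrite big_seq1 /monomial big_nil mulr1 mderiv_word_type.
rewrite /= big_allpairs_dep /= big_enum /=; apply: eq_bigr => j _.
rewrite IH; last exact: (smooth_pderivs [:: j]).
rewrite mulr_sumr; apply: eq_bigr => w _.
rewrite /monomial big_cons mulrCA; congr (_ * _).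
rewrite mderiv_word_type; last exact: (smooth_pderivs [:: j]).
by rewrite mderiv_word_type// -pderivs_cat; rewrite (perm_pderivs spsi (s2 := j :: w))// perm_catC.
Qed.

Lemma morder_word_type w : morder (word_type w) = size w.
Proof.
rewrite /morder; elim: w => [|j w IH].
  by rewrite big1// => i _; rewrite ffunE.
rewrite /= -IH -add1n; under eq_bigr do rewrite ffunE /=.
rewrite big_split /=; congr (_ + _)%N; last by apply: eq_bigr => i _; rewrite ffunE.
by rewrite (bigD1 j)//= eqxx big1 ?addn0// => i ij; rewrite eq_sym (negbTE ij).
Qed.

Lemma word_type_surj (a : multiindex d) : exists w, word_type w = a.
Proof.
exists (flatten [seq nseq (a i) i | i <- enum 'I_d]).
by apply/ffunP => i; rewrite ffunE count_mem_flatten_nseq.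
Qed.

Lemma monomial_word_type w w' : word_type w = word_type w' ->
  @monomial R d w = monomial w'.
Proof.
move=> /ffunP E; apply/funext => x; apply: perm_big.
by apply/allP => i _ /=; have := E i; rewrite !ffunE => ->.
Qed.

Variable L : ('rV[R]_d -> R) -> R.

(** The Taylor term is a sum over words; genericity concerns coefficients indexed by multiindices.
    Grouping words by type multiplies each moment by a multinomial coefficient, [word_mult]. *)
Definition moment_coef m (a : multiindex d) : R :=
  \sum_(w <- words m | word_type w == a) L (monomial w).

Definition word_mult m (a : multiindex d) : nat :=
  \sum_(w <- words m | word_type w == a) 1.

Lemma moment_coefE w : moment_coef (size w) (word_type w) =
  (word_mult (size w) (word_type w))%:R * L (monomial w).
Proof.
rewrite /moment_coef /word_mult natr_sum mulr_suml; apply: eq_bigr => v /eqP vw.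
by rewrite mul1r (monomial_word_type vw).
Qed.

Lemma word_mult_gt0 w : (0 < word_mult (size w) (word_type w))%N.
Proof.
have mw : w \in words (size w) by rewrite mem_words.
by rewrite /word_mult (big_rem w)//= eqxx.
Qed.

Lemma nonzero_moment_coef w : L (monomial w) != 0 ->
  nonzero_coefs (size w) (moment_coef (size w)).
Proof.
move=> Lw; exists (word_type w); first exact: morder_word_type.
by rewrite moment_coefE mulf_neq0// pnatr_eq0 -lt0n word_mult_gt0.
Qed.

Lemma order_deriv_moment_coef m psi x :
  order_deriv m (moment_coef m) psi x =
  \sum_(w <- words m) mderiv (word_type w) psi x * L (monomial w).
Proof.
rewrite /order_deriv; pose s := undup [seq word_type w | w <- words m].
rewrite (_ : [set a | morder a = m] = [set` s]); last first.
  apply/seteqP; split=> a /=.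
    move=> am; rewrite mem_undup; have [w wa] := word_type_surj a.
    apply/mapP; exists w => //; rewrite mem_words.
    by rewrite -morder_word_type wa am.
  by rewrite mem_undup => /mapP[w wm ->]; rewrite morder_word_type; apply/eqP; rewrite -mem_words.
rewrite -fsbig_seq; last exact: undup_uniq.
rewrite /moment_coef; under eq_bigr do rewrite mulr_suml big_mkcond /=.
rewrite exchange_big /=; apply: eq_big_seq => w ww.
rewrite (bigD1_seq (word_type w)) ?undup_uniq//=; last first.
  by rewrite mem_undup; apply/mapP; exists w.
rewrite eqxx big1 ?addr0 => [|a aw]; first by rewrite mulrC.
by rewrite eq_sym (negbTE aw).
Qed.

Variables (gamma : R) (f : 'rV[R]_d -> R).
Hypothesis (gamma_gt0 : 0 < gamma) (repL : dual_rep gamma f L).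

Lemma tame_taylorQ m psi x (s : R) : smooth psi ->
  tame (fun y => taylorQ m psi x (s *: y)).
Proof.
move=> spsi; have -> : (fun y => taylorQ m psi x (s *: y)) =
    fun y => s ^+ m * \sum_(w <- words m) mderiv (word_type w) psi x * monomial w y.
  by apply/funext => y; rewrite taylorQ_homogeneous taylorQ_words.
apply: tameZ; apply: tame_sum => w; apply: tameZ; exact: tame_prod_coor.
Qed.

Lemma tame_tayrem m psi x (s : R) : tame psi -> `|s| <= 1 ->
  tame (fun y => tayrem m psi x (s *: y)).
Proof.
move=> tpsi s1; elim: m => [|m IH].
  have := tame_affine x s1 tpsi; congr tame; apply/funext => y /=; by rewrite addrC.
have -> : (fun y => tayrem m.+1 psi x (s *: y)) =
    (fun y => tayrem m psi x (s *: y) - m`!%:R^-1 * taylorQ m psi x (s *: y)).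
  by apply/funext => y /=; rewrite [_ / _]mulrC.
apply: tameB => //; apply: tameZ; apply: tame_taylorQ; exact: tame_smooth.
Qed.

Lemma dual_rep_taylorQ m psi x (s : R) : smooth psi ->
  L (fun y => taylorQ m psi x (s *: y)) =
  s ^+ m * order_deriv m (moment_coef m) psi x.
Proof.
move=> spsi; rewrite order_deriv_moment_coef.
rewrite (dual_rep_eq L (psi := fun y => s ^+ m *
  \sum_(w <- words m) mderiv (word_type w) psi x * monomial w y)).
  rewrite (dual_repZ repL).
    by rewrite (dual_rep_sum repL)// => w; exact: tame_prod_coor.
  by apply: tame_sum => w; apply: tameZ; exact: tame_prod_coor.
by move=> y; rewrite taylorQ_homogeneous taylorQ_words.
Qed.

(* f * psi_sigma up to a scalar factor and the rescaling of x by sigma = 1 / s. *)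
Definition smear psi (s : R) x : R := L (fun y => psi (x - s *: y)).

Lemma smear_tayrem n psi (s : R) x : tame psi -> 0 <= s <= 1 ->
  (forall w, (size w < n)%N -> L (monomial w) = 0) ->
  smear psi s x = L (fun y => tayrem n psi x (- s *: y)).
Proof.
move=> tpsi /andP[s0 s1]; have ns : `|- s| <= 1 by rewrite normrN ger0_norm.
elim: n => [|n IH] H.
  by apply: dual_rep_eq => y /=; rewrite scaleNr.
have spsi := tame_smooth tpsi.
transitivity (L (fun y => tayrem n psi x (- s *: y) -
    n`!%:R^-1 * taylorQ n psi x (- s *: y))); last first.
  by apply: dual_rep_eq => y /=; rewrite [n`!%:R^-1 * _]mulrC.
rewrite (dual_repB repL); [|exact: tame_tayrem|by apply: tameZ; exact: tame_taylorQ].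
rewrite (dual_repZ repL); last exact: tame_taylorQ.
rewrite dual_rep_taylorQ// order_deriv_moment_coef big_seq big1 => [|w].
  by rewrite !mulr0 subr0 IH// => w wn; apply: H; exact: ltnW.
by rewrite mem_words => /eqP wn; rewrite H ?wn// mulr0.
Qed.

(** Taylor terms below order [n] are killed by the vanishing moments, term [n] gives the main part,
    and the remainder of order [n + 1] is controlled by [jet_le_tayrem] and the continuity of
    [L]. *)
Lemma smear_asymptotics n psi (rho : R) : tame psi ->
  (forall w, (size w < n)%N -> L (monomial w) = 0) ->
  exists2 K, 0 <= K & forall s x, 0 <= s <= 1 -> enorm x <= rho ->
    `|smear psi s x - (- s) ^+ n / n`!%:R * order_deriv n (moment_coef n) psi x|
      <= K * s ^+ n.+1.
Proof.
move=> tpsi H; have [C [N [C0 bL]]] := dual_rep_bound repL.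
have [K K0 HK] := jet_le_tayrem N n.+1 rho gamma_gt0 tpsi.
exists (C * K) => [|s x s01 xr]; first exact: mulr_ge0.
have /andP[s0 s1] := s01; have ns : `|- s| <= 1 by rewrite normrN ger0_norm.
have spsi := tame_smooth tpsi.
rewrite (smear_tayrem (n := n))//.
rewrite (_ : _ - _ = L (fun y => tayrem n.+1 psi x (- s *: y))).
  rewrite -mulrA; apply: bL; [exact: tame_tayrem|exact: HK].
transitivity (L (fun y => tayrem n psi x (- s *: y) -
    n`!%:R^-1 * taylorQ n psi x (- s *: y))); last first.
  by apply: dual_rep_eq => y /=; rewrite [n`!%:R^-1 * _]mulrC.
rewrite (dual_repB repL); [|exact: tame_tayrem|by apply: tameZ; exact: tame_taylorQ].
rewrite (dual_repZ repL); last exact: tame_taylorQ.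
by rewrite dual_rep_taylorQ// mulrA [n`!%:R^-1 * _]mulrC.
Qed.

Lemma translate_bound psi (r rho : R) : 0 < r -> tame psi ->
  exists2 C, 0 <= C & forall (s : R) x v y, 0 <= s <= 1 -> enorm x <= rho -> enorm v <= 1 ->
    `|psi (- s *: y + (x + v)) - psi (- s *: y + x)| <=
      C * enorm v * expR (r * enorm y).
Proof.
move=> r0 tpsi.
have /choice[M HM] : forall j : 'I_d, exists M, jet_le 0 r M (pderivs [:: j] psi).
  by move=> j; exact: (tame_pderivs [:: j] tpsi).
have M0 j : 0 <= M j by exact: jet_le_ge0 (HM j).
exists ((\sum_j M j) * expR (r * (rho + 1))).
  by rewrite mulr_ge0 ?expR_ge0// sumr_ge0.
move=> s x v y /andP[s0 s1] xr v1; rewrite addrA.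
have [t /andP[t0 t1] ->] := mean_value (- s *: y + x) v
  (smooth_has_partials (tame_smooth tpsi)).
apply: (le_trans (ler_norm_sum _ _ _)); rewrite !mulr_suml; apply: ler_sum => j _.
have -> : M j * expR (r * (rho + 1)) * enorm v * expR (r * enorm y) =
    enorm v * (M j * expR (r * (enorm y + (rho + 1)))).
  have -> : expR (r * (enorm y + (rho + 1))) = expR (r * enorm y) * expR (r * (rho + 1)).
    by rewrite -expRD -mulrDr.
  by ring.
rewrite normrM; apply: ler_pM => //; first exact: coor_le_enorm.
apply: (le_trans (jet_le_bound _ (HM j))); rewrite ler_wpM2l// ler_expR ler_wpM2l ?(ltW r0)//.
apply: (le_trans (enormD _ _)); rewrite addrA; apply: lerD.
  apply: (le_trans (enormD _ _)); apply: lerD => //.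
  by rewrite enormZ normrN ger0_norm// ler_piMl ?enorm_ge0.
rewrite enormZ ger0_norm//; apply: le_trans v1; by rewrite ler_piMl ?enorm_ge0.
Qed.

Lemma jet_le_translate N psi (r rho : R) : 0 < r -> tame psi ->
  exists2 C, 0 <= C & forall s x v, 0 <= s <= 1 -> enorm x <= rho -> enorm v <= 1 ->
    jet_le N r (C * enorm v)
      (fun y : 'rV[R]_d => psi (- s *: y + (x + v)) - psi (- s *: y + x)).
Proof.
move=> r0; elim: N psi => [|N IH] psi tpsi;
  have [C0 C00 b] := translate_bound rho r0 tpsi.
  by exists C0 => // s x v s01 xr v1; split=> // y; exact: b.
have /choice[C HC] : forall j : 'I_d, exists C, 0 <= C /\
    forall s x v, 0 <= s <= 1 -> enorm x <= rho -> enorm v <= 1 ->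
    jet_le N r (C * enorm v) (fun y : 'rV[R]_d =>
      pderivs [:: j] psi (- s *: y + (x + v)) - pderivs [:: j] psi (- s *: y + x)).
  by move=> j; have [C ? HC] := IH _ (tame_pderivs [:: j] tpsi); exists C.
have C0s : 0 <= \sum_j C j by rewrite sumr_ge0// => j _; have [] := HC j.
exists (C0 + \sum_j C j); first exact: addr_ge0.
move=> s x v s01 xr v1; have /andP[s0 s1] := s01.
have hD := smooth_has_partials (tame_smooth tpsi).
have hp := has_partialsB (has_partials_affine (- s) (x + v) hD) (has_partials_affine (- s) x hD).
apply: (jet_leS hp) => [y|i].
  apply: (le_trans (b s x v y s01 xr v1)).
  by rewrite ler_wpM2r ?expR_ge0// ler_wpM2r ?enorm_ge0// lerDl.
have [Ci0 HCi] := HC i.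
have -> : (fun y => - s * pderivs [:: i] psi (- s *: y + (x + v)) -
      - s * pderivs [:: i] psi (- s *: y + x)) =
    (fun y => - s * (pderivs [:: i] psi (- s *: y + (x + v)) - pderivs [:: i] psi (- s *: y + x))).
  by apply/funext => y; rewrite mulrBr.
apply: jet_le_mono (jet_leZ (- s) (HCi s x v s01 xr v1)) => //.
rewrite normrN ger0_norm//.
have Cv : 0 <= C i * enorm v by rewrite mulr_ge0 ?enorm_ge0.
apply: (@le_trans _ _ (C i * enorm v)); first by rewrite ler_piMl.
rewrite ler_wpM2r ?enorm_ge0// (bigD1 i)//= addrCA lerDl addr_ge0//.
by rewrite sumr_ge0// => j _; have [] := HC j.
Qed.

(** Translating [psi] by [v] changes its jets by at most a multiple of |v|, and [L] is bounded in
    jets. The intermediate value theorem relies on this. *)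
Lemma continuous_smear psi (s : R) : tame psi -> 0 <= s <= 1 -> continuous (smear psi s).
Proof.
move=> tpsi s01 x; have [C [N [C0 bL]]] := dual_rep_bound repL.
have [K K0 HK] := jet_le_translate N (enorm x) gamma_gt0 tpsi.
have /andP[s0 s1] := s01; have ns : `|- s| <= 1 by rewrite normrN ger0_norm.
have b v : enorm v <= 1 -> `|smear psi s (x + v) - smear psi s x| <= C * K * enorm v.
  move=> v1; have t1 := tame_affine (x + v) ns tpsi; have t2 := tame_affine x ns tpsi.
  rewrite -mulrA (_ : smear psi s (x + v) - _ =
      L (fun y => psi (- s *: y + (x + v)) - psi (- s *: y + x))).
    by apply: bL; [exact: tameB|exact: HK].
  rewrite (dual_repB repL)//; congr (_ - _); apply: dual_rep_eq => y;
    by rewrite addrC scaleNr.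
suff H : forall e : R, 0 < e -> \forall z \near x, `|smear psi s x - smear psi s z| < e.
  exact: (proj2 (@cvgrPdist_lt _ _ _ (nbhs x) _ (smear psi s) (smear psi s x)) H).
move=> e e0.
(* Balls are for the sup norm; dividing by [d + 1] controls the Euclidean norm. *)
pose q := Num.min 1 (e / (C * K + 1)) / (d%:R + 1).
have CK : 0 < C * K + 1 by rewrite ltr_wpDl// mulr_ge0.
have d1 : 0 < d%:R + 1 :> R by rewrite ltr_wpDl.
have q0 : 0 < q by rewrite divr_gt0// lt_min ltr01 divr_gt0.
apply/nbhs_ballP; exists q => //= z; rewrite -ball_normE /= => zx.
have zv : enorm (z - x) < Num.min 1 (e / (C * K + 1)).
  apply: (le_lt_trans (enorm_le_norm _)).
  rewrite distrC in zx; move: zx; rewrite /q ltr_pdivlMr// => zx.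
  apply: le_lt_trans zx; rewrite mulrC ler_wpM2l// lerDl//.
move: zv; rewrite lt_min => /andP[v1 ve].
have := b (z - x) (ltW v1); rewrite [x + _]addrC subrK distrC => /le_lt_trans; apply.
apply: (@le_lt_trans _ _ ((C * K + 1) * enorm (z - x))).
  by rewrite ler_wpM2r ?enorm_ge0// lerDl.
by rewrite -ltr_pdivlMl// mulrC.
Qed.

End leading_term.

(** * Zero sets *)

Section zero_sets.
Variables (R : realType) (d : nat).
Implicit Types (f psi : 'rV[R]_d -> R) (x y z : 'rV[R]_d).
Implicit Types (L : ('rV[R]_d -> R) -> R).

Definition moments_below L n : Prop :=
  forall w, (size w < n)%N -> L (@monomial R d w) = 0.

Lemma bmeas_test_function psi : test_function psi -> bmeas psi.
Proof.
move=> [spsi cpsi].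
have cont : continuous psi by move=> x; exact: differentiable_continuous (spsi [::] x).
split; first exact: continuous_measurable_row.
have /(@compact_bounded R 'rV[R]_d)[M [_ HM]] := cpsi.
have [K HK] := continuous_bounded_ball (d%:R * (M + 1)) cont.
exists `|K| => x; have [->|px] := eqVneq (psi x) 0; first by rewrite normr0.
apply: le_trans (ler_norm K); apply: HK; apply: (le_trans (enorm_le_norm _)).
rewrite ler_wpM2l//; apply: (HM (M + 1)); first by rewrite ltrDl.
exact: subset_closure.
Qed.

Lemma continuous_order_deriv L n psi : smooth psi ->
  continuous (order_deriv n (moment_coef L n) psi).
Proof.
move=> spsi x.
have -> : order_deriv n (moment_coef L n) psi = (fun x =>
    \sum_(w <- words d n) L (monomial w) * pderivs w psi x).
  apply/funext => z; rewrite order_deriv_moment_coef.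
  by apply: eq_bigr => w _; rewrite mderiv_word_type// mulrC.
have h := has_partials_sum (words d n) (fun w =>
  has_partialsZ (L (monomial w)) (smooth_has_partials (smooth_pderivs w spsi))).
by have [/differentiable_continuous] := h x.
Qed.

Variables (gamma : R) (gamma_gt0 : 0 < gamma).

(** One ball must serve all small [s], because the zero of the other blurred function to be excluded
    moves with [s]. *)
Lemma smear_neq0_near f L n psi x0 : dual_rep gamma f L -> tame psi ->
  moments_below L n -> order_deriv n (moment_coef L n) psi x0 != 0 ->
  exists r s1 : R, [/\ 0 < r, 0 < s1 & forall s z, 0 < s < s1 -> s <= 1 ->
    `|x0 - z| < r -> smear L psi s z != 0].
Proof.
move=> repL tpsi mL E0.
have cE := @continuous_order_deriv L n _ (tame_smooth tpsi).
set E := order_deriv n _ psi in cE E0 *.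
have e0 : 0 < `|E x0| / 2 by rewrite divr_gt0// normr_gt0.
have /cvgrPdist_lt/(_ _ e0)/nbhs_ballP[r /= r0 H] := cE x0.
have [K K0 HK] := smear_asymptotics gamma_gt0 repL (enorm x0 + d%:R * r) tpsi mL.
have n0 : 0 < n`!%:R :> R by rewrite ltr0n fact_gt0.
have K1 : 0 < K + 1 by rewrite ltr_wpDl.
(* On the ball [|E z|] exceeds [|E x0| / 2], so a zero would give |E x0| / (2 n!) < s K after
   division by s^n; [K + 1] keeps the divisor positive. *)
exists r, (`|E x0| / 2 / n`!%:R / (K + 1)); split=> //.
  by rewrite divr_gt0// divr_gt0.
move=> s z /andP[s0 ss] s1 xz; apply/negP => /eqP sz.
have zr : enorm z <= enorm x0 + d%:R * r.
  have -> : z = x0 + - (x0 - z) by rewrite opprB addrC subrK.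
  apply: (le_trans (enormD _ _)); rewrite enormN lerD2l.
  by apply: (le_trans (enorm_le_norm _)); rewrite ler_wpM2l// ltW.
have Ez : `|E x0| / 2 < `|E z|.
  have := H z; rewrite -ball_normE /= => /(_ xz) h.
  have := ler_normD (E x0 - E z) (E z); rewrite subrK; lra.
have s01 : 0 <= s <= 1 by rewrite (ltW s0).
have := HK s z s01 zr; rewrite sz sub0r normrN -/E => h.
have sn : 0 < s ^+ n by rewrite exprn_gt0.
have {}h : s ^+ n * (`|E z| / n`!%:R) <= s ^+ n * (s * K).
  move: h; rewrite !normrM normfV normrX normrN (gtr0_norm s0) (gtr0_norm n0).
  by rewrite exprSr (mulrC K) -!mulrA (mulrC n`!%:R^-1).
move: h; rewrite ler_pM2l// => h.
move: ss; rewrite ltr_pdivlMr// => ss.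
have : `|E x0| / 2 / n`!%:R < `|E z| / n`!%:R by rewrite ltr_pM2r// invr_gt0.
lra.
Qed.

Lemma smear_sign f L n psi x0 : dual_rep gamma f L -> tame psi ->
  moments_below L n -> order_deriv n (moment_coef L n) psi x0 != 0 ->
  exists2 s1 : R, 0 < s1 & forall s, 0 < s < s1 -> s <= 1 ->
    0 < (- 1) ^+ n * smear L psi s x0 * order_deriv n (moment_coef L n) psi x0.
Proof.
move=> repL tpsi mL; set E := order_deriv n _ psi x0 => E0.
have [K K0 HK] := smear_asymptotics gamma_gt0 repL (enorm x0) tpsi mL.
have n0 : 0 < n`!%:R :> R by rewrite ltr0n fact_gt0.
have K1 : 0 < K + 1 by rewrite ltr_wpDl.
have E1 : 0 < `|E| by rewrite normr_gt0.
exists (`|E| / n`!%:R / (K + 1)); first by rewrite divr_gt0// divr_gt0.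
move=> s /andP[s0 ss] s1.
have s01 : 0 <= s <= 1 by rewrite (ltW s0).
have := HK s x0 s01 (lexx _); rewrite -/E; set u := smear _ _ _ _ => h.
have sn : 0 < s ^+ n by rewrite exprn_gt0.
have sg1 : (-1) ^+ n * (-1) ^+ n = 1 :> R by rewrite -exprMn mulrNN mulr1 expr1n.
have {}h : `|(-1) ^+ n * u * E - s ^+ n / n`!%:R * E ^+ 2| <= K * s ^+ n.+1 * `|E|.
  have -> : (-1) ^+ n * u * E - s ^+ n / n`!%:R * E ^+ 2 =
      (-1) ^+ n * (u - (- s) ^+ n / n`!%:R * E) * E.
    rewrite -[- s]mulN1r exprMn mulrBr !mulrA sg1 mul1r; ring.
  by rewrite !normrM normrX normrN1 expr1n mul1r ler_wpM2r.
have : K * s ^+ n.+1 * `|E| < s ^+ n / n`!%:R * E ^+ 2.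
  rewrite -(real_normK (num_real E)) expr2 mulrA ltr_pM2r//.
  rewrite exprSr mulrCA -mulrA ltr_pM2l//.
  move: ss; rewrite ltr_pdivlMr// => ss.
  rewrite [ltRHS]mulrC; apply: le_lt_trans ss.
  by rewrite mulrC ler_wpM2l ?(ltW s0)// lerDl.
move: h; rewrite ler_norml => /andP[+ _]; lra.
Qed.

(** The order of choices matters: the ball comes from g, then two points of opposite sign inside it
    from the regular zero, and only then [s]. Convexity keeps the zero found on the segment in the
    ball. *)
Lemma smear_zeros_regular f g LF LG n m psi (s : nat -> R) :
  dual_rep gamma f LF -> dual_rep gamma g LG -> tame psi ->
  moments_below LF n -> moments_below LG m ->
  (forall i, 0 < s i) -> (s i @[i --> \oo] --> (0 : R)) ->
  (forall i x, s i <= 1 -> smear LF psi (s i) x = 0 -> smear LG psi (s i) x = 0) ->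
  regular_zero (order_deriv n (moment_coef LF n) psi) `<=`
    [set x | order_deriv m (moment_coef LG m) psi x = 0].
Proof.
move=> repF repG tpsi mF mG sp s0 sz x0 rx0; apply: contrapT => /eqP Ex.
have [r [s1 [r0 s10 H]]] := smear_neq0_near repG tpsi mG Ex.
have [[y Uy yp] [y' Uy' yn]] := rx0 _ (nbhsx_ballx x0 r r0).
have [s2 s20 H2] := smear_sign repF tpsi mF (lt0r_neq0 yp).
have [s3 s30 H3] := smear_sign repF tpsi mF (ltr0_neq0 yn).
have t0 : 0 < Num.min (Num.min s1 1) (Num.min s2 s3) by rewrite !lt_min s10 ltr01 s20.
have [i _ /(_ i (leqnn _)) /=] : \forall i \near \oo, s i < Num.min (Num.min s1 1) (Num.min s2 s3).
  by apply: cvgr_lt t0.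
rewrite !lt_min => /andP[/andP[is1 i1] /andP[is2 is3]].
have i1' := ltW i1; have si := sp i.
have hp : 0 < (-1) ^+ n * smear LF psi (s i) y.
  by have := H2 (s i); rewrite si is2 => /(_ isT i1'); rewrite pmulr_lgt0.
have hn : (-1) ^+ n * smear LF psi (s i) y' < 0.
  by have := H3 (s i); rewrite si is3 => /(_ isT i1'); rewrite nmulr_lgt0.
pose u (t : R) := (-1) ^+ n * smear LF psi (s i) (t *: (y' - y) + y).
have cu : continuous u.
  move=> t; apply: cvgM; first exact: cvg_cst.
  apply: (@continuous_comp _ _ _ (fun t : R => t *: (y' - y) + y) (smear LF psi (s i))).
    by apply: cvgD; [exact: scalel_continuous|exact: cvg_cst].
  by apply: (continuous_smear gamma_gt0 repF tpsi); rewrite (ltW si).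
have [||t] := @IVT R u 0 1 0 ler01.
- exact: continuous_subspaceT.
- rewrite /u scale0r add0r scale1r subrK.
  by rewrite ge_min le_max (ltW hn) (ltW hp) orbT.
rewrite in_itv /= => /andP[t0' t1] /eqP; rewrite mulf_eq0 signr_eq0 /= => /eqP z0.
have zr : `|x0 - (t *: (y' - y) + y)| < r.
  have -> : x0 - (t *: (y' - y) + y) = (1 - t) *: (x0 - y) + t *: (x0 - y').
    by apply/rowP => j; rewrite !mxE; ring.
  move: Uy Uy'; rewrite -ball_normE /= => a b.
  apply: (le_lt_trans (ler_normD _ _)); rewrite !normrZ (ger0_norm t0') ger0_norm ?subr_ge0//.
  have [->|tn] := eqVneq t 0; first by rewrite subr0 mul1r mul0r addr0.
  have tp : 0 < t by rewrite lt_neqAle eq_sym tn.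
  have h1 : (1 - t) * `|x0 - y| <= (1 - t) * r by rewrite ler_wpM2l ?subr_ge0// ltW.
  have h2 : t * `|x0 - y'| < t * r by rewrite ltr_pM2l.
  lra.
have si1 : 0 < s i < s1 by rewrite si.
by move/eqP: (H (s i) _ si1 i1' zr); apply; exact: sz.
Qed.

Lemma dual_rep_sub f g LF LG (c : R) : dual_rep gamma f LF -> dual_rep gamma g LG ->
  dual_rep gamma (fun x => g x - c * f x) (fun phi => LG phi - c * LF phi).
Proof.
move=> repF repG; split.
- have := integrableB measurableT (dual_rep_integrable repG)
    (integrableZl measurableT c (dual_rep_integrable repF)).
  by apply: eq_integrable => // x _ /=.
- move=> k phi psi tphi tpsi.
  by rewrite (dual_rep_linear repF)// (dual_rep_linear repG)//; ring.
- have [C [N [C0 bF]]] := dual_rep_bound repF.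
  have [C' [N' [C0' bG]]] := dual_rep_bound repG.
  exists (C' + `|c| * C), (maxn N N'); split; first by rewrite addr_ge0// mulr_ge0.
  move=> phi M tphi j.
  have h1 := bF phi M tphi (jet_leW (leq_maxl _ _) j).
  have h2 := bG phi M tphi (jet_leW (leq_maxr _ _) j).
  apply: (le_trans (ler_normB _ _)); rewrite normrM mulrDl; apply: lerD => //.
  by rewrite -mulrA ler_wpM2l.
move=> phi tphi testphi; rewrite (dual_rep_test repF)// (dual_rep_test repG)//.
have bphi := bmeas_test_function testphi.
have iF := bmeas_integrable (dual_rep_integrable repF) bphi.
have iG := bmeas_integrable (dual_rep_integrable repG) bphi.
rewrite -RintegralZl// -RintegralB//.
  by apply: eq_Rintegral => x _; ring.
have := bmeas_integrable (dual_rep_integrable repF) (bmeasM (bmeas_cst c) bphi).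
by apply: eq_integrable => // x _ /=; rewrite mulrCA.
Qed.

Lemma moments_order L : (forall w, L (@monomial R d w) = 0) \/
  exists w0, L (@monomial R d w0) != 0 /\ moments_below L (size w0).
Proof.
have [h|/existsNP[w /eqP Lw]] := pselect (forall w, L (@monomial R d w) = 0); first by left.
right.
have ex : exists n, `[< exists w, size w = n /\ L (@monomial R d w) != 0 >].
  by exists (size w); apply/asboolP; exists w.
case: (ex_minnP ex) => n /asboolP[w0 [<- Lw0]] H; exists w0; split=> // v vw.
apply: contrapT => /eqP Lv; have /H : `[< exists w, size w = size v /\ L (@monomial R d w) != 0 >].
  by apply/asboolP; exists v.
by rewrite leqNgt vw.
Qed.

(** An identically zero derivative of order [m] would have a zero set containing the regular zeros
    of any derivative of order [m + 1], and positive dimension supplies one. *)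
Lemma genericity_order_deriv psi m C : (0 < d)%N -> genericity psi ->
  nonzero_coefs m C -> exists x, order_deriv m C psi x != 0.
Proof.
move=> d0 gpsi mC; apply: contrapT => nex.
pose w : seq 'I_d := nseq m.+1 (Ordinal d0).
have nz : nonzero_coefs m.+1 (fun _ : multiindex d => 1 : R).
  exists (word_type w); last exact: oner_neq0.
  by rewrite morder_word_type size_nseq.
apply: (gpsi m.+1 m _ _ nz mC); first by left => /eqP; rewrite gtn_eqF.
by move=> x _ /=; apply: contrapT => /eqP h; apply: nex; exists x.
Qed.

Lemma smear_ae0 f L psi (s : R) x : dual_rep gamma f L -> tame psi -> 0 <= s <= 1 ->
  {ae lebesgue_row R d, forall x, f x = 0} -> smear L psi s x = 0.
Proof.
move=> repL tpsi /andP[s0 s1] f0; apply: (dual_rep_ae0 gamma_gt0 repL f0).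
have ns : `|- s| <= 1 by rewrite normrN ger0_norm.
have := tame_affine x ns tpsi; congr tame; apply/funext => y.
by rewrite scaleNr addrC.
Qed.

Variables (psi : 'rV[R]_d -> R) (s : nat -> R).
Hypotheses (d_gt0 : (0 < d)%N) (tpsi : tame psi) (psi_gen : genericity psi).
Hypotheses (s_gt0 : forall i, 0 < s i) (s_cvg0 : s i @[i --> \oo] --> (0 : R)).

(** If f vanishes, every point is a zero of its blurs, whereas a nonzero moment of g makes the blurs
    of g nonzero near some point at small scales. *)
Lemma smear_zeros_ae0 f g LF LG : dual_rep gamma f LF -> dual_rep gamma g LG ->
  (forall i x, s i <= 1 -> smear LF psi (s i) x = 0 -> smear LG psi (s i) x = 0) ->
  {ae lebesgue_row R d, forall x, f x = 0} -> {ae lebesgue_row R d, forall x, g x = 0}.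
Proof.
move=> repF repG sz f0; apply: (moments0_ae0 gamma_gt0 repG).
have [//|[w0 [Lw0 mG]]] := moments_order LG.
have [x0 Ex0] := genericity_order_deriv d_gt0 psi_gen (nonzero_moment_coef Lw0).
have [r [s1 [r0 s10 H]]] := smear_neq0_near repG tpsi mG Ex0.
have t0 : 0 < Num.min s1 1 by rewrite lt_min s10 ltr01.
have [i _ /(_ i (leqnn _)) /=] : \forall i \near \oo, s i < Num.min s1 1.
  by apply: cvgr_lt t0.
rewrite lt_min => /andP[is1 i1].
have si1 : 0 < s i < s1 by rewrite s_gt0.
have := H (s i) x0 si1 (ltW i1); rewrite subrr normr0 => /(_ r0) /eqP; case.
apply: sz; first exact: ltW.
by apply: (smear_ae0 x0 repF tpsi) => //; rewrite (ltW (s_gt0 i)) ltW.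
Qed.

(** Genericity yields proportional coefficients; cancelling the positive multinomial factors gives
    proportional moments. Zero sets need only be included one in the other, so the lemma also
    applies to the pair f, g - c f. *)
Lemma smear_zeros_proportional f g LF LG w v :
  dual_rep gamma f LF -> dual_rep gamma g LG ->
  LF (@monomial R d w) != 0 -> moments_below LF (size w) ->
  LG (@monomial R d v) != 0 -> moments_below LG (size v) ->
  (forall i x, s i <= 1 -> smear LF psi (s i) x = 0 -> smear LG psi (s i) x = 0) ->
  size w = size v /\ exists c : R, forall u, size u = size w ->
    LG (@monomial R d u) = c * LF (monomial u).
Proof.
move=> repF repG Lw mF Lv mG sz.
have incl := smear_zeros_regular repF repG tpsi mF mG s_gt0 s_cvg0 sz.
have gen := psi_gen (nonzero_moment_coef Lw) (nonzero_moment_coef Lv).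
have wv : size w = size v by apply: contrapT => ne; apply: gen => //; left.
split=> //; have [c Hc] : proportional (size w) (moment_coef LF (size w))
    (moment_coef LG (size v)).
  by apply: contrapT => ne; apply: gen => //; right.
exists c => u uw; have := Hc (word_type u).
rewrite morder_word_type => /(_ uw); rewrite -wv -uw !moment_coefE mulrCA.
by apply: mulfI; rewrite pnatr_eq0 -lt0n word_mult_gt0.
Qed.

Lemma smear_zeros_unique f g LF LG : dual_rep gamma f LF -> dual_rep gamma g LG ->
  (forall i x, s i <= 1 -> smear LF psi (s i) x = 0 <-> smear LG psi (s i) x = 0) ->
  exists2 c : R, c != 0 & {ae lebesgue_row R d, forall x, g x = c * f x}.
Proof.
move=> repF repG sz.
have szF i x : s i <= 1 -> smear LF psi (s i) x = 0 -> smear LG psi (s i) x = 0.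
  by move=> /(sz i x)[].
have szG i x : s i <= 1 -> smear LG psi (s i) x = 0 -> smear LF psi (s i) x = 0.
  by move=> /(sz i x)[].
have both0 : {ae lebesgue_row R d, forall x, f x = 0} ->
    {ae lebesgue_row R d, forall x, g x = 0} ->
    exists2 c : R, c != 0 & {ae lebesgue_row R d, forall x, g x = c * f x}.
  move=> f0 g0; exists 1; first exact: oner_neq0.
  by apply: filterS2 f0 g0 => x -> ->; rewrite mulr0.
have [F0|[w [Lw mF]]] := moments_order LF.
  have f0 := moments0_ae0 gamma_gt0 repF F0.
  by apply: both0 => //; exact: smear_zeros_ae0 repF repG szF f0.
have [G0|[v [Lv mG]]] := moments_order LG.
  have g0 := moments0_ae0 gamma_gt0 repG G0.
  by apply: both0 => //; exact: smear_zeros_ae0 repG repF szG g0.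
have [wv [c Hc]] := smear_zeros_proportional repF repG Lw mF Lv mG szF.
exists c.
  by apply: contra_neq Lv => c0; rewrite (Hc v (esym wv)) c0 mul0r.
have repH := dual_rep_sub c repF repG.
have H0 : {ae lebesgue_row R d, forall x, g x - c * f x = 0}.
  apply: (moments0_ae0 gamma_gt0 repH).
  have [//|[u [Lu mH]]] := moments_order (fun phi => LG phi - c * LF phi).
  (* A lowest nonzero moment of g - c f would have the order of [w], the very order at which [c]
     cancels all moments. *)
  have [|wu _] := smear_zeros_proportional repF repH Lw mF Lu mH.
    move=> i x i1 F0; have G0 := szF i x i1 F0.
    by move: F0 G0; rewrite /smear => -> ->; rewrite mulr0 subr0.
  by move/eqP: Lu; case; rewrite (Hc u (esym wu)) subrr.
by apply: filterS H0 => x /eqP; rewrite subr_eq0 => /eqP.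
Qed.

End zero_sets.

(** At the point sigma x, psi_sigma (sigma x - y) equals sigma^-d psi (x - y / sigma), so zero sets
    correspond under dilation. The condition [sigma^-1 <= 1] holds for all large indices. *)
Lemma convolution_smear (R : realType) (d : nat) (gamma sigma : R)
  (f psi : 'rV[R]_d -> R) (F : {linear Pgamma d gamma -> R^o}) (Ppsi : P_set psi)
  (g0 : 0 < gamma) (s0 : 0 < sigma) x : Pgamma_dual_L1 f F -> sigma^-1 <= 1 ->
  convolution F Ppsi g0 s0 (sigma *: x) =
  (sigma ^+ d)^-1 * smear (dual_ext F) psi sigma^-1 x.
Proof.
move=> fF s1; have repF := Pgamma_dual_L1_rep g0 fF.
have tpsi := P_set_tame Ppsi.
have ns : `|- sigma^-1| <= 1 by rewrite normrN ger0_norm// invr_ge0 ltW.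
rewrite convolution_dual_ext /smear -(dual_repZ repF); last first.
  have := tame_affine x ns tpsi; congr tame; apply/funext => y.
  by rewrite scaleNr addrC.
apply: dual_rep_eq => y; rewrite /dilate scalerBr scalerA mulVf ?gt_eqF//.
by rewrite scale1r.
Qed.

Theorem theorem1 (R : realType) (d : nat) (d_ge1 : (1 <= d)%N)
  (psi : 'rV[R]_d -> R) (psiP : P_set psi) (psi_gen : genericity psi)
  (gamma : R) (gamma_gt0 : 0 < gamma)
  (sigma : nat -> R) (sigma_gt0 : forall i, 0 < sigma i)
  (sigma_oo : sigma i @[i --> \oo] --> +oo)
  (f g : 'rV[R]_d -> R) (F G : {linear Pgamma d gamma -> R^o})
  (fF : Pgamma_dual_L1 f F) (gG : Pgamma_dual_L1 g G)
  (same_zeros : forall i,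
    [set x | convolution F psiP gamma_gt0 (sigma_gt0 i) x = 0] =
    [set x | convolution G psiP gamma_gt0 (sigma_gt0 i) x = 0]) :
  exists2 c : R, c != 0 &
    {ae lebesgue_row R d, forall x, g x = c * f x}.
Proof.
have tpsi := P_set_tame psiP.
have s_gt0 i : 0 < (sigma i)^-1 by rewrite invr_gt0.
have s_cvg0 : (sigma i)^-1 @[i --> \oo] --> (0 : R).
  by apply/gtr0_cvgV0 => //; exact: nearW.
apply: (smear_zeros_unique gamma_gt0 d_ge1 tpsi psi_gen s_gt0 s_cvg0
  (Pgamma_dual_L1_rep gamma_gt0 fF) (Pgamma_dual_L1_rep gamma_gt0 gG)) => i x i1.
have c0 : (sigma i ^+ d)^-1 != 0 by rewrite invr_eq0 expf_neq0// gt_eqF.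
have zero_smear (h : 'rV[R]_d -> R) (H : {linear Pgamma d gamma -> R^o}) :
    Pgamma_dual_L1 h H -> smear (dual_ext H) psi (sigma i)^-1 x = 0 <->
    convolution H psiP gamma_gt0 (sigma_gt0 i) (sigma i *: x) = 0.
  move=> hH; rewrite (convolution_smear psiP gamma_gt0 (sigma_gt0 i) x hH i1).
  by split => [->|/eqP]; [rewrite mulr0|rewrite mulf_eq0 (negbTE c0) => /eqP].
have := same_zeros i => /seteqP[FG GF].
split; first by move=> /(zero_smear _ _ fF)/FG/(zero_smear _ _ gG).
by move=> /(zero_smear _ _ gG)/GF/(zero_smear _ _ fF).
Qed.
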